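(* Let $k$ be a field, $Q$ a finite quiver, and $A=kQ/I$ a Koszul algebra of global dimension $n$, where $n\ge 2$. For each vertex $v\in Q_0$ let $e_v$ denote the associated idempotent. Then $$\dim_k HH^n(A)\ \ge\ \dim_k\Big(\coprod_{v\in Q_0}e_vK_ne_v\Big),$$ where $K_n\subseteq kQ_n$ is the subspace defined in the context.
   Context: For a finite quiver $Q$, $Q_0$ is the vertex set, $Q_i$ is the set of paths of length $i$, $kQ_i$ is the subspace of the path algebra $kQ$ spanned by $Q_i$ (a $kQ_0$-$kQ_0$ bimodule), and $kQ=\bigoplus_{i\ge0}kQ_i$ is graded by path length. The ideal $I$ is a two-sided ideal of $kQ$ generated by quadratic relations (homogeneous elements of degree two), so that $A=kQ/I$ is a quadratic algebra, graded by path length with $A_0=kQ_0$. Such an $A$ is Koszul if $A_0$, as a graded $A$-module, has a linear graded projective resolution (its $i$-th term is generated in degree $i$ for every $i\ge 0$). Let $R\subseteq kQ_2$ be the $kQ_0$-sub-bimodule of homogeneous elements of degree two in $I$. For $n\ge2$ put $$K_n=\bigcap_{r+s+2=n}kQ_r\cdot R\cdot kQ_s\subseteq kQ_n,$$ the intersection being over integers $r,s\ge0$ with $r+s+2=n$, and $kQ_r\cdot R\cdot kQ_s$ being the span of the products in $kQ$. $HH^n(A)=\mathrm{Ext}^n_{A^e}(A,A)$ is the $n$-th Hochschild cohomology group, with $A^e=A\otimes_kA^{op}$. *)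

(* Defs.v *)
From HB Require Import structures.
From mathcomp Require Import all_boot all_order all_algebra finmap.
From mathcomp.multinomials Require Import monalg.
From mathcomp Require Import boolp.

Set Implicit Arguments.
Unset Strict Implicit.
Unset Printing Implicit Defensive.

Import GRing.Theory.
Local Open Scope ring_scope.

(* An associative unital [k]-algebra is a ring with a ring morphism from [k] to
   its centre.  MathComp's [algType] excludes the zero ring, which is the path
   algebra of the quiver without vertices. *)
HB.mixin Record isKAlgebra (k : fieldType) A of GRing.PzRing A := {
  kscal : k -> A;
  kscal_zmod_morphism : zmod_morphism kscal;
  kscal_monoid_morphism : monoid_morphism kscal;
  kscalC : forall c x, kscal c * x = x * kscal c
}.

#[short(type="kalgType")]
HB.structure Definition KAlgebra (k : fieldType) :=
  { A of isKAlgebra k A & GRing.PzRing A }.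

HB.instance Definition _ (k : fieldType) (A : kalgType k) :=
  GRing.isZmodMorphism.Build k A (@kscal k A) (@kscal_zmod_morphism k A).
HB.instance Definition _ (k : fieldType) (A : kalgType k) :=
  GRing.isMonoidMorphism.Build k A (@kscal k A) (@kscal_monoid_morphism k A).

(* A partial monoid whose identity is split into finitely many local
   identities: [obind] expresses that both bracketings of [x y z] are
   undefined or both are defined and equal, and the last two axioms say that
   exactly one local identity composes with [x] on each side, giving [x]. *)
HB.mixin Record isPMonoid X of Choice X := {
  pmul : X -> X -> option X;
  pids : seq X;
  pmulA : forall x y z,
    obind (fun yz => pmul x yz) (pmul y z) =
    obind (fun xy => pmul xy z) (pmul x y);
  pmul1m : forall x, pmap (fun e => pmul e x) pids = [:: x];
  pmulm1 : forall x, pmap (fun e => pmul x e) pids = [:: x]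
}.

#[short(type="pmonType")]
HB.structure Definition PMonoid := { X of isPMonoid X & Choice X }.

(* The algebra with basis [X]; undefined products of basis elements are 0. *)
Definition pmalg (k : fieldType) (X : pmonType) := {malg k[X]}.

HB.instance Definition _ k X := GRing.Lmodule.on (@pmalg k X).
HB.instance Definition _ k X := Choice.on (@pmalg k X).

Section PMAlg.
Variables (k : fieldType) (X : pmonType).
Implicit Types (f g h : pmalg k X) (x y z : X).

Definition omon (o : option X) : pmalg k X := oapp (fun z => << z >>) 0 o.

Definition pm_mul f g : pmalg k X :=
  \sum_(x <- msupp f) \sum_(y <- msupp g) (f@_x * g@_y) *: omon (pmul x y).

Definition pm_one : pmalg k X := \sum_(e <- pids) << e >>.

Lemma pm_mulEw (d1 d2 : {fset X}) f g :
  (msupp f `<=` d1)%fset -> (msupp g `<=` d2)%fset ->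
  pm_mul f g = \sum_(x <- d1) \sum_(y <- d2) (f@_x * g@_y) *: omon (pmul x y).
Proof.
move=> le1 le2; rewrite /pm_mul (big_fset_incl _ le1) /=; last first.
  by move=> x _ /mcoeff_outdom fx; rewrite big1 // => y _; rewrite fx mul0r scale0r.
apply: eq_bigr => x _; apply: big_fset_incl => // y _ /mcoeff_outdom ->.
by rewrite mulr0 scale0r.
Qed.

Lemma pm_mulDl : left_distributive pm_mul +%R.
Proof.
move=> f g h.
rewrite (@pm_mulEw (msupp f `|` msupp g)%fset (msupp h)) ?msuppD_le ?fsubset_refl //.
rewrite (@pm_mulEw (msupp f `|` msupp g)%fset (msupp h) f) ?fsubsetUl ?fsubset_refl //.
rewrite (@pm_mulEw (msupp f `|` msupp g)%fset (msupp h) g) ?fsubsetUr ?fsubset_refl //.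
rewrite -big_split; apply: eq_bigr => x _ /=; rewrite -big_split.
by apply: eq_bigr => y _ /=; rewrite mcoeffD mulrDl scalerDl.
Qed.

Lemma pm_mulDr : right_distributive pm_mul +%R.
Proof.
move=> h f g.
rewrite (@pm_mulEw (msupp h) (msupp f `|` msupp g)%fset) ?msuppD_le ?fsubset_refl //.
rewrite (@pm_mulEw (msupp h) (msupp f `|` msupp g)%fset h f) ?fsubsetUl ?fsubset_refl //.
rewrite (@pm_mulEw (msupp h) (msupp f `|` msupp g)%fset h g) ?fsubsetUr ?fsubset_refl //.
rewrite -big_split; apply: eq_bigr => x _ /=; rewrite -big_split.
by apply: eq_bigr => y _ /=; rewrite mcoeffD mulrDr scalerDl.
Qed.

Lemma pm_mulZl c f g : c *: pm_mul f g = pm_mul (c *: f) g.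
Proof.
rewrite (@pm_mulEw (msupp f) (msupp g) (c *: f)) ?msuppZ_le ?fsubset_refl //.
rewrite scaler_sumr; apply: eq_bigr => x _; rewrite scaler_sumr.
by apply: eq_bigr => y _; rewrite mcoeffZ scalerA mulrA.
Qed.

Lemma pm_mulZr c f g : c *: pm_mul f g = pm_mul f (c *: g).
Proof.
rewrite (@pm_mulEw (msupp f) (msupp g) f (c *: g)) ?msuppZ_le ?fsubset_refl //.
rewrite scaler_sumr; apply: eq_bigr => x _; rewrite scaler_sumr.
by apply: eq_bigr => y _; rewrite mcoeffZ scalerA mulrCA.
Qed.

Lemma pm_mul0g g : pm_mul 0 g = 0.
Proof. by rewrite /pm_mul msupp0 big_seq_fset0. Qed.

Lemma pm_mulg0 f : pm_mul f 0 = 0.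
Proof. by rewrite -{1}(scale0r (0 : pmalg k X)) -pm_mulZr scale0r. Qed.

Lemma pm_mulUU x y : pm_mul << x >> << y >> = omon (pmul x y).
Proof.
rewrite (@pm_mulEw [fset x]%fset [fset y]%fset) ?msuppU_le //.
by rewrite !big_seq_fset1 !mcoeffUU mulr1 scale1r.
Qed.

Lemma pm_mul_suml (I : Type) (r : seq I) (F : I -> pmalg k X) g :
  pm_mul (\sum_(i <- r) F i) g = \sum_(i <- r) pm_mul (F i) g.
Proof. exact: (big_morph (pm_mul^~ g) (fun _ _ => pm_mulDl _ _ _) (pm_mul0g g)). Qed.

Lemma pm_mul_sumr (I : Type) (r : seq I) (F : I -> pmalg k X) g :
  pm_mul g (\sum_(i <- r) F i) = \sum_(i <- r) pm_mul g (F i).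
Proof. exact: (big_morph (pm_mul g) (fun _ _ => pm_mulDr _ _ _) (pm_mulg0 g)). Qed.

Lemma pmalgE f : f = \sum_(x <- msupp f) f@_x *: (<< x >> : pmalg k X).
Proof.
rewrite {1}[f]monalgE; apply: eq_bigr => x _; apply/malgP => y.
by rewrite mcoeffZ !mcoeffU; case: eqP; rewrite ?mulr1 ?mulr0.
Qed.

Lemma pmalg_ind (P : pmalg k X -> Prop) :
  P 0 -> (forall f g, P f -> P g -> P (f + g)) ->
  (forall c f, P f -> P (c *: f)) -> (forall x, P << x >>) ->
  forall f, P f.
Proof.
move=> P0 PD PZ PU f; rewrite (pmalgE f).
by elim/big_ind: _ => // x _; apply: PZ; apply: PU.
Qed.

Lemma pm_mulA : associative pm_mul.
Proof.
move=> f g h; elim/pmalg_ind: f => [|f f' IH IH'|c f IH|x].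
- by rewrite !pm_mul0g.
- by rewrite !pm_mulDl IH IH'.
- by rewrite -!pm_mulZl IH.
elim/pmalg_ind: g => [|g g' IH IH'|c g IH|y].
- by rewrite pm_mul0g pm_mulg0 pm_mul0g.
- by rewrite !(pm_mulDl, pm_mulDr) IH IH'.
- by rewrite -!(pm_mulZl, pm_mulZr) IH.
elim/pmalg_ind: h => [|h h' IH IH'|c h IH|z].
- by rewrite !pm_mulg0.
- by rewrite !pm_mulDr IH IH'.
- by rewrite -!pm_mulZr IH.
rewrite !pm_mulUU; have := pmulA x y z.
case: (pmul y z) => [yz|]; case: (pmul x y) => [xy|] //=;
  rewrite ?pm_mulUU ?pm_mul0g ?pm_mulg0 // => E; by rewrite ?E // -?E.
Qed.

Lemma omon_pmap (r : seq X) (F : X -> option X) :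
  \sum_(e <- r) omon (F e) = \sum_(x <- pmap F r) << x >>.
Proof.
elim: r => [|e r IH]; rewrite ?big_nil // big_cons IH /=.
by case: (F e) => [x|] /=; rewrite ?big_cons ?add0r.
Qed.

Lemma pm_mul1g : left_id pm_one pm_mul.
Proof.
move=> g; elim/pmalg_ind: g => [|g g' IH IH'|c g IH|y].
- by rewrite pm_mulg0.
- by rewrite pm_mulDr IH IH'.
- by rewrite -pm_mulZr IH.
rewrite pm_mul_suml; under eq_bigr do rewrite pm_mulUU.
by rewrite omon_pmap pmul1m big_seq1.
Qed.

Lemma pm_mulg1 : right_id pm_one pm_mul.
Proof.
move=> g; elim/pmalg_ind: g => [|g g' IH IH'|c g IH|y].
- by rewrite pm_mul0g.
- by rewrite pm_mulDl IH IH'.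
- by rewrite -pm_mulZl IH.
rewrite pm_mul_sumr; under eq_bigr do rewrite pm_mulUU.
by rewrite omon_pmap pmulm1 big_seq1.
Qed.

HB.instance Definition _ := GRing.Zmodule_isPzRing.Build (pmalg k X)
  pm_mulA pm_mul1g pm_mulg1 pm_mulDl pm_mulDr.

Definition pm_scal (c : k) : pmalg k X := c *: pm_one.

Lemma pm_scal_zmod_morphism : zmod_morphism pm_scal.
Proof. by move=> c d; rewrite /pm_scal scalerBl. Qed.

Lemma pm_scalE c (f : pmalg k X) : pm_scal c * f = c *: f.
Proof.
rewrite [LHS](_ : _ = pm_mul (c *: pm_one) f) //.
by rewrite -pm_mulZl pm_mul1g.
Qed.

Lemma pm_scal_monoid_morphism : monoid_morphism pm_scal.
Proof.
split=> [|c d]; first by rewrite /pm_scal scale1r.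
by rewrite pm_scalE /pm_scal scalerA.
Qed.

Lemma pm_scalC c (f : pmalg k X) : pm_scal c * f = f * pm_scal c.
Proof.
rewrite pm_scalE [RHS](_ : _ = pm_mul f (c *: pm_one)) //.
by rewrite -pm_mulZr pm_mulg1.
Qed.

HB.instance Definition _ := isKAlgebra.Build k (pmalg k X)
  pm_scal_zmod_morphism pm_scal_monoid_morphism pm_scalC.

End PMAlg.

Section QuotientAlgebra.
Variables (k : fieldType) (B : kalgType k) (G : B -> Prop).

Definition ideal (y : B) : Prop :=
  exists s : seq (B * B * B),
    (forall t, t \in s -> G t.1.2) /\ y = \sum_(t <- s) t.1.1 * t.1.2 * t.2.

Lemma idealD x y : ideal x -> ideal y -> ideal (x + y).
Proof.
case=> [s [Gs ->]] [t [Gt ->]]; exists (s ++ t); split; last by rewrite big_cat.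
by move=> u; rewrite mem_cat => /orP[/Gs|/Gt].
Qed.

Lemma idealMl a x : ideal x -> ideal (a * x).
Proof.
case=> [s [Gs ->]]; exists [seq (a * t.1.1, t.1.2, t.2) | t <- s]; split.
  by move=> _ /mapP[t /Gs ? ->].
by rewrite big_map mulr_sumr; apply: eq_bigr => t _; rewrite /= !mulrA.
Qed.

Lemma idealMr a x : ideal x -> ideal (x * a).
Proof.
case=> [s [Gs ->]]; exists [seq (t.1.1, t.1.2, t.2 * a) | t <- s]; split.
  by move=> _ /mapP[t /Gs ? ->].
by rewrite big_map mulr_suml; apply: eq_bigr => t _; rewrite /= !mulrA.
Qed.

Definition ideal_pred : {pred B} := fun y => `[< ideal y >].

Lemma ideal_zmod_closed : zmod_closed ideal_pred.
Proof.
split=> [|x y]; first by apply/asboolP; exists [::]; rewrite big_nil.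
move=> /asboolP Ix /asboolP Iy; apply/asboolP; apply: idealD => //.
by rewrite -mulN1r; apply: idealMl.
Qed.

HB.instance Definition _ :=
  GRing.isZmodClosed.Build B ideal_pred ideal_zmod_closed.

Definition quotalg : Type := Quotient.quot ideal_pred.

HB.instance Definition _ := GRing.Zmodule.on quotalg.

Definition quotpi (x : B) : quotalg := \pi_(Quotient.quot ideal_pred)%qT x.
Definition quotrepr (a : quotalg) : B :=
  repr (a : Quotient.quot ideal_pred).

Lemma quotreprK : cancel quotrepr quotpi.
Proof. exact: reprK. Qed.

Lemma quotpiP x y : quotpi x = quotpi y <-> ideal (x - y).
Proof.
have E : (ideal_pred (x - y)) = (quotpi x == quotpi y).
  exact: (Quotient.idealrBE (ideal_pred : zmodClosed B) x y).
split=> [/eqP|I]; first by rewrite -E => /asboolP.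
by apply/eqP; rewrite -E; apply/asboolP.
Qed.

Lemma quotpiD : {morph quotpi : x y / x + y}.
Proof. by move=> x y; exact: (raddfD (\pi_(Quotient.quot ideal_pred)%qT)). Qed.

Definition q_mul (a b : quotalg) := quotpi (quotrepr a * quotrepr b).

Lemma reprpi x : ideal (quotrepr (quotpi x) - x).
Proof. by apply/quotpiP; rewrite quotreprK. Qed.

Lemma q_mulE x y : q_mul (quotpi x) (quotpi y) = quotpi (x * y).
Proof.
apply/quotpiP.
set x' := quotrepr _; set y' := quotrepr _.
have -> : x' * y' - x * y = x' * (y' - y) + (x' - x) * y.
  by rewrite mulrBr mulrBl addrA subrK.
by apply: idealD; [apply: idealMl | apply: idealMr]; apply: reprpi.
Qed.

Lemma quot_elim (P : quotalg -> Prop) : (forall x, P (quotpi x)) -> forall a, P a.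
Proof. by move=> H a; rewrite -(quotreprK a). Qed.

Lemma q_mulA : associative q_mul.
Proof.
by elim/quot_elim=> x; elim/quot_elim=> y; elim/quot_elim=> z; rewrite !q_mulE mulrA.
Qed.

Lemma q_mul1 : left_id (quotpi 1) q_mul.
Proof. by elim/quot_elim=> x; rewrite q_mulE mul1r. Qed.

Lemma q_mulr1 : right_id (quotpi 1) q_mul.
Proof. by elim/quot_elim=> x; rewrite q_mulE mulr1. Qed.

Lemma q_mulDl : left_distributive q_mul +%R.
Proof.
elim/quot_elim=> x; elim/quot_elim=> y; elim/quot_elim=> z.
by rewrite -quotpiD !q_mulE mulrDl quotpiD.
Qed.

Lemma q_mulDr : right_distributive q_mul +%R.
Proof.
elim/quot_elim=> x; elim/quot_elim=> y; elim/quot_elim=> z.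
by rewrite -quotpiD !q_mulE mulrDr quotpiD.
Qed.

HB.instance Definition _ := GRing.Zmodule_isPzRing.Build quotalg
  q_mulA q_mul1 q_mulr1 q_mulDl q_mulDr.

Lemma quotpiB : {morph quotpi : x y / x - y}.
Proof. by move=> x y; exact: (raddfB (\pi_(Quotient.quot ideal_pred)%qT)). Qed.

Lemma quotpiM : {morph quotpi : x y / x * y}.
Proof. by move=> x y; rewrite -q_mulE. Qed.

Definition q_scal (c : k) : quotalg := quotpi (kscal c).

Lemma q_scal_zmod_morphism : zmod_morphism q_scal.
Proof. by move=> c d; rewrite /q_scal kscal_zmod_morphism quotpiB. Qed.

Lemma q_scal_monoid_morphism : monoid_morphism q_scal.
Proof.
have [k1 kM] := @kscal_monoid_morphism k B.
by split=> [|c d]; rewrite /q_scal ?k1 // kM quotpiM.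
Qed.

Lemma q_scalC c (a : quotalg) : q_scal c * a = a * q_scal c.
Proof. by elim/quot_elim: a => x; rewrite -!quotpiM kscalC. Qed.

HB.instance Definition _ := isKAlgebra.Build k quotalg
  q_scal_zmod_morphism q_scal_monoid_morphism q_scalC.

End QuotientAlgebra.

Arguments quotalg {k B} G.
Arguments quotpi {k B} G x.
Arguments quotrepr {k B G} a.

Record quiver := Quiver {
  qvert : finType;
  qarr : finType;
  qsrc : qarr -> qvert;
  qtgt : qarr -> qvert
}.

Section Paths.
Variable Q : quiver.

Fixpoint is_walk (v : qvert Q) (s : seq (qarr Q)) : bool :=
  if s is a :: s' then (qsrc a == v) && is_walk (qtgt a) s' else true.

(* A path is its starting vertex with its list of arrows, in the order in
   which they are followed; [(v, [::])] is the trivial path at [v]. *)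
Definition qpath := {p : qvert Q * seq (qarr Q) | is_walk p.1 p.2}.
HB.instance Definition _ := Choice.on qpath.

Definition pstart (p : qpath) : qvert Q := (val p).1.
Definition parrows (p : qpath) : seq (qarr Q) := (val p).2.
Definition pend (p : qpath) : qvert Q := last (pstart p) (map (@qtgt Q) (parrows p)).
Definition plen (p : qpath) : nat := size (parrows p).
Definition ptriv (v : qvert Q) : qpath := exist _ (v, [::]) isT.

(* The product of [p] and [q] is [p] followed by [q]. *)
Definition pcomp (p q : qpath) : option qpath :=
  if pend p == pstart q then insub (pstart p, parrows p ++ parrows q) : option qpath
  else None.

Lemma is_walk_cat v s t :
  is_walk v (s ++ t) = is_walk v s && is_walk (last v (map (@qtgt Q) s)) t.
Proof. by elim: s v => //= a s IH v; rewrite IH andbA. Qed.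

Lemma pcompP p q : pend p = pstart q ->
  exists2 r : qpath, pcomp p q = Some r &
    val r = (pstart p, parrows p ++ parrows q).
Proof.
move=> e; rewrite /pcomp e eqxx.
set u := (_, _ ++ _); have w : is_walk u.1 u.2.
  by rewrite is_walk_cat (valP p) -/(pend p) e (valP q).
by exists (exist _ u w) => //; rewrite insubT.
Qed.

Lemma pcomp_none p q : pend p != pstart q -> pcomp p q = None.
Proof. by rewrite /pcomp => /negbTE ->. Qed.

Lemma pcompA p q r :
  obind (fun yz => pcomp p yz) (pcomp q r) =
  obind (fun xy => pcomp xy r) (pcomp p q).
Proof.
have [e1|n1] := eqVneq (pend q) (pstart r); last first.
  rewrite (pcomp_none n1) /=.
  have [e2|n2] := eqVneq (pend p) (pstart q); last by rewrite pcomp_none.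
  have [u -> vu] := pcompP e2; rewrite /= pcomp_none //.
  by rewrite /pend /pstart /parrows vu /= map_cat last_cat -/(pend p) e2.
have [u -> vu] := pcompP e1.
have su : pstart u = pstart q by rewrite /pstart vu.
have [e2|n2] := eqVneq (pend p) (pstart q); last first.
  by rewrite (pcomp_none n2) /= pcomp_none // su.
have [w -> vw] := pcompP e2.
have ew : pend w = pstart r.
  by rewrite {1}/pend /pstart /parrows vw /= map_cat last_cat -/(pend p) e2.
have eu : pend p = pstart u by rewrite su.
have [x /= -> vx] := pcompP eu; have [y /= -> vy] := pcompP ew.
congr Some; apply: val_inj; rewrite [LHS]vx [RHS]vy.
by rewrite /pstart /parrows vu vw /= catA.
Qed.

Lemma pmap_ids p (F : qpath -> option qpath) v0 :
  (forall v, F (ptriv v) = if v == v0 then Some p else None) ->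
  pmap F (map ptriv (enum (qvert Q))) = [:: p].
Proof.
move=> HF; have := enum_uniq (qvert Q); have := mem_enum (qvert Q) v0.
elim: (enum _) => //= v s IH; rewrite inE HF.
have [<- _ /andP[nv _]|ne /= vs /andP[_ us]] := eqVneq v0 v; last first.
  exact: IH.
congr cons; elim: s nv {IH} => //= w s IH; rewrite inE negb_or => /andP[nw ns].
by rewrite HF eq_sym (negbTE nw) /= IH.
Qed.

Lemma pcomp1p p : pmap (fun e => pcomp e p) (map ptriv (enum (qvert Q))) = [:: p].
Proof.
apply: (pmap_ids (v0 := pstart p)) => v; rewrite /pcomp /pend /=.
case: eqP => // ->.
by rewrite -[(_, _)]/(pstart p, parrows p) -surjective_pairing valK.
Qed.

Lemma pcompp1 p : pmap (fun e => pcomp p e) (map ptriv (enum (qvert Q))) = [:: p].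
Proof.
apply: (pmap_ids (v0 := pend p)) => v; rewrite /pcomp /= eq_sym.
case: eqP => // _.
by rewrite /parrows /= cats0 -surjective_pairing valK.
Qed.

HB.instance Definition _ := isPMonoid.Build qpath pcompA pcomp1p pcompp1.

End Paths.

(* [A] tensored over [k] with its opposite algebra: the monoid algebra of the
   multiplicative monoid of [A * A^op], modulo the bilinearity relations. *)
Section Enveloping.
Variables (k : fieldType) (A : kalgType k).

Definition envmon : Type := (A * A)%type.
HB.instance Definition _ := Choice.on envmon.

Definition env_mul (p q : envmon) : option envmon :=
  Some (p.1 * q.1, q.2 * p.2).

Lemma env_mulA p q r :
  obind (fun yz => env_mul p yz) (env_mul q r) =
  obind (fun xy => env_mul xy r) (env_mul p q).
Proof. by rewrite /env_mul /= !mulrA. Qed.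

Lemma env_mul1m p : pmap (fun e => env_mul e p) [:: (1, 1) : envmon] = [:: p].
Proof. by case: p => a b; rewrite /= mul1r mulr1. Qed.

Lemma env_mulm1 p : pmap (fun e => env_mul p e) [:: (1, 1) : envmon] = [:: p].
Proof. by case: p => a b; rewrite /= mul1r mulr1. Qed.

HB.instance Definition _ := isPMonoid.Build envmon env_mulA env_mul1m env_mulm1.

Definition pre_tensor (a b : A) : pmalg k envmon := << (a, b) : envmon >>.

Inductive env_rel : pmalg k envmon -> Prop :=
| EnvAddl a a' b :
    env_rel (pre_tensor (a + a') b - pre_tensor a b - pre_tensor a' b)
| EnvAddr a b b' :
    env_rel (pre_tensor a (b + b') - pre_tensor a b - pre_tensor a b')
| EnvScall c a b :
    env_rel (pre_tensor (kscal c * a) b - c *: pre_tensor a b)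
| EnvScalr c a b :
    env_rel (pre_tensor a (kscal c * b) - c *: pre_tensor a b).

Definition envalg : Type := quotalg env_rel.
HB.instance Definition _ := KAlgebra.on envalg.

Definition tensor (a b : A) : envalg := quotpi env_rel (pre_tensor a b).

(* [A] as a left module over [envalg]: the action of [a] tensor [b] on [x] is
   [a * x * b], see [tensor_bimod] below. *)
Definition bimod : Type := A.
HB.instance Definition _ := GRing.Zmodule.on bimod.

Definition pre_act (f : pmalg k envmon) (x : A) : A :=
  \sum_(p <- msupp f) kscal f@_p * (p.1 * x * p.2).

Lemma pre_actEw (d : {fset envmon}) f x : (msupp f `<=` d)%fset ->
  pre_act f x = \sum_(p <- d) kscal f@_p * (p.1 * x * p.2).
Proof.
move=> le; rewrite /pre_act (big_fset_incl _ le) //= => p _ /mcoeff_outdom ->.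
by rewrite rmorph0 mul0r.
Qed.

Lemma pre_actD f g x : pre_act (f + g) x = pre_act f x + pre_act g x.
Proof.
rewrite (@pre_actEw (msupp f `|` msupp g)%fset) ?msuppD_le //.
rewrite (@pre_actEw (msupp f `|` msupp g)%fset f) ?fsubsetUl //.
rewrite (@pre_actEw (msupp f `|` msupp g)%fset g) ?fsubsetUr //.
by rewrite -big_split; apply: eq_bigr => p _ /=; rewrite mcoeffD rmorphD mulrDl.
Qed.

Lemma pre_actZ c f x : pre_act (c *: f) x = kscal c * pre_act f x.
Proof.
rewrite (@pre_actEw (msupp f) (c *: f)) ?msuppZ_le // mulr_sumr.
by apply: eq_bigr => p _; rewrite mcoeffZ rmorphM -mulrA.
Qed.

Lemma pre_actU a b x : pre_act (pre_tensor a b) x = a * x * b.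
Proof.
rewrite (@pre_actEw [fset ((a, b) : envmon)]%fset) ?msuppU_le //.
by rewrite big_seq_fset1 mcoeffUU rmorph1 mul1r.
Qed.

Lemma pre_act0 x : pre_act 0 x = 0.
Proof. by rewrite -(scale0r (0 : pmalg k envmon)) pre_actZ rmorph0 mul0r. Qed.

Lemma pre_actB f g x : pre_act (f - g) x = pre_act f x - pre_act g x.
Proof. by rewrite -scaleN1r pre_actD pre_actZ rmorphN1 mulN1r. Qed.

Lemma pre_actDr f x y : pre_act f (x + y) = pre_act f x + pre_act f y.
Proof.
rewrite /pre_act -big_split; apply: eq_bigr => p _ /=.
by rewrite mulrDr mulrDl mulrDr.
Qed.

Lemma pre_actZr f c x : pre_act f (kscal c * x) = kscal c * pre_act f x.
Proof.
rewrite /pre_act mulr_sumr; apply: eq_bigr => p _ /=.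
have -> : p.1 * (kscal c * x) = kscal c * (p.1 * x) by rewrite !mulrA kscalC.
by rewrite -!mulrA (mulrA (kscal _)) (mulrA (kscal c)) kscalC.
Qed.

Lemma pre_actr0 f : pre_act f 0 = 0.
Proof. by have := pre_actZr f 0 0; rewrite rmorph0 !mul0r. Qed.

Lemma pre_act1 x : pre_act 1 x = x.
Proof.
rewrite [X in pre_act X](_ : _ = pre_tensor 1 1); last exact: big_seq1.
by rewrite pre_actU mul1r mulr1.
Qed.

Lemma pre_actM f g x : pre_act (f * g) x = pre_act f (pre_act g x).
Proof.
elim/pmalg_ind: f => [|f f' IH IH'|c f IH|[a b]].
- by rewrite mul0r !pre_act0.
- by rewrite mulrDl !pre_actD IH IH'.
- by rewrite -pm_scalE -mulrA !pm_scalE !pre_actZ IH.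
elim/pmalg_ind: g => [|g g' IH IH'|c g IH|[a' b']].
- by rewrite mulr0 pre_act0 pre_actr0.
- by rewrite mulrDr !pre_actD IH IH' pre_actDr.
- by rewrite -pm_scalE mulrA -pm_scalC -mulrA !pm_scalE !pre_actZ IH pre_actZr.
rewrite [X in pre_act X](_ : _ = pre_tensor (a * a') (b' * b)).
  by rewrite !pre_actU !mulrA.
exact: pm_mulUU.
Qed.

Lemma pre_act_rel r x : env_rel r -> pre_act r x = 0.
Proof.
case=> [a a' b|a b b'|c a b|c a b].
- by rewrite !pre_actB !pre_actU !mulrDl addrAC addrK subrr.
- by rewrite !pre_actB !pre_actU !mulrDr addrAC addrK subrr.
- by rewrite pre_actB pre_actZ !pre_actU !mulrA subrr.
- rewrite pre_actB pre_actZ !pre_actU (mulrA (a * x)) -(kscalC c (a * x)).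
  by rewrite -[X in X - _]mulrA subrr.
Qed.

Lemma pre_act_ideal f x : ideal env_rel f -> pre_act f x = 0.
Proof.
case=> s [sG ->].
elim: s sG => [|t s IH] sG; first by rewrite big_nil pre_act0.
rewrite big_cons pre_actD !pre_actM (pre_act_rel _ (sG t (mem_head t s))).
rewrite pre_actr0 add0r; apply: IH => u us.
by apply: (sG u); rewrite inE us orbT.
Qed.

Definition bimod_scale (u : envalg) (x : bimod) : bimod := pre_act (quotrepr u) x.

Lemma bimod_scaleE f x : bimod_scale (quotpi env_rel f) x = pre_act f x.
Proof.
apply/eqP; rewrite -subr_eq0 -pre_actB; apply/eqP/pre_act_ideal.
exact: reprpi.
Qed.

Lemma bimod_scaleA u v x :
  bimod_scale u (bimod_scale v x) = bimod_scale (u * v) x.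
Proof.
elim/quot_elim: u => f; elim/quot_elim: v => g.
by rewrite -quotpiM !bimod_scaleE pre_actM.
Qed.

Lemma bimod_scale1 : left_id 1 bimod_scale.
Proof. by move=> x; rewrite [LHS]bimod_scaleE pre_act1. Qed.

Lemma bimod_scaleDr : right_distributive bimod_scale +%R.
Proof. by move=> u x y; exact: pre_actDr. Qed.

Lemma bimod_scaleDl x : {morph bimod_scale^~ x : u v / u + v}.
Proof.
elim/quot_elim=> f; elim/quot_elim=> g.
by rewrite -quotpiD !bimod_scaleE pre_actD.
Qed.

HB.instance Definition _ := GRing.Zmodule_isLmodule.Build envalg bimod
  bimod_scaleA bimod_scale1 bimod_scaleDr bimod_scaleDl.

Lemma tensor_bimod a b (x : bimod) : tensor a b *: x = (a * x * b : A).
Proof. by rewrite [LHS]bimod_scaleE pre_actU. Qed.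

End Enveloping.
Arguments envalg {k} A.
Arguments bimod {k} A.

Section QuotientModule.
Variables (R : pzRingType) (V : lmodType R) (G : V -> Prop).

Definition lspan (y : V) : Prop :=
  exists s : seq (R * V),
    (forall t, t \in s -> G t.2) /\ y = \sum_(t <- s) t.1 *: t.2.

Lemma lspanD x y : lspan x -> lspan y -> lspan (x + y).
Proof.
case=> [s [Gs ->]] [t [Gt ->]]; exists (s ++ t); split; last by rewrite big_cat.
by move=> u; rewrite mem_cat => /orP[/Gs|/Gt].
Qed.

Lemma lspanZ a x : lspan x -> lspan (a *: x).
Proof.
case=> [s [Gs ->]]; exists [seq (a * t.1, t.2) | t <- s]; split.
  by move=> _ /mapP[t /Gs ? ->].
by rewrite big_map scaler_sumr; apply: eq_bigr => t _; rewrite /= scalerA.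
Qed.

Definition lspan_pred : {pred V} := fun y => `[< lspan y >].

Lemma lspan_zmod_closed : zmod_closed lspan_pred.
Proof.
split=> [|x y]; first by apply/asboolP; exists [::]; rewrite big_nil.
move=> /asboolP Ix /asboolP Iy; apply/asboolP; apply: lspanD => //.
by rewrite -scaleN1r; apply: lspanZ.
Qed.

HB.instance Definition _ :=
  GRing.isZmodClosed.Build V lspan_pred lspan_zmod_closed.

Definition quotmod : Type := Quotient.quot lspan_pred.
HB.instance Definition _ := GRing.Zmodule.on quotmod.

Definition modpi (x : V) : quotmod := \pi_(Quotient.quot lspan_pred)%qT x.
Definition modrepr (a : quotmod) : V := repr (a : Quotient.quot lspan_pred).

Lemma modreprK : cancel modrepr modpi.
Proof. exact: reprK. Qed.

Lemma modpiP x y : modpi x = modpi y <-> lspan (x - y).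
Proof.
have E : (lspan_pred (x - y)) = (modpi x == modpi y).
  exact: (Quotient.idealrBE (lspan_pred : zmodClosed V) x y).
split=> [/eqP|I]; first by rewrite -E => /asboolP.
by apply/eqP; rewrite -E; apply/asboolP.
Qed.

Lemma modpiD : {morph modpi : x y / x + y}.
Proof. by move=> x y; exact: (raddfD (\pi_(Quotient.quot lspan_pred)%qT)). Qed.

Definition mod_scale (a : R) (x : quotmod) : quotmod := modpi (a *: modrepr x).

Lemma mod_scaleE a x : mod_scale a (modpi x) = modpi (a *: x).
Proof.
apply/modpiP; rewrite -scalerBr; apply: lspanZ.
by apply/modpiP; rewrite modreprK.
Qed.

Lemma mod_elim (P : quotmod -> Prop) : (forall x, P (modpi x)) -> forall a, P a.
Proof. by move=> H a; rewrite -(modreprK a). Qed.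

Lemma mod_scaleA a b x : mod_scale a (mod_scale b x) = mod_scale (a * b) x.
Proof. by elim/mod_elim: x => x; rewrite !mod_scaleE scalerA. Qed.

Lemma mod_scale1 : left_id 1 mod_scale.
Proof. by elim/mod_elim=> x; rewrite mod_scaleE scale1r. Qed.

Lemma mod_scaleDr : right_distributive mod_scale +%R.
Proof.
move=> a; elim/mod_elim=> x; elim/mod_elim=> y.
by rewrite -modpiD !mod_scaleE scalerDr modpiD.
Qed.

Lemma mod_scaleDl x : {morph mod_scale^~ x : a b / a + b}.
Proof. by move=> a b; elim/mod_elim: x => x; rewrite !mod_scaleE scalerDl modpiD. Qed.

HB.instance Definition _ := GRing.Zmodule_isLmodule.Build R quotmod
  mod_scaleA mod_scale1 mod_scaleDr mod_scaleDl.

End QuotientModule.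
Arguments quotmod {R V} G.
Arguments modpi {R V} G x.

Section Homological.
Variable R : pzRingType.

Definition projective (P : lmodType R) : Prop :=
  forall (M N : lmodType R) (g : {linear M -> N}) (f : {linear P -> N}),
    (forall y, exists x, g x = y) ->
    exists h : {linear P -> M}, forall x, g (h x) = f x.

Record proj_resolution (M : lmodType R) := ProjResolution {
  pterm :> nat -> lmodType R;
  pdiff : forall i, {linear pterm i.+1 -> pterm i};
  paug : {linear pterm 0%N -> M};
  pterm_projective : forall i, projective (pterm i);
  paug_surj : forall y, exists x, paug x = y;
  paug_exact : forall x, paug x = 0 <-> exists y, pdiff 0%N y = x;
  pdiff_exact : forall i x, pdiff i x = 0 <-> exists y, pdiff i.+1 y = x
}.

Definition proj_dim_le (M : lmodType R) (m : nat) : Prop :=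
  exists P : proj_resolution M, forall i, (m < i)%N -> forall x : P i, x = 0.

Definition gl_dim_le (m : nat) : Prop :=
  forall M : lmodType R, proj_dim_le M m.

Definition gl_dim (n : nat) : Prop :=
  gl_dim_le n /\ forall m, gl_dim_le m -> (n <= m)%N.

End Homological.

(* [Ext_dim_ge n M N d] states that the dimension over [k] of [Ext^n_R(M, N)]
   is at least [d]: for a projective resolution [P] of [M] there are [d]
   [n]-cocycles of [Hom_R(P, N)] that are linearly independent over [k] modulo
   the coboundaries.  Resolutions exist, and the condition does not depend on
   the choice of [P]; it is required of all of them. *)
Section Ext.
Variables (k : fieldType) (R : kalgType k) (M N : lmodType R).

Definition cocycle (P : proj_resolution M) n (f : {linear P n -> N}) : Prop :=
  forall x, f (pdiff P n x) = 0.

Definition coboundary (P : proj_resolution M) n : (P n -> N) -> Prop :=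
  match n with
  | 0 => fun f => forall x, f x = 0
  | m.+1 => fun f => exists g : {linear P m -> N}, forall x, f x = g (pdiff P m x)
  end.

Definition Ext_dim_ge (n d : nat) : Prop :=
  forall P : proj_resolution M,
  exists f : 'I_d -> {linear P n -> N},
    (forall i, cocycle (f i)) /\
    forall c : 'I_d -> k,
      coboundary (fun x => \sum_i (kscal (c i) : R) *: f i x) ->
      forall i, c i = 0.

End Ext.
Arguments Ext_dim_ge {k R} M N n d.

Definition HH_dim_ge (k : fieldType) (A : kalgType k) (n d : nat) : Prop :=
  Ext_dim_ge (R := envalg A) (bimod A) (bimod A) n d.

Section QuadraticAlgebra.
Variables (k : fieldType) (Q : quiver).

Definition path_algebra := pmalg k (qpath Q).
HB.instance Definition _ := KAlgebra.on path_algebra.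
HB.instance Definition _ := GRing.Lmodule.on path_algebra.

Definition idem (v : qvert Q) : path_algebra := << ptriv v >>.

(* [kQ_i] *)
Definition homog (i : nat) (x : path_algebra) : Prop :=
  forall p, x@_p != 0 -> plen p = i.

Variable rho : path_algebra -> Prop.

Definition qalgebra := quotalg rho.
HB.instance Definition _ := KAlgebra.on qalgebra.

(* [A_i] *)
Definition grade (i : nat) (a : qalgebra) : Prop :=
  exists2 x, homog i x & a = quotpi rho x.

Definition is_grading (M : lmodType qalgebra) (g : int -> M -> Prop) : Prop :=
  [/\ forall j, g j 0 /\ (forall x y, g j x -> g j y -> g j (x - y)),
      forall i j a x, grade i a -> g j x -> g (i%:Z + j) (a *: x),
      forall x, exists (s : seq int) (f : int -> M),
        (forall j, g j (f j)) /\ x = \sum_(j <- s) f j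
    & forall (s : seq int) (f : int -> M), uniq s -> (forall j, g j (f j)) ->
        \sum_(j <- s) f j = 0 -> forall j, j \in s -> f j = 0].

(* The graded module [A_0]: the quotient of [A] by the left ideal spanned by
   the [A_i] with [i >= 1], concentrated in degree 0. *)
Definition A0mod : lmodType qalgebra :=
  quotmod (V := qalgebra^o) (fun a => exists2 i, (0 < i)%N & grade i a).

Definition A0_deg (j : int) (x : A0mod) : Prop := j = 0 \/ x = 0.

Definition generated_in_degree (M : lmodType qalgebra) (g : int -> M -> Prop)
    (j : int) : Prop := forall x, lspan (g j) x.

Definition Koszul : Prop :=
  exists (P : proj_resolution A0mod) (g : forall i, int -> P i -> Prop),
    [/\ forall i, is_grading (g i),
        forall i j x, g i.+1 j x -> g i j (pdiff P i x),
        forall j x, g 0%N j x -> A0_deg j (paug P x)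
      & forall i, generated_in_degree (g i) i%:Z].

Definition quadR (x : path_algebra) : Prop := ideal rho x /\ homog 2 x.

Definition Kspace (n : nat) (x : path_algebra) : Prop :=
  forall r s, (r + s + 2)%N = n ->
    lspan (fun y : path_algebra => exists a b c : path_algebra,
      [/\ homog r a, quadR b, homog s c & y = a * b * c]) x.

(* The coproduct of the spaces [e_v K_n e_v], as families indexed by the finite
   set of vertices. *)
Definition coprod_eKe (n : nat) (f : {ffun qvert Q -> path_algebra}) : Prop :=
  forall v, exists2 x, Kspace n x & f v = idem v * x * idem v.

End QuadraticAlgebra.

Definition dim_ge (k : fieldType) (V : lmodType k) (U : V -> Prop) (d : nat) :=
  exists b : 'I_d -> V, (forall i, U (b i)) /\
    forall c : 'I_d -> k, \sum_i c i *: b i = 0 -> forall i, c i = 0.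

(* Main.v *)
From HB Require Import structures.
Require Import Defs.
From mathcomp Require Import all_boot all_algebra finmap.
From mathcomp.multinomials Require Import monalg.
From mathcomp Require Import boolp classical_sets.

Set Implicit Arguments.
Unset Strict Implicit.
Unset Printing Implicit Defensive.

Import GRing.Theory.
Local Open Scope ring_scope.

(** Let T be the path algebra, T_i its part of degree i, and A = T/I. The Koszul
    complex with terms A K_i A is a projective resolution of A by bimodules. It
    stops at index n when n bounds the projective dimension of A_0, because then
    K_(n+1) = 0 ([K_vanish]); hence every bimodule map f : A K_n A -> A is a
    cocycle. If f is a coboundary, it factors through the differential, which takes
    an arrow out of a generator x of K_n on the left or on the right, so that f(x)
    lies in the radical of A, the span of the paths of positive length
    ([boundary_radical]). A linear functional on the sum of the spaces e_v K_n e_v,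
    multiplied by e_v on the summand of v, extends to a bimodule map whose values on
    these spaces are multiples of the e_v and meet the radical in 0 only. Thus independent functionals give independent classes in
    HH^n(A) ([Ext_lower_bound]). Since Ext is given by conditions on all
    projective resolutions, the classes are moved to an arbitrary one along a
    comparison map ([Ext_dim_ge_transfer]).

    Most of the work is the exactness of the Koszul complex. First comes the left
    complex with terms A K_i. Let P be a linear resolution of A_0. By induction on i
    the component of degree i of P_i, which generates P_i, is identified with K_i
    ([lowest_exists]), and the map A K_i -> P_i is an isomorphism: its injectivity
    uses that P_i is projective ([Sig_kernel]). So the left complex is exact
    ([left_exact]), and it stays so after tensoring with A_s ([exact_tensor]). In
    the bimodule complex, grade A K_i A by the degree s of the right factor. One part
    of the differential keeps s and is that of the left complex, the other raises s
    by one, so primitives are found by solving for one s after the other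
    ([primitive], [dif_exact]).

    No tensor product of modules is formed. All spaces are represented inside T: A K_i
    is the image of T K_i, taken modulo I T_i, the differential of the left complex is
    an inclusion, and A K_i A is spanned by the images of the spaces T K_i T_s in a
    free module over the enveloping algebra whose basis consists of the paths of
    length i ([vec], [dif_vec]). *)

(** * Submodules, free modules and lifting *)

Lemma linear_of (R : pzRingType) (M N : lmodType R) (f : M -> N) :
  (forall a x y, f (a *: x + y) = a *: f x + f y) ->
  exists g : {linear M -> N}, forall x, g x = f x.
Proof.
move=> lf.
pose m := GRing.isLinear.Build R M N *:%R f lf.
by exists (HB.pack f m : {linear M -> N}).
Qed.

Section Submodule.
Variables (R : pzRingType) (V : lmodType R).

Record submodule := Submodule {
  smem :> V -> Prop;
  smem0 : smem 0;
  smemL : forall a x y, smem x -> smem y -> smem (a *: x + y)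
}.

Lemma smemD (U : submodule) x y : U x -> U y -> U (x + y).
Proof. by move=> Ux Uy; rewrite -(scale1r x); apply: smemL. Qed.

Lemma smemZ (U : submodule) a x : U x -> U (a *: x).
Proof. by move=> Ux; rewrite -(addr0 (_ *: _)); apply: smemL => //; apply: smem0. Qed.

Lemma smemN (U : submodule) x : U x -> U (- x).
Proof. by rewrite -scaleN1r; apply: smemZ. Qed.

Lemma smemB (U : submodule) x y : U x -> U y -> U (x - y).
Proof. by move=> Ux Uy; apply: smemD => //; apply: smemN. Qed.

Lemma smem_sum (U : submodule) I (r : seq I) (P : pred I) F :
  (forall i, P i -> U (F i)) -> U (\sum_(i <- r | P i) F i).
Proof. by move=> UF; elim/big_ind: _ => //; [apply: smem0 | apply: smemD]. Qed.

Variable U : submodule.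
Definition smem_pred : {pred V} := fun x => `[<U x>].

Lemma smem_pred_closed : submod_closed smem_pred.
Proof.
split=> [|a x y /asboolP Ux /asboolP Uy]; first by apply/asboolP; apply: smem0.
by apply/asboolP; apply: smemL.
Qed.

HB.instance Definition _ :=
  GRing.isSubmodClosed.Build R V smem_pred smem_pred_closed.

Record subm := SubM { sval_ :> V; _ : sval_ \in smem_pred }.
HB.instance Definition _ := [isSub for sval_].
HB.instance Definition _ := [Choice of subm by <:].
HB.instance Definition _ := [SubChoice_isSubLmodule of subm by <:].

Definition incl : {linear subm -> V} := val.

Lemma inclP x : U (incl x).
Proof. by apply/asboolP; apply: (valP x). Qed.

Lemma incl_inj : injective incl.
Proof. exact: val_inj. Qed.

Lemma inclD x y : incl (x + y) = incl x + incl y.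
Proof. exact: linearD. Qed.

Lemma inclZ a x : incl (a *: x) = a *: incl x.
Proof. exact: linearZZ. Qed.

Lemma subm_of x : U x -> exists y, incl y = x.
Proof. by move=> /asboolP Ux; exists (SubM Ux). Qed.

Lemma corestrict (M : lmodType R) (f : {linear M -> V}) :
  (forall x, U (f x)) -> exists g : {linear M -> subm}, forall x, incl (g x) = f x.
Proof.
move=> Uf; pose g x := SubM (introT (asboolP _) (Uf x)).
have [|h hE] := @linear_of R M subm g.
  by move=> a x y; apply: incl_inj; rewrite linearP /= linearP.
by exists h => x; rewrite hE.
Qed.

End Submodule.
Arguments incl {R V} U : simpl never.

Section Lifting.
Variable R : pzRingType.
Implicit Types M N P : lmodType R.

Definition image_sub M N (g : {linear M -> N}) : submodule N.
Proof.
exists (fun y => exists x, g x = y); first by exists 0; rewrite linear0.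
by move=> a _ _ [x <-] [y <-]; exists (a *: x + y); rewrite linearP.
Defined.

(** [g] becomes surjective when both maps are corestricted to its image. *)
Lemma projective_lift P M N (g : {linear M -> N}) (f : {linear P -> N}) :
  projective P -> (forall p, exists x, g x = f p) ->
  exists h : {linear P -> M}, forall p, g (h p) = f p.
Proof.
move=> projP fg.
have [g' g'E] := corestrict (U := image_sub g) (fun x => ex_intro _ x erefl).
have [f' f'E] := corestrict (U := image_sub g) fg.
have [|h hE] := projP _ _ g' f'.
  move=> y; have [x gx] := inclP y; exists x.
  by apply: incl_inj; rewrite g'E gx.
by exists h => p; rewrite -g'E hE f'E.
Qed.

Section Free.
Variable I : finType.
Definition free_mod := {ffun I -> R^o}.
HB.instance Definition _ := GRing.Lmodule.on free_mod.

Definition delta (i : I) : free_mod := [ffun j => (j == i)%:R].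

Lemma free_modE (f : free_mod) : f = \sum_i (f i : R) *: delta i.
Proof.
apply/ffunP => j; rewrite sum_ffunE (bigD1 j) //= big1 ?addr0.
  by rewrite !ffunE eqxx /GRing.scale /= mulr1.
by move=> i ne; rewrite !ffunE eq_sym (negbTE ne) /GRing.scale /= mulr0.
Qed.

Lemma free_scaleE a (f : free_mod) i : (a *: f) i = a * f i.
Proof. by rewrite ffunE. Qed.

Definition free_fun M (F : I -> M) (f : free_mod) : M := \sum_i (f i : R) *: F i.

Lemma free_fun_is_linear M (F : I -> M) : linear (free_fun F).
Proof.
move=> a f g; rewrite /free_fun scaler_sumr -big_split /=.
by apply: eq_bigr => i _; rewrite !ffunE scalerDl scalerA.
Qed.

HB.instance Definition _ M (F : I -> M) :=
  GRing.isLinear.Build R free_mod M *:%R (free_fun F) (free_fun_is_linear F).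

Lemma free_fun_delta M (F : I -> M) i : free_fun F (delta i) = F i.
Proof.
rewrite /free_fun (bigD1 i) //= big1 ?addr0 ?ffunE ?eqxx ?scale1r // => j ne.
by rewrite ffunE (negbTE ne) scale0r.
Qed.

Lemma free_projective : projective free_mod.
Proof.
move=> M N g f gsurj.
have [F FE] := choice (fun i : I => gsurj (f (delta i))).
exists (free_fun F : {linear free_mod -> M}) => p.
rewrite {2}(free_modE p) /= /free_fun !linear_sum; apply: eq_bigr => i _.
by rewrite !linearZ FE.
Qed.

Lemma retract_projective (U : submodule free_mod) (p : {linear free_mod -> free_mod}) :
  (forall f, U (p f)) -> (forall f, U f -> p f = f) -> projective (subm U).
Proof.
move=> pU pid M N g f gsurj.
have [p' p'E] := corestrict pU.
have [h hE] := free_projective (f \o p' : {linear free_mod -> N}) gsurj.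
exists (h \o incl U : {linear subm U -> M}) => x /=.
rewrite hE /=; congr (f _); apply: incl_inj; rewrite p'E pid //; exact: inclP.
Qed.

End Free.
End Lifting.

(** * Comparison of projective resolutions *)

Section Comparison.
Variables (R : pzRingType) (M : lmodType R).
Implicit Types (P : proj_resolution M).

Lemma pdiff_pdiff P i x : pdiff P i (pdiff P i.+1 x) = 0.
Proof. by apply/pdiff_exact; exists x. Qed.

Lemma paug_pdiff P x : paug P (pdiff P 0 x) = 0.
Proof. by apply/paug_exact; exists x. Qed.

Lemma comparison P (P' : proj_resolution M) :
  exists f : forall i, {linear P i -> P' i},
    (forall x, paug P' (f 0%N x) = paug P x) /\
    (forall i x, pdiff P' i (f i.+1 x) = f i (pdiff P i x)).
Proof.
pose ok i (f : {linear P i -> P' i}) :=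
  forall x, exists y, pdiff P' i y = f (pdiff P i x).
have [|f0 f0E] := projective_lift (g := paug P') (f := paug P) (@pterm_projective _ _ P 0).
  by move=> p; apply: paug_surj.
have ok0 : ok 0%N f0.
  by move=> x; apply/paug_exact; rewrite f0E paug_pdiff.
have step i (f : {f : {linear P i -> P' i} | ok i f}) :
  {g : {f : {linear P i.+1 -> P' i.+1} | ok i.+1 f} |
     forall x, pdiff P' i (sval g x) = sval f (pdiff P i x)}.
  apply: cid; case: f => f okf /=.
  have [|g gE] := projective_lift (g := pdiff P' i)
    (f := f \o pdiff P i : {linear P i.+1 -> P' i}) (@pterm_projective _ _ P i.+1).
    exact: okf.
  have okg : ok i.+1 g.
    by move=> x; apply/pdiff_exact; rewrite gE /= pdiff_pdiff linear0.
  by exists (exist _ g okg) => x; rewrite /= gE.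
pose F := nat_rect (fun i => {f : {linear P i -> P' i} | ok i f})
  (exist _ f0 ok0) (fun i f => sval (step i f)).
exists (fun i => sval (F i)); split=> // i x.
exact: (svalP (step i (F i))).
Qed.

Lemma homotopy P (P' : proj_resolution M) (f g : forall i, {linear P i -> P' i}) :
  (forall x, paug P' (f 0%N x) = paug P' (g 0%N x)) ->
  (forall i x, pdiff P' i (f i.+1 x) = f i (pdiff P i x)) ->
  (forall i x, pdiff P' i (g i.+1 x) = g i (pdiff P i x)) ->
  exists h : forall i, {linear P i -> P' i.+1}, forall i x,
    f i.+1 x - g i.+1 x = pdiff P' i.+1 (h i.+1 x) + h i (pdiff P i x).
Proof.
move=> aE fE gE.
pose ok i (h : {linear P i -> P' i.+1}) := forall x,
  pdiff P' i (h (pdiff P i x)) = f i (pdiff P i x) - g i (pdiff P i x).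
have [|h0 h0E] := projective_lift (g := pdiff P' 0)
    (f := f 0%N \- g 0%N : {linear P 0%N -> P' 0%N}) (@pterm_projective _ _ P 0).
  by move=> p; apply/paug_exact; rewrite linearB /= aE subrr.
have ok0 : ok 0%N h0 by move=> x; rewrite h0E.
have step i (h : {h : {linear P i -> P' i.+1} | ok i h}) :
  {h' : {h : {linear P i.+1 -> P' i.+2} | ok i.+1 h} | forall x,
    f i.+1 x - g i.+1 x = pdiff P' i.+1 (sval h' x) + sval h (pdiff P i x)}.
  apply: cid; case: h => h okh /=.
  have [|h' h'E] := projective_lift (g := pdiff P' i.+1)
    (f := (f i.+1 \- g i.+1) \- (h \o pdiff P i) : {linear P i.+1 -> P' i.+1})
    (@pterm_projective _ _ P i.+1).
    move=> p; apply/pdiff_exact.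
    by rewrite linearB linearB /= fE gE okh subrr.
  have okh' : ok i.+1 h'.
    by move=> x; rewrite h'E /= pdiff_pdiff linear0 subr0.
  by exists (exist _ h' okh') => x; rewrite /= h'E /= subrK.
pose F := nat_rect (fun i => {h : {linear P i -> P' i.+1} | ok i h})
  (exist _ h0 ok0) (fun i h => sval (step i h)).
by exists (fun i => sval (F i)) => i x; apply: (svalP (step i (F i))).
Qed.

Lemma homotopy_id P (f : forall i, {linear P i -> P i}) :
  (forall x, paug P (f 0%N x) = paug P x) ->
  (forall i x, pdiff P i (f i.+1 x) = f i (pdiff P i x)) ->
  exists h : forall i, {linear P i -> P i.+1}, forall i x,
    x = f i.+1 x + (pdiff P i.+1 (h i.+1 x) + h i (pdiff P i x)).
Proof.
move=> aE fE.
have [||h hE] := homotopy (f := fun i => idfun : {linear P i -> P i}) (g := f) _ _ fE.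
- by move=> x; rewrite aE.
- by [].
by exists h => i x; rewrite -hE /= addrCA subrr addr0.
Qed.

End Comparison.

(** Moving a cocycle along a comparison map and back changes it by a coboundary, so
    that a single resolution suffices to bound the dimension of Ext from below. *)
Lemma Ext_dim_ge_transfer (k : fieldType) (R : kalgType k) (M N : lmodType R)
    (C : proj_resolution M) (n d : nat) (f : 'I_d -> {linear C n.+1 -> N}) :
  (forall i, cocycle (f i)) ->
  (forall c : 'I_d -> k,
     coboundary (P := C) (n := n.+1) (fun x => \sum_i (kscal (c i) : R) *: f i x) ->
     forall i, c i = 0) ->
  Ext_dim_ge M N n.+1 d.
Proof.
move=> fcoc find P.
have [u [ua ud]] := comparison P C.
have [v [va vd]] := comparison C P.
have [||h hE] := @homotopy_id R M C (fun i => u i \o v i : {linear C i -> C i}).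
- by move=> x; rewrite /= ua va.
- by move=> i x; rewrite /= ud vd.
exists (fun i => f i \o u n.+1 : {linear P n.+1 -> N}); split.
  by move=> i x; rewrite /= -ud; apply: fcoc.
move=> c [g gE]; apply: find.
(* If the transported combination is the coboundary of [g], the original one is the
   coboundary of [g v] corrected by the homotopy. *)
pose F (x : C n) : N := g (v n x) + \sum_i (kscal (c i) : R) *: f i (h n x).
have [G GE] : exists G : {linear C n -> N}, forall x, G x = F x.
  apply: linear_of => a x y; rewrite /F !linearP scalerDr -!addrA; congr (_ + _).
  rewrite addrCA; congr (_ + _); rewrite scaler_sumr -big_split /=.
  apply: eq_bigr => i _; rewrite !linearP scalerDr !scalerA kscalC.
  by congr (_ + _); rewrite linearP.
exists G => x; rewrite GE /F -vd -gE -big_split /=; apply: eq_bigr => i _.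
rewrite -scalerDr {1}[x](hE n) /= !linearD /=.
by rewrite (fcoc i) add0r.
Qed.

(** * Projections onto subspaces *)

Section Complement.
Variables (k : fieldType) (V : lmodType k) (U : submodule V).

(** A subspace maximal among those meeting [U] trivially is a complement: by Zorn's
    lemma there is one, and any vector outside the sum could be added to it. *)
Lemma complement_exists : exists W : submodule V,
  (forall x, U x -> W x -> x = 0) /\ (forall x, exists2 u, U u & W (x - u)).
Proof.
pose good (A : set V) := (forall a x y, A x -> A y -> A (a *: x + y)) /\
  forall x, U x -> A x -> x = 0.
have [F Fgood Ftot|A [[Asub AU] Amax]] := @Zorn_bigcup V good.
  split=> [a x y [B FB Bx] [C FC Cy]|x Ux [B FB]]; last by apply: (Fgood _ FB).2.
  have [BC|CB] := Ftot _ _ FB FC.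
    by exists C => //; apply: (Fgood _ FC).1 => //; apply: BC.
  by exists B => //; apply: (Fgood _ FB).1 => //; apply: CB.
have A0 : A 0.
  case: (pselect (A 0)) => // nA0.
  have [[y Ay]|nA] := pselect (exists y, A y).
    by case: nA0; have := Asub (-1) _ _ Ay Ay; rewrite scaleN1r addNr.
  case: (Amax [set 0]%classic).
    split=> [y Ay|/(_ 0 erefl)//]; by case: nA; exists y.
  by split=> [a x y -> ->|x _ ->] //; rewrite scaler0 addr0.
exists (Submodule A0 Asub); split=> //= x.
apply: contrapT => nx.
pose B : set V := fun z => exists a w, A w /\ z = a *: x + w.
case: (Amax B).
  split=> [w Aw|BA]; first by exists 0, w; rewrite scale0r add0r.
  apply: nx; exists 0; rewrite ?subr0; first exact: smem0.
  by apply: BA; exists 1, 0; rewrite scale1r addr0.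
split=> [a _ _ [b [w [Aw ->]]] [c [w' [Aw' ->]]]|z Uz [a [w [Aw zE]]]].
  exists (a * b + c), (a *: w + w'); split; first exact: Asub.
  by rewrite scalerDr scalerDl scalerA -!addrA; congr (_ + _); rewrite addrCA.
have [a0|a0] := eqVneq a 0.
  by apply: AU => //; rewrite zE a0 scale0r add0r.
case: nx; exists (a^-1 *: z); first exact: smemZ.
rewrite zE scalerDr scalerA mulVf // scale1r opprD addNKr.
by rewrite -scaleN1r; do 2!apply: (smemZ (U := Submodule A0 Asub)).
Qed.

Lemma projection_exists : exists p : {linear V -> V},
  (forall x, U (p x)) /\ (forall x, U x -> p x = x).
Proof.
have [W [UW0 UW]] := complement_exists.
have /choice[p pE] : forall x, exists u, U u /\ W (x - u).
  by move=> x; have [u] := UW x; exists u.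
have uniq_p x u : U u -> W (x - u) -> p x = u.
  move=> Uu Wxu; apply/eqP; rewrite -subr_eq0; apply/eqP/UW0.
    by apply: smemB => //; apply: (pE x).1.
  rewrite (_ : _ - u = (x - u) - (x - p x)); last by rewrite opprB [RHS]addrC subrKA.
  by apply: smemB => //; apply: (pE x).2.
have [|q qE] := @linear_of _ V V p.
  move=> a x y; have [[Ux Wx] [Uy Wy]] := (pE x, pE y).
  apply: uniq_p; first exact: smemL.
  by rewrite opprD addrACA -scalerBr; apply: smemL.
exists q; split=> [x|x Ux]; rewrite qE; first exact: (pE x).1.
by apply: uniq_p => //; rewrite subrr; apply: smem0.
Qed.

End Complement.

(** * The path algebra *)

Local Notation pcomp := Defs.pcomp.

Section PathSplit.
Variable Q : quiver.
Implicit Types p q r : qpath Q.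

Lemma qpath_eq p q : pstart p = pstart q -> parrows p = parrows q -> p = q.
Proof.
move=> e1 e2; apply: val_inj; move: e1 e2; rewrite /pstart /parrows.
by case: (val p) => ? ?; case: (val q) => ? ? /= -> ->.
Qed.

Lemma pcomp_some p q r : pcomp p q = Some r ->
  [/\ pend p = pstart q, pstart r = pstart p & parrows r = parrows p ++ parrows q].
Proof.
rewrite /pcomp; case: eqP => // e; case: insubP => // u _ vu [<-].
by rewrite /pstart /parrows vu.
Qed.

Lemma plen_comp p q r : pcomp p q = Some r -> plen r = (plen p + plen q)%N.
Proof. by case/pcomp_some=> _ _; rewrite /plen => ->; rewrite size_cat. Qed.

Lemma pcomp_cat p q r : pend p = pstart q -> pstart r = pstart p ->
  parrows r = parrows p ++ parrows q -> pcomp p q = Some r.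
Proof.
move=> e s a; have [u -> vu] := pcompP e; congr Some.
by apply: qpath_eq; rewrite /pstart /parrows vu.
Qed.

Lemma pcomp_injr p p' q q' r : plen q = plen q' ->
  pcomp p q = Some r -> pcomp p' q' = Some r -> p = p' /\ q = q'.
Proof.
move=> sq /[dup] lr /pcomp_some[e s a] /[dup] lr' /pcomp_some[e' s' a'].
have sp : size (parrows p) = size (parrows p').
  move: (plen_comp lr); rewrite (plen_comp lr') sq => /eqP.
  by rewrite eqn_add2r => /eqP.
move: a; rewrite a' => /eqP; rewrite eq_sym eqseq_cat // => /andP[/eqP ap /eqP aq].
have pp : p = p' by apply: qpath_eq => //; rewrite -s -s'.
by split=> //; apply: qpath_eq => //; rewrite -e -e' pp.
Qed.

Lemma pcomp_injl p p' q q' r : plen p = plen p' ->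
  pcomp p q = Some r -> pcomp p' q' = Some r -> p = p' /\ q = q'.
Proof.
move=> sp e e'; apply: (pcomp_injr _ e e').
move: (plen_comp e); rewrite (plen_comp e') sp => /eqP.
by rewrite eqn_add2l eq_sym => /eqP.
Qed.

Lemma path_split r i : (i <= plen r)%N ->
  exists p q, [/\ pcomp p q = Some r, plen p = i & plen q = (plen r - i)%N].
Proof.
move=> ir; have := valP r; rewrite -(cat_take_drop i (val r).2) is_walk_cat.
set s := take _ _; set t := drop _ _ => /andP[ws wt].
pose p : qpath Q := exist _ (_, s) ws; pose q : qpath Q := exist _ (_, t) wt.
exists p, q; split; last by rewrite /plen /parrows /= size_drop.
  by apply: pcomp_cat => //; rewrite /parrows /= cat_take_drop.
by rewrite /plen /parrows /= size_takel.
Qed.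

Lemma path_splitr r i : (i <= plen r)%N ->
  exists p q, pcomp p q = Some r /\ plen q = i.
Proof.
move=> ir; have [|p [q [e _ lq]]] := @path_split r (plen r - i); first exact: leq_subr.
by exists p, q; rewrite lq subKn.
Qed.

Lemma pcomp_triv_start p : pcomp (ptriv (pstart p)) p = Some p.
Proof. exact: pcomp_cat. Qed.

Lemma pcomp_triv_end p : pcomp p (ptriv (pend p)) = Some p.
Proof. by apply: pcomp_cat; rewrite // /parrows /= cats0. Qed.

(** A finite type, so that it can index the basis of a free module. *)
Record walk i := Walk {
  walk_val : qvert Q * i.-tuple (qarr Q);
  _ : is_walk walk_val.1 walk_val.2
}.
HB.instance Definition _ i := [isSub for @walk_val i].
HB.instance Definition _ i := [Finite of walk i by <:].

Definition wpath i (m : walk i) : qpath Q :=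
  exist _ ((val m).1, tval (val m).2) (valP m).

Lemma plen_wpath i (m : walk i) : plen (wpath m) = i.
Proof. by rewrite /plen /parrows /= size_tuple. Qed.

Lemma wpath_inj i : injective (@wpath i).
Proof.
move=> m m' /(congr1 val) /= [e1 e2]; apply: val_inj.
by rewrite [val m]surjective_pairing [val m']surjective_pairing e1; congr pair; apply: val_inj.
Qed.

Lemma walk_of p : exists m : walk (plen p), wpath m = p.
Proof.
have w := valP p; pose m : walk (plen p) := @Walk (plen p) ((val p).1, in_tuple (val p).2) w.
by exists m; apply: qpath_eq.
Qed.

End PathSplit.
Coercion wpath : walk >-> qpath.

(** The path algebra with opaque operations, so that products and multiples are
    compared by their arguments and not by unfolding finitely supported functions. *)
Section LockedPathAlgebra.
Variables (k : fieldType) (Q : quiver).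

Definition palg : Type := path_algebra k Q.
HB.instance Definition _ := GRing.Zmodule.on palg.

Definition of_palg (x : palg) : path_algebra k Q := x.

Definition palg_mul : palg -> palg -> palg :=
  locked (fun x y => of_palg x * of_palg y).
Definition palg_one : palg := locked (1 : path_algebra k Q).
Definition palg_scale : k -> palg -> palg :=
  locked (fun c x => c *: of_palg x).

Lemma palg_mulE x y : palg_mul x y = of_palg x * of_palg y.
Proof. by rewrite /palg_mul -lock. Qed.

Lemma palg_oneE : palg_one = (1 : path_algebra k Q).
Proof. by rewrite /palg_one -lock. Qed.

Lemma palg_scaleE c x : palg_scale c x = c *: of_palg x.
Proof. by rewrite /palg_scale -lock. Qed.

Fact palg_mulA : associative palg_mul.
Proof. by move=> x y z; rewrite !palg_mulE; apply: mulrA. Qed.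

Fact palg_mul1 : left_id palg_one palg_mul.
Proof. by move=> x; rewrite palg_mulE palg_oneE; apply: mul1r. Qed.

Fact palg_mulr1 : right_id palg_one palg_mul.
Proof. by move=> x; rewrite palg_mulE palg_oneE; apply: mulr1. Qed.

Fact palg_mulDl : left_distributive palg_mul +%R.
Proof. by move=> x y z; rewrite !palg_mulE; apply: mulrDl. Qed.

Fact palg_mulDr : right_distributive palg_mul +%R.
Proof. by move=> x y z; rewrite !palg_mulE; apply: mulrDr. Qed.

HB.instance Definition _ := GRing.Zmodule_isPzRing.Build palg
  palg_mulA palg_mul1 palg_mulr1 palg_mulDl palg_mulDr.

Fact palg_scaleA a b x : palg_scale a (palg_scale b x) = palg_scale (a * b) x.
Proof. by rewrite !palg_scaleE; apply: scalerA. Qed.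

Fact palg_scale1 : left_id 1 palg_scale.
Proof. by move=> x; rewrite palg_scaleE; apply: scale1r. Qed.

Fact palg_scaleDr : right_distributive palg_scale +%R.
Proof. by move=> a x y; rewrite !palg_scaleE; apply: scalerDr. Qed.

Fact palg_scaleDl x : {morph palg_scale^~ x : a b / a + b}.
Proof. by move=> a b; rewrite !palg_scaleE; apply: scalerDl. Qed.

HB.instance Definition _ := GRing.Zmodule_isLmodule.Build k palg
  palg_scaleA palg_scale1 palg_scaleDr palg_scaleDl.

Definition pbase : qpath Q -> palg := locked (fun p => << p >> : path_algebra k Q).
Definition pcoef : palg -> qpath Q -> k := locked (fun x p => (of_palg x)@_p).

Lemma pbaseE p : pbase p = << p >>.
Proof. by rewrite /pbase -lock. Qed.

Lemma pcoefE x p : pcoef x p = (of_palg x)@_p.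
Proof. by rewrite /pcoef -lock. Qed.

Lemma mulE (x y : palg) : x * y = of_palg x * of_palg y.
Proof. exact: palg_mulE. Qed.

Lemma scaleE c (x : palg) : c *: x = c *: of_palg x.
Proof. exact: palg_scaleE. Qed.

Lemma oneE : (1 : palg) = (1 : path_algebra k Q).
Proof. exact: palg_oneE. Qed.

Lemma scaleT_mull c (x y : palg) : c *: (x * y) = (c *: x) * y.
Proof. by rewrite !scaleE !mulE; apply: pm_mulZl. Qed.

Lemma scaleT_mulr c (x y : palg) : c *: (x * y) = x * (c *: y).
Proof. by rewrite !scaleE !mulE; apply: pm_mulZr. Qed.

Lemma pcoef_linear c (x y : palg) p :
  pcoef (c *: x + y) p = c * pcoef x p + pcoef y p.
Proof. by rewrite !pcoefE -[in RHS]mcoeffZ -mcoeffD scaleE. Qed.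

Lemma pcoef_base p q : pcoef (pbase p) q = (p == q)%:R.
Proof. by rewrite pcoefE pbaseE mcoeffU. Qed.

Lemma pcoef_inj (x y : palg) : (forall p, pcoef x p = pcoef y p) -> x = y.
Proof. by move=> xy; apply/malgP => p; have := xy p; rewrite !pcoefE. Qed.

Lemma psupp_fin (x : palg) : exists s : seq (qpath Q), forall p, pcoef x p != 0 -> p \in s.
Proof. by exists (msupp (of_palg x)) => p; rewrite pcoefE mcoeff_neq0. Qed.

Lemma pbase_mul p q : pbase p * pbase q = oapp pbase 0 (pcomp p q).
Proof.
rewrite mulE !pbaseE [LHS]pm_mulUU.
by case: (pmul p q) (erefl : pmul p q = pcomp p q) => [r|] <- /=; rewrite ?pbaseE.
Qed.

Lemma pbase_one : \sum_v pbase (ptriv v) = 1.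
Proof.
rewrite oneE [RHS](_ : _ = \sum_(p <- map (@ptriv Q) (enum (qvert Q))) << p >>) //.
by rewrite big_map big_enum; apply: eq_bigr => v _; rewrite pbaseE.
Qed.

End LockedPathAlgebra.
Arguments pbase {k Q} p.

Section PathAlgebra.
Variables (k : fieldType) (Q : quiver).
Local Notation T := (palg k Q).
Local Notation U p := (pbase (p : qpath Q) : T).
Local Notation e v := (pbase (ptriv v) : T).
Implicit Types (x y z : T) (p q r t : qpath Q) (v w : qvert Q).

Lemma pcoefD x y p : pcoef (x + y) p = pcoef x p + pcoef y p.
Proof. by rewrite -[x]scale1r pcoef_linear mul1r scale1r. Qed.

Lemma pcoef0 p : pcoef (0 : T) p = 0.
Proof. by apply: (addrI (pcoef 0 p)); rewrite -pcoefD !addr0. Qed.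

Lemma pcoefZ c x p : pcoef (c *: x) p = c * pcoef x p.
Proof. by rewrite -[c *: x]addr0 pcoef_linear pcoef0 addr0. Qed.

Lemma pcoef_sum I (s : seq I) (P : pred I) (F : I -> T) p :
  pcoef (\sum_(i <- s | P i) F i) p = \sum_(i <- s | P i) pcoef (F i) p.
Proof. exact: (big_morph (fun x => pcoef x p) (fun x y => pcoefD x y p) (pcoef0 p)). Qed.

Lemma psuppP x : exists s : seq (qpath Q),
  [/\ uniq s, forall p, p \in s -> pcoef x p != 0 & x = \sum_(p <- s) pcoef x p *: U p].
Proof.
have [s0 sP] := psupp_fin x; exists [seq p <- undup s0 | pcoef x p != 0].
split; [exact/filter_uniq/undup_uniq| by move=> p; rewrite mem_filter => /andP[]|].
set s := filter _ _; have us : uniq s by exact/filter_uniq/undup_uniq.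
apply: pcoef_inj => q; rewrite pcoef_sum.
have zero p : p != q -> pcoef (pcoef x p *: U p) q = 0.
  by move=> ne; rewrite pcoefZ pcoef_base (negbTE ne) mulr0.
have [xq|nq] := eqVneq (pcoef x q) 0.
  rewrite big1_seq // => p _; have [->|/zero //] := eqVneq p q.
  by rewrite pcoefZ xq mul0r.
have qs : q \in s by rewrite mem_filter nq mem_undup sP.
rewrite (bigD1_seq q) //= big1 => [|p /zero //].
by rewrite pcoefZ pcoef_base eqxx mulr1 addr0.
Qed.

Lemma path_ind (F : T -> Prop) : F 0 -> (forall x y, F x -> F y -> F (x + y)) ->
  (forall c x, F x -> F (c *: x)) -> (forall p, F (U p)) -> forall x, F x.
Proof.
move=> F0 FD FZ FU x; have [s [_ _ ->]] := psuppP x.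
by elim/big_ind: _ => // p _; apply: FZ.
Qed.

Lemma idem_path v p : e v * U p = if v == pstart p then U p else 0.
Proof.
rewrite pbase_mul; case: eqP => [->|/eqP ne]; first by rewrite pcomp_triv_start.
by rewrite pcomp_none.
Qed.

Lemma path_idem v p : U p * e v = if v == pend p then U p else 0.
Proof.
rewrite pbase_mul; case: eqP => [->|/eqP ne]; first by rewrite pcomp_triv_end.
by rewrite pcomp_none // eq_sym.
Qed.

Lemma idem_mul v w : e v * e w = if v == w then e v else 0.
Proof. by rewrite idem_path -[pstart (ptriv w)]/w; case: (v =P w) => [->|_]. Qed.

Lemma idem_idem v : e v * e v = e v.
Proof. by rewrite idem_mul eqxx. Qed.

Lemma idem_start p : e (pstart p) * U p = U p.
Proof. by rewrite idem_path eqxx. Qed.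

Lemma idem_end p : U p * e (pend p) = U p.
Proof. by rewrite path_idem eqxx. Qed.

(** ** Linear extension from paths *)

Lemma mext_exists (V : lmodType k) (F : qpath Q -> V) :
  exists f : {linear T -> V}, forall p, f (U p) = F p.
Proof.
have /choice[S SP] : forall x, exists s : seq (qpath Q), forall p, pcoef x p != 0 -> p \in s.
  exact: psupp_fin.
pose f x := \sum_(p <- undup (S x)) pcoef x p *: F p.
have fE (t : seq (qpath Q)) x : {subset S x <= t} -> f x = \sum_(p <- undup t) pcoef x p *: F p.
  move=> st; rewrite [RHS](bigID (mem (undup (S x)))) /= [X in _ + X]big1 ?addr0; last first.
    move=> p; rewrite mem_undup; have [->|/SP ->//] := eqVneq (pcoef x p) 0.
    by rewrite scale0r.
  rewrite -big_filter; apply: perm_big; apply: uniq_perm; rewrite ?undup_uniq //.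
    exact/filter_uniq/undup_uniq.
  move=> p; rewrite mem_filter /= !mem_undup.
  by apply/idP/andP => [ps|[]//]; split=> //; apply: st.
have [|g gE] := @linear_of k T V f; last first.
  exists g => p; rewrite gE (fE (p :: S (U p))); last by move=> q; rewrite inE orbC => ->.
  rewrite (bigD1_seq p) ?undup_uniq ?mem_undup ?mem_head //= big1 => [|q ne].
    by rewrite pcoef_base eqxx scale1r addr0.
  by rewrite pcoef_base eq_sym (negbTE ne) scale0r.
move=> c x y; pose t := S (c *: x + y) ++ S x ++ S y.
rewrite !(fE t) /t; try by move=> p ps; rewrite !mem_cat ps ?orbT.
rewrite scaler_sumr -big_split; apply: eq_bigr => p _ /=.
by rewrite pcoef_linear scalerDl scalerA.
Qed.

Definition mext (V : lmodType k) (F : qpath Q -> V) : {linear T -> V} :=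
  sval (cid (mext_exists F)).

Lemma mextU (V : lmodType k) (F : qpath Q -> V) p : mext F (U p) = F p.
Proof. exact: (svalP (cid (mext_exists F))). Qed.

(** ** Degrees *)

Definition degs (P : nat -> Prop) x := forall p, pcoef x p != 0 -> P (plen p).
Definition hdeg i := degs (fun n => n = i).
Definition dgeq s := degs (fun n => s <= n)%N.

Lemma degs_ind (P : nat -> Prop) (F : T -> Prop) :
  F 0 -> (forall x y, F x -> F y -> F (x + y)) ->
  (forall c p, P (plen p) -> F (c *: U p)) -> forall x, degs P x -> F x.
Proof.
move=> F0 FD FU x dx; have [s [_ sx ->]] := psuppP x; rewrite big_seq.
by elim/big_ind: _ => // p /sx /dx; apply: FU.
Qed.

Lemma degs0 P : degs P 0.
Proof. by move=> p; rewrite pcoef0 eqxx. Qed.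

Lemma degsL P c x y : degs P x -> degs P y -> degs P (c *: x + y).
Proof.
move=> dx dy p; rewrite pcoefD pcoefZ.
have [->|nx _] := eqVneq (pcoef x p) 0; last exact: dx.
by rewrite mulr0 add0r; apply: dy.
Qed.

Definition degs_sub P : submodule T := Submodule (degs0 P) (@degsL P).

Lemma degsD P x y : degs P x -> degs P y -> degs P (x + y).
Proof. by move=> dx dy; rewrite -(scale1r x); apply: degsL. Qed.

Lemma degsZ P c x : degs P x -> degs P (c *: x).
Proof. by move=> dx; rewrite -(addr0 (_ *: _)); apply: degsL => //; apply: degs0. Qed.

Lemma degs_sum P I (s : seq I) (R : pred I) (F : I -> T) :
  (forall i, R i -> degs P (F i)) -> degs P (\sum_(i <- s | R i) F i).
Proof.
by move=> dF; elim/big_ind: _ => //; [apply: degs0 | move=> x y; apply: degsD].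
Qed.

Lemma degsU (P : nat -> Prop) p : P (plen p) -> degs P (U p).
Proof. by move=> Pp q; rewrite pcoef_base; case: (p =P q) => [<-|]; rewrite ?eqxx. Qed.

Lemma degsW (P P' : nat -> Prop) x : (forall n, P n -> P' n) -> degs P x -> degs P' x.
Proof. by move=> PP' dx p /dx /PP'. Qed.

Lemma degs_mul (P1 P2 P : nat -> Prop) x y :
  (forall a b, P1 a -> P2 b -> P (a + b)%N) -> degs P1 x -> degs P2 y -> degs P (x * y).
Proof.
move=> PP dx dy; elim/degs_ind: x / dx => [|x x'|c p Pp].
- by rewrite mul0r; apply: degs0.
- by rewrite mulrDl => ? ?; apply: degsD.
rewrite -scaleT_mull; apply: degsZ.
elim/degs_ind: y / dy => [|y y'|d q Pq].
- by rewrite mulr0; apply: degs0.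
- by rewrite mulrDr => ? ?; apply: degsD.
rewrite -scaleT_mulr; apply: degsZ.
rewrite pbase_mul; case E: (pcomp p q) => [r|] /=; last exact: degs0.
by apply: degsU; rewrite (plen_comp E); apply: PP.
Qed.

Lemma hdeg_mul i j x y : hdeg i x -> hdeg j y -> hdeg (i + j) (x * y).
Proof.
apply: (@degs_mul (fun n => n = i) (fun n => n = j) (fun n => n = (i + j)%N)).
by move=> a b -> ->.
Qed.

Lemma geq_mul i j x y : dgeq i x -> dgeq j y -> dgeq (i + j) (x * y).
Proof. by apply: degs_mul => a b; apply: leq_add. Qed.

Lemma hdeg_geq i x : hdeg i x -> dgeq i x.
Proof. by apply: (@degsW (fun n => n = i)) => n ->. Qed.

Lemma geqW i j x : (i <= j)%N -> dgeq j x -> dgeq i x.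
Proof. by move=> ij; apply: degsW => n; apply: leq_trans. Qed.

Lemma hdeg_idem v : hdeg 0 (e v).
Proof. exact: (@degsU (fun n => n = 0%N)). Qed.

Lemma hdeg1 : hdeg 0 (1 : T).
Proof.
rewrite -pbase_one; apply: (@degs_sum (fun n => n = 0%N)) => v _.
exact: hdeg_idem.
Qed.

Lemma hdeg_path p : hdeg (plen p) (U p).
Proof. exact: (@degsU (fun n => n = plen p)). Qed.

Lemma hdeg_walk i (m : walk Q i) : hdeg i (U m).
Proof. by apply: (@degsU (fun n => n = i)); rewrite plen_wpath. Qed.

Lemma degs_bound x : exists B, degs (fun n => n <= B)%N x.
Proof.
have [s sP] := psupp_fin x; exists (\max_(p <- s) plen p) => p /sP px.
exact: (leq_bigmax_seq (F := @plen Q) _ px).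
Qed.

Definition res (P : pred nat) : {linear T -> T} :=
  mext (fun p => if P (plen p) then U p else 0).

Lemma coef_res P x p : pcoef (res P x) p = if P (plen p) then pcoef x p else 0.
Proof.
elim/path_ind: x => [|x y IH IH'|c x IH|q].
- by rewrite linear0 !pcoef0; case: ifP.
- by rewrite linearD /= !pcoefD IH IH'; case: ifP => _; rewrite ?addr0.
- by rewrite linearZZ !pcoefZ IH; case: ifP => _; rewrite ?mulr0.
rewrite /res mextU pcoef_base; case: eqP => [->|ne].
  by case: ifP => _; rewrite ?pcoef0 // pcoef_base eqxx.
by case: ifP => _; case: ifP => _; rewrite ?pcoef0 // pcoef_base; case: eqP.
Qed.

Lemma degs_res (P : pred nat) x : degs (fun n => P n) (res P x).
Proof. by move=> p; rewrite coef_res; case: ifP => //; rewrite eqxx. Qed.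

Lemma res_id (P : pred nat) x : degs (fun n => P n) x -> res P x = x.
Proof.
move=> dx; apply: pcoef_inj => p; rewrite coef_res.
by have [->|/dx /= ->] := eqVneq (pcoef x p) 0; last by []; case: ifP.
Qed.

Lemma res_none (P : pred nat) x : degs (fun n => ~~ P n) x -> res P x = 0.
Proof.
move=> dx; apply: pcoef_inj => p; rewrite coef_res pcoef0.
by have [->|/dx /= /negbTE ->] := eqVneq (pcoef x p) 0; last by []; case: ifP.
Qed.

Lemma hdeg_res i x : hdeg i (res (pred1 i) x).
Proof. by move=> p /degs_res /eqP. Qed.

Lemma res_hdeg P i x : hdeg i x -> res P x = if P i then x else 0.
Proof.
move=> hx; case: ifP => Pi; first by apply: res_id => p /hx ->.
by apply: res_none => p /hx ->; rewrite Pi.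
Qed.

Lemma res_geq P s x : dgeq s x -> dgeq s (res P x).
Proof. by move=> gx p; rewrite coef_res; case: ifP => _; [apply: gx | rewrite eqxx]. Qed.

Lemma res_mulr P j y z : hdeg j z ->
  res P (y * z) = res (fun n => P (n + j)%N) y * z.
Proof.
move=> hz; elim/degs_ind: z / hz => [|z z' IH IH'|d q lq].
- by rewrite !mulr0 linear0.
- by rewrite !mulrDr linearD /= IH IH'.
rewrite -!scaleT_mulr linearZZ; congr (_ *: _).
elim/path_ind: y => [|y y' IH IH'|c y IH|p].
- by rewrite linear0 !mul0r linear0.
- by rewrite mulrDl !linearD /= IH IH' mulrDl.
- by rewrite -scaleT_mull !linearZZ IH scaleT_mull.
rewrite pbase_mul {2}/res mextU; case E: (pcomp p q) => [r|] /=.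
  rewrite /res mextU (plen_comp E) lq; case: ifP; rewrite ?mul0r //.
  by rewrite pbase_mul E.
by rewrite linear0; case: ifP; rewrite ?mul0r // pbase_mul E.
Qed.

Lemma res_mull P i y z : hdeg i y ->
  res P (y * z) = y * res (fun n => P (i + n)%N) z.
Proof.
move=> hy; elim/degs_ind: y / hy => [|y y' IH IH'|c p lp].
- by rewrite !mul0r linear0.
- by rewrite !mulrDl linearD /= IH IH'.
rewrite -!scaleT_mull linearZZ; congr (_ *: _).
elim/path_ind: z => [|z z' IH IH'|d z IH|q].
- by rewrite linear0 !mulr0 linear0.
- by rewrite mulrDr !linearD /= IH IH' mulrDr.
- by rewrite -scaleT_mulr !linearZZ IH scaleT_mulr.
rewrite pbase_mul {2}/res mextU; case E: (pcomp p q) => [r|] /=.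
  rewrite /res mextU (plen_comp E) lp; case: ifP; rewrite ?mulr0 //.
  by rewrite pbase_mul E.
by rewrite linear0; case: ifP; rewrite ?mulr0 // pbase_mul E.
Qed.

Lemma sum_res x B : degs (fun n => n < B)%N x ->
  x = \sum_(h < B) res (pred1 (h : nat)) x.
Proof.
move=> dx; apply: pcoef_inj => p; rewrite pcoef_sum.
have [x0|nx] := eqVneq (pcoef x p) 0.
  by rewrite x0 big1 // => h _; rewrite coef_res x0; case: ifP.
rewrite (bigD1 (Ordinal (dx _ nx))) //= big1 ?addr0.
  by rewrite coef_res /= eqxx.
move=> h; rewrite -val_eqE /= => ne; rewrite coef_res /= eq_sym.
by rewrite (negbTE ne).
Qed.

(** ** Removing a path at one end *)

(** There is at most one such path, as two paths with the same product and the same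
    right factor are equal. *)
Definition rdiv q r : option (qpath Q) :=
  if pselect (exists p, pcomp p q = Some r) is left h then Some (sval (cid h)) else None.
Definition ldiv p r : option (qpath Q) :=
  if pselect (exists q, pcomp p q = Some r) is left h then Some (sval (cid h)) else None.

(** Division by [q] on the right, where the paths that do not end with [q] are
    sent to 0. *)
Definition dR q : {linear T -> T} := mext (fun r => oapp (@pbase k Q) 0 (rdiv q r)).
Definition dL p : {linear T -> T} := mext (fun r => oapp (@pbase k Q) 0 (ldiv p r)).

Lemma dR_mulr x q t : plen t = plen q ->
  dR q (x * (U t)) = if t == q then x * pbase (ptriv (pstart q)) else 0.
Proof.
move=> lt; elim/path_ind: x => [|x y IH IH'|c x IH|p].
- by rewrite !mul0r linear0; case: ifP.
- by rewrite !mulrDl linearD /= IH IH'; case: ifP; rewrite ?addr0.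
- by rewrite -!scaleT_mull linearZZ IH; case: ifP; rewrite ?scaler0.
rewrite !pbase_mul; case E: (pcomp p t) => [r|] /=; last first.
  rewrite linear0; case: (t =P q) => // <-; rewrite -pbase_mul path_idem; case: eqP => // e.
  by have [r] := pcompP (esym e); rewrite E.
rewrite /dR mextU /rdiv; case: pselect => [h|nh].
  case: (cid h) => p' /= E'; have [<- <-] := pcomp_injr lt E E'.
  by rewrite eqxx; have [<- _ _] := pcomp_some E; rewrite pcomp_triv_end.
by case: eqP => // tq; case: nh; exists p; rewrite -tq.
Qed.

Lemma dL_mull x p t : plen t = plen p ->
  dL p ((U t) * x) = if t == p then pbase (ptriv (pend p)) * x else 0.
Proof.
move=> lt; elim/path_ind: x => [|x y IH IH'|c x IH|q].
- by rewrite !mulr0 linear0; case: ifP.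
- by rewrite !mulrDr linearD /= IH IH'; case: ifP; rewrite ?addr0.
- by rewrite -!scaleT_mulr linearZZ IH; case: ifP; rewrite ?scaler0.
rewrite !pbase_mul; case E: (pcomp t q) => [r|] /=; last first.
  rewrite linear0; case: (t =P p) => // <-; rewrite -pbase_mul idem_path; case: eqP => // e.
  by have [r] := pcompP e; rewrite E.
rewrite /dL mextU /ldiv; case: pselect => [h|nh].
  case: (cid h) => q' /= E'; have [<- <-] := pcomp_injl lt E E'.
  by rewrite eqxx; have [-> _ _] := pcomp_some E; rewrite pcomp_triv_start.
by case: eqP => // tp; case: nh; exists q; rewrite -tp.
Qed.

Lemma geq_ind s (F : T -> Prop) : F 0 -> (forall x y, F x -> F y -> F (x + y)) ->
  (forall x t, plen t = s -> F (x * (U t))) -> forall x, dgeq s x -> F x.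
Proof.
move=> F0 FD FM x; elim/degs_ind => // c p /path_splitr[p1 [p2 [E l2]]].
by rewrite -[U p]/(oapp (@pbase k Q) 0 (Some p)) -E -pbase_mul scaleT_mull; apply: FM.
Qed.

Lemma geq_indl s (F : T -> Prop) : F 0 -> (forall x y, F x -> F y -> F (x + y)) ->
  (forall x t, plen t = s -> F ((U t) * x)) -> forall x, dgeq s x -> F x.
Proof.
move=> F0 FD FM x; elim/degs_ind => // c p /path_split[p1 [p2 [E l1 _]]].
by rewrite -[U p]/(oapp (@pbase k Q) 0 (Some p)) -E -pbase_mul scaleT_mulr; apply: FM.
Qed.

Lemma dR_mul q y z : dgeq (plen q) z -> dR q (y * z) = y * dR q z.
Proof.
move: z; apply: geq_ind => [|z z' IH IH'|x t lt].
- by rewrite mulr0 linear0 mulr0.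
- by rewrite mulrDr !linearD /= IH IH' mulrDr.
by rewrite mulrA !dR_mulr //; case: ifP; rewrite ?mulr0 ?mulrA.
Qed.

Lemma dL_mul p y z : dgeq (plen p) y -> dL p (y * z) = dL p y * z.
Proof.
move: y; apply: geq_indl => [|y y' IH IH'|x t lt].
- by rewrite mul0r linear0 mul0r.
- by rewrite mulrDl !linearD /= IH IH' mulrDl.
by rewrite -mulrA !dL_mull //; case: ifP; rewrite ?mul0r ?mulrA.
Qed.

Lemma dR_hdeg q z : hdeg (plen q) z -> dR q z = pcoef z q *: pbase (ptriv (pstart q)).
Proof.
move=> hz; elim/degs_ind: z / hz => [|z z' IH IH'|c t lt].
- by rewrite linear0 pcoef0 scale0r.
- by rewrite linearD /= IH IH' pcoefD scalerDl.
rewrite linearZZ pcoefZ pcoef_base -scalerA /=; congr (_ *: _).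
rewrite -[X in dR q X]mul1r dR_mulr //; case: eqP => _; last by rewrite scale0r.
by rewrite mul1r scale1r.
Qed.

(** A path of length at least [s] determines its last [s] arrows and the path before
    them. *)
Lemma sum_dR s x : dgeq s x -> x = \sum_(q : walk Q s) dR q x * (U q).
Proof.
move: x; apply: geq_ind => [|x y {1}-> {1}->|x t lt].
- by rewrite big1 // => q _; rewrite linear0 mul0r.
- by rewrite -big_split; apply: eq_bigr => q _ /=; rewrite linearD mulrDl.
have [m mt] := walk_of t; move: m mt; rewrite lt => m mt.
rewrite (bigD1 m) //= big1 ?addr0.
  by rewrite dR_mulr ?plen_wpath // mt eqxx -mulrA idem_start.
move=> q ne; rewrite dR_mulr ?plen_wpath // -mt (inj_eq (@wpath_inj _ _)).
by rewrite eq_sym (negbTE ne) mul0r.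
Qed.

Lemma sum_dL s x : dgeq s x -> x = \sum_(p : walk Q s) (U p) * dL p x.
Proof.
move: x; apply: geq_indl => [|x y {1}-> {1}->|x t lt].
- by rewrite big1 // => q _; rewrite linear0 mulr0.
- by rewrite -big_split; apply: eq_bigr => q _ /=; rewrite linearD mulrDr.
have [m mt] := walk_of t; move: m mt; rewrite lt => m mt.
rewrite (bigD1 m) //= big1 ?addr0.
  by rewrite dL_mull ?plen_wpath // mt eqxx mulrA idem_end.
move=> q ne; rewrite dL_mull ?plen_wpath // -mt (inj_eq (@wpath_inj _ _)).
by rewrite eq_sym (negbTE ne) mulr0.
Qed.

Lemma hdeg_sum s z : hdeg s z -> z = \sum_(q : walk Q s) pcoef z q *: (U q).
Proof.
move=> hz; rewrite {1}(sum_dR (hdeg_geq hz)); apply: eq_bigr => q _.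
by rewrite dR_hdeg ?plen_wpath // -scaleT_mull idem_start.
Qed.

Lemma pcoef_mul_idem x v p : pcoef (x * e v) p = if v == pend p then pcoef x p else 0.
Proof.
elim/path_ind: x => [|x y IH IH'|c x IH|q].
- by rewrite mul0r pcoef0 if_same.
- by rewrite mulrDl !pcoefD IH IH'; case: ifP => _; rewrite ?addr0.
- by rewrite -scaleT_mull !pcoefZ IH; case: ifP => _; rewrite ?mulr0.
rewrite path_idem; case: (v =P pend q) => [->|nq]; rewrite ?pcoef0 pcoef_base.
  by case: (q =P p) => [->|_]; rewrite ?eqxx // if_same.
by case: (q =P p) => [<-|_]; [case: eqP | rewrite if_same].
Qed.

Lemma pcoef_idem_mul x v p : pcoef (e v * x) p = if v == pstart p then pcoef x p else 0.
Proof.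
elim/path_ind: x => [|x y IH IH'|c x IH|q].
- by rewrite mulr0 pcoef0 if_same.
- by rewrite mulrDr !pcoefD IH IH'; case: ifP => _; rewrite ?addr0.
- by rewrite -scaleT_mulr !pcoefZ IH; case: ifP => _; rewrite ?mulr0.
rewrite idem_path; case: (v =P pstart q) => [->|nq]; rewrite ?pcoef0 pcoef_base.
  by case: (q =P p) => [->|_]; rewrite ?eqxx // if_same.
by case: (q =P p) => [<-|_]; [case: eqP | rewrite if_same].
Qed.

Lemma dR_hdeg_mul s (q : walk Q s) y z : hdeg s z ->
  dR q (y * z) = pcoef z q *: (y * pbase (ptriv (pstart q))).
Proof.
move=> hz; rewrite dR_mul ?plen_wpath; last exact: hdeg_geq.
by rewrite dR_hdeg ?plen_wpath // scaleT_mulr.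
Qed.

Lemma degs_dR (P : nat -> Prop) s (q : walk Q s) x :
  dgeq s x -> degs (fun n => P (n - s)%N) x -> degs P (dR q x).
Proof.
move=> gx dx; have dgx : degs (fun n => (s <= n)%N /\ P (n - s)%N) x.
  by move=> p np; split; [apply: gx | apply: dx].
elim/degs_ind: x / dgx {gx dx} => [|x y|c p [/path_splitr[p1 [p2 [E l2]]] Pp]].
- by rewrite linear0; apply: degs0.
- by rewrite linearD; apply: degsD.
rewrite linearZZ; apply: degsZ.
rewrite -[U p]/(oapp (@pbase k Q) 0 (Some p)) -E -pbase_mul dR_mulr ?plen_wpath //.
case: eqP => [p2q|_]; last exact: degs0.
rewrite -p2q; have [<- _ _] := pcomp_some E; rewrite idem_end; apply: degsU.
by move: Pp; rewrite (plen_comp E) l2 addnK.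
Qed.

Lemma degs_dL (P : nat -> Prop) s (q : walk Q s) x :
  dgeq s x -> degs (fun n => P (n - s)%N) x -> degs P (dL q x).
Proof.
move=> gx dx; have dgx : degs (fun n => (s <= n)%N /\ P (n - s)%N) x.
  by move=> p np; split; [apply: gx | apply: dx].
elim/degs_ind: x / dgx {gx dx} => [|x y|c p [/path_split[p1 [p2 [E l1 _]]] Pp]].
- by rewrite linear0; apply: degs0.
- by rewrite linearD; apply: degsD.
rewrite linearZZ; apply: degsZ.
rewrite -[U p]/(oapp (@pbase k Q) 0 (Some p)) -E -pbase_mul dL_mull ?plen_wpath //.
case: eqP => [p1q|_]; last exact: degs0.
rewrite -p1q; have [-> _ _] := pcomp_some E; rewrite idem_start; apply: degsU.
by move: Pp; rewrite (plen_comp E) l1 addKn.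
Qed.

End PathAlgebra.
Arguments degs_sub {k Q} P.
Arguments res {k Q} P.
Arguments dR {k Q} q.
Arguments dL {k Q} p.

(** * Products of subspaces and the spaces K_i *)

Section Products.
Variables (k : fieldType) (Q : quiver).
Local Notation T := (palg k Q).
Implicit Types (X Y Z : T -> Prop) (x y z : T).

Inductive sprod X Y : T -> Prop :=
| sprod0 : sprod X Y 0
| sprodD x y : sprod X Y x -> sprod X Y y -> sprod X Y (x + y)
| sprodM x y : X x -> Y y -> sprod X Y (x * y).

Lemma sprod_sub X Y (Z : submodule T) x :
  (forall x y, X x -> Y y -> Z (x * y)) -> sprod X Y x -> Z x.
Proof.
move=> XYZ; elim=> [|y z _ Zy _ Zz|y z]; [exact: smem0|exact: smemD|exact: XYZ].
Qed.

Lemma sprodS X X' Y Y' x : (forall x, X x -> X' x) -> (forall y, Y y -> Y' y) ->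
  sprod X Y x -> sprod X' Y' x.
Proof.
move=> XX YY; elim=> [|y z _ ? _ ?|y z /XX ? /YY ?].
- exact: sprod0.
- exact: sprodD.
- exact: sprodM.
Qed.

Lemma sprodL (X : submodule T) Y c x y :
  sprod X Y x -> sprod X Y y -> sprod X Y (c *: x + y).
Proof.
move=> Xx Xy; apply: sprodD => //; elim: Xx => [|z z' _ IH _ IH'|z z' Xz Yz].
- by rewrite scaler0; apply: sprod0.
- by rewrite scalerDr; apply: sprodD.
- by rewrite scaleT_mull; apply: sprodM => //; apply: smemZ.
Qed.

Definition prodS (X : submodule T) Y : submodule T :=
  Submodule (sprod0 X Y) (@sprodL X Y).

Lemma sprod_mull X Y a x : (forall y, X y -> X (a * y)) ->
  sprod X Y x -> sprod X Y (a * x).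
Proof.
move=> Xa; elim=> [|y z _ ? _ ?|y z /Xa ? ?].
- by rewrite mulr0; apply: sprod0.
- by rewrite mulrDr; apply: sprodD.
- by rewrite mulrA; apply: sprodM.
Qed.

Lemma sprod_mulr X Y a x : (forall y, Y y -> Y (y * a)) ->
  sprod X Y x -> sprod X Y (x * a).
Proof.
move=> Ya; elim=> [|y z _ ? _ ?|y z ? /Ya ?].
- by rewrite mul0r; apply: sprod0.
- by rewrite mulrDl; apply: sprodD.
- by rewrite -mulrA; apply: sprodM.
Qed.

Definition fullS : submodule T.
Proof. by exists (fun _ => True). Defined.

Definition homS i : submodule T := degs_sub (fun n => n = i).

Definition graded X := forall (P : pred nat) x, X x -> X (res P x).

Lemma graded_full : graded fullS. Proof. by []. Qed.

Lemma graded_geq s : graded (dgeq s).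
Proof. by move=> P x; apply: res_geq. Qed.

Lemma graded_sprod X Y j : graded X -> (forall y, Y y -> hdeg j y) ->
  graded (sprod X Y).
Proof.
move=> gX hY P x; elim=> [|y z _ ? _ ?|y z Xy Yz].
- by rewrite linear0; apply: sprod0.
- by rewrite linearD; apply: sprodD.
- by rewrite (res_mulr _ _ (hY _ Yz)); apply: sprodM => //; apply: gX.
Qed.

(** Degrees add up in a product, so that an element of degree [h + j] only involves
    the components of degree [h] of the left factors. *)
Lemma sprod_comp X Y h j x : graded X -> (forall y, Y y -> hdeg j y) ->
  sprod X Y x -> hdeg (h + j) x -> sprod (fun y => X y /\ hdeg h y) Y x.
Proof.
move=> gX hY Xx hx; rewrite -[x](@res_id _ _ (pred1 (h + j)%N)); last first.
  by move=> p /hx ->; rewrite /= eqxx.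
elim: Xx {hx} => [|y z _ ? _ ?|y z Xy Yz].
- by rewrite linear0; apply: sprod0.
- by rewrite linearD; apply: sprodD.
rewrite (res_mulr _ _ (hY _ Yz)); apply: sprodM => //; split; first exact: gX.
by move=> p /degs_res; rewrite /= eqn_add2r => /eqP.
Qed.

Lemma sprod_geq (X : submodule T) s x : dgeq s x ->
  (forall q : walk Q s, X (dR q x)) -> sprod X (hdeg s) x.
Proof.
move=> gx Xx; rewrite (sum_dR gx); apply: (smem_sum (U := prodS X (hdeg s))).
by move=> q _; apply: sprodM => //; apply: hdeg_walk.
Qed.

Lemma sprod_in_geq (X : submodule T) i s x :
  (forall x, X x -> dgeq i x) -> sprod X (hdeg s) x -> dgeq (i + s) x.
Proof.
move=> Xi; apply: (@sprod_sub _ _ (degs_sub (fun n => i + s <= n)%N)) => y z /Xi ? ?.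
by apply: geq_mul => //; apply: hdeg_geq.
Qed.

Lemma geq_sprod s x : dgeq s x -> sprod fullS (hdeg s) x.
Proof. by move=> gx; apply: sprod_geq. Qed.

End Products.
Arguments fullS {k Q}.
Arguments homS {k Q} i.

(** The ideals I of the path algebra for which T/I is positively graded with
    degrees 0 and 1 those of T. *)
Record gideal (k : fieldType) (Q : quiver) := GIdeal {
  gid :> submodule (palg k Q);
  gid_l : forall a x, gid x -> gid (a * x);
  gid_r : forall a x, gid x -> gid (x * a);
  gid_graded : graded gid;
  gid_geq2 : forall x, gid x -> dgeq 2 x
}.

Section KoszulSpaces.
Variables (k : fieldType) (Q : quiver) (I : gideal k Q).
Local Notation T := (palg k Q).
Implicit Types (x y z : T).

Definition quad x := I x /\ hdeg 2 x.
Local Notation R := quad.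

Lemma quadRL c x y : R x -> R y -> R (c *: x + y).
Proof. by move=> [Ix hx] [Iy hy]; split; [apply: smemL | apply: degsL]. Qed.

Lemma quadR0 : R 0.
Proof. by split; [apply: smem0 | apply: degs0]. Qed.

Definition quadS : submodule T := Submodule quadR0 quadRL.

(** The space K_i, which is T_i when [i < 2] because there are then no conditions. The
    degree is stated separately for this reason. *)
Definition Kk i x :=
  (forall r s, (r + s + 2)%N = i -> sprod (sprod (hdeg r) R) (hdeg s) x) /\ hdeg i x.

Lemma Kk0 i : Kk i 0.
Proof.
split; last exact: degs0.
by move=> r s _; apply: sprod0.
Qed.

Lemma KkL i c x y : Kk i x -> Kk i y -> Kk i (c *: x + y).
Proof.
move=> [Kx hx] [Ky hy]; split; last exact: degsL.
move=> r s rs.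
by apply: (@sprodL _ _ (prodS (homS r) R)); [apply: Kx | apply: Ky].
Qed.

Definition KS i : submodule T := Submodule (Kk0 i) (@KkL i).

Lemma Kk_hdeg i x : Kk i x -> hdeg i x. Proof. by case. Qed.

Lemma Kk_T0l i a x : hdeg 0 a -> Kk i x -> Kk i (a * x).
Proof.
move=> ha [Kx hx]; split; last by rewrite -[i]add0n; apply: hdeg_mul.
move=> r s rs; apply: sprod_mull (Kx r s rs) => y.
by apply: sprod_mull => z hz; rewrite -[r]add0n; apply: hdeg_mul.
Qed.

Lemma Kk_T0r i a x : hdeg 0 a -> Kk i x -> Kk i (x * a).
Proof.
move=> ha [Kx hx]; split; last by rewrite -[i]addn0; apply: hdeg_mul.
move=> r s rs; apply: sprod_mulr (Kx r s rs) => y hy.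
by rewrite -[s]addn0; apply: hdeg_mul.
Qed.

Lemma hdeg_Kk0 x : hdeg 0 x -> Kk 0 x.
Proof. by move=> hx; split=> // r s; rewrite addn2. Qed.

Lemma hdeg_Kk1 x : hdeg 1 x -> Kk 1 x.
Proof. by move=> hx; split=> // r s; rewrite addn2. Qed.

(** The conditions that do not involve the first arrow survive when it is cut off. *)
Lemma Kk_subl i x : Kk i.+1 x -> sprod (hdeg 1) (Kk i) x.
Proof.
move=> [Kx hx]; have gx : dgeq 1 x.
  by apply: (geqW _ (hdeg_geq hx)).
rewrite (sum_dL gx); apply: (smem_sum (U := prodS (homS 1) (Kk i))) => p _.
apply: sprodM; first exact: hdeg_walk.
split; last first.
  by apply: degs_dL => // q /hx ->; rewrite subn1.
move=> r s rs.
have rs1 : (r.+1 + s + 2)%N = i.+1 by rewrite !addSn rs.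
elim: (Kx _ _ rs1) => [|y z _ ? _ ?|y z Xy hz].
- by rewrite linear0; apply: sprod0.
- by rewrite linearD; apply: sprodD.
elim: Xy => [|u v _ ? _ ?|a b ha Rb].
- by rewrite mul0r linear0; apply: sprod0.
- by rewrite mulrDl linearD; apply: sprodD.
have ga : dgeq 1 a by apply: (geqW _ (hdeg_geq ha)).
rewrite -mulrA dL_mul ?plen_wpath // mulrA; do 2?apply: sprodM => //.
by apply: degs_dL => // q /ha ->; rewrite subn1.
Qed.

Lemma Kk_subr i x : Kk i.+1 x -> sprod (Kk i) (hdeg 1) x.
Proof.
move=> [Kx hx]; have gx : dgeq 1 x.
  by apply: (geqW _ (hdeg_geq hx)).
rewrite (sum_dR gx); apply: (smem_sum (U := prodS (KS i) (hdeg 1))) => p _.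
apply: sprodM; last exact: hdeg_walk.
split; last first.
  by apply: degs_dR => // q /hx ->; rewrite subn1.
move=> r s rs.
have rs1 : (r + s.+1 + 2)%N = i.+1 by rewrite -rs !addn2 addnS.
elim: (Kx _ _ rs1) => [|y z _ ? _ ?|y z Xy hz].
- by rewrite linear0; apply: sprod0.
- by rewrite linearD; apply: sprodD.
have gz : dgeq 1 z by apply: (geqW _ (hdeg_geq hz)).
rewrite dR_mul ?plen_wpath //; apply: sprodM => //.
by apply: degs_dR => // q /hz ->; rewrite subn1.
Qed.

Lemma Kk_quadl i x : Kk i.+2 x -> sprod R (hdeg i) x.
Proof.
move=> [Kx hx]; have := Kx 0%N i (addn2 i).
apply: sprodS => // y; apply: (@sprod_sub _ _ _ _ quadS) => a b ha [Ib hb].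
by split; [apply: gid_l | exact: (hdeg_mul ha hb)].
Qed.

Lemma Kk_quadr i x : Kk i.+2 x -> sprod (hdeg i) R x.
Proof.
move=> [Kx hx]; have := Kx i 0%N; rewrite addn0 addn2 => /(_ erefl).
elim=> [|y z _ ? _ ?|y z Xy hz]; [exact: sprod0|exact: sprodD|].
apply: sprod_mulr Xy => b [Ib hb]; split; first exact: gid_r.
exact: (hdeg_mul hb hz).
Qed.

(** The conditions that start after the first arrow are inherited from K_i, so only the
    one at the left end has to be added. *)
Lemma Kk_intro i x : sprod (hdeg 1) (Kk i) x ->
  (forall j, i = j.+1 -> sprod R (hdeg j) x) -> Kk i.+1 x.
Proof.
move=> Tx Rx; split; last first.
  apply: (@sprod_sub _ _ _ _ (homS i.+1)) Tx => y z hy [_ hz].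
  exact: (hdeg_mul hy hz).
move=> -[|r] s.
  rewrite add0n addn2 => -[si]; apply: sprodS (Rx s (esym si)) => // y Ry.
  by rewrite -[y]mul1r; apply: sprodM => //; apply: hdeg1.
move=> rs; have {}rs : (r + s + 2)%N = i by move: rs; rewrite !addSn => -[].
elim: Tx => [|y z _ ? _ ?|y z hy [Kz _]];
  [exact: sprod0|exact: sprodD|].
elim: (Kz r s rs) => [|u v _ ? _ ?|u v Xu hv].
- by rewrite mulr0; apply: sprod0.
- by rewrite mulrDr; apply: sprodD.
rewrite mulrA; apply: sprodM => //.
elim: Xu => [|u' v' _ ? _ ?|u' v' hu Rv].
- by rewrite mulr0; apply: sprod0.
- by rewrite mulrDr; apply: sprodD.
by rewrite mulrA; apply: sprodM => //; exact: (hdeg_mul hy hu).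
Qed.

(** [TK i] stands for T K_i and [IT i] for I T_i, both inside T; the left Koszul complex
    is [TK i / (TK i /\ IT i)], which is A K_i, and its differentials are induced by
    the inclusions of [TK i.+1] into [TK i]. *)
Definition TK i : submodule T := prodS fullS (Kk i).
Definition IT i : submodule T := prodS I (hdeg i).

(** The elements of T that vanish in the term of index [i - 1] of the left Koszul
    complex, this term being A_0 for [i = 0]. *)
Definition ITp i : submodule T :=
  if i is j.+1 then IT j else degs_sub (fun n => 1 <= n)%N.

Lemma TK_mull i a x : TK i x -> TK i (a * x).
Proof. by apply: sprod_mull. Qed.

Lemma IT_mull i a x : IT i x -> IT i (a * x).
Proof. by apply: sprod_mull => y; apply: gid_l. Qed.

Lemma ITp_mull i a x : ITp i x -> ITp i (a * x).
Proof.
case: i => [|i]; last exact: IT_mull.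
by move=> gx; apply: (@geq_mul _ _ 0 1).
Qed.

Lemma TK_mulr0 i a x : hdeg 0 a -> TK i x -> TK i (x * a).
Proof. by move=> ha; apply: sprod_mulr => y; apply: Kk_T0r. Qed.

Lemma Kk_TK i x : Kk i x -> TK i x.
Proof. by move=> Kx; rewrite -[x]mul1r; apply: sprodM. Qed.

Lemma TK_geq i x : TK i x -> dgeq i x.
Proof.
apply: (@sprod_sub _ _ _ _ (degs_sub (fun n => i <= n)%N)) => y z _ /Kk_hdeg hz.
by apply: (@geq_mul _ _ 0 i) => //; apply: hdeg_geq.
Qed.

Lemma IT_geq i x : IT i x -> dgeq i x.
Proof.
apply: (@sprod_sub _ _ _ _ (degs_sub (fun n => i <= n)%N)) => y z _ hz.
by apply: (@geq_mul _ _ 0 i) => //; apply: hdeg_geq.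
Qed.

Lemma TK_graded i : graded (TK i).
Proof. by apply: (@graded_sprod _ _ _ _ i) => [|y /Kk_hdeg]; first exact: graded_full. Qed.

Lemma IT_graded i : graded (IT i).
Proof. by apply: (@graded_sprod _ _ _ _ i) => //; exact: (gid_graded (g := I)). Qed.

Lemma TK_Kk i x : TK i x -> hdeg i x -> Kk i x.
Proof.
move=> Tx; rewrite -{1}[i]add0n => hx.
have := sprod_comp (@graded_full k Q) (@Kk_hdeg i) Tx hx.
by apply: (@sprod_sub _ _ _ _ (KS i)) => a b [_ ha]; apply: Kk_T0l.
Qed.

Lemma TK_decr i x : TK i.+1 x -> TK i x.
Proof.
apply: sprod_sub => y z _ /Kk_subl Kz; apply: TK_mull.
exact: sprodS Kz.
Qed.

Lemma TK_ITp i x : TK i.+1 x -> ITp i x.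
Proof.
apply: sprod_sub => y z _ Kz; apply: ITp_mull; case: i Kz => [|i] Kz.
  exact: hdeg_geq (Kk_hdeg Kz).
by apply: sprodS (Kk_quadl Kz) => // u [].
Qed.

(** The cycles of the left Koszul complex at index [i] have degree at least [i + 1], and
    those of that degree form K_(i+1), which is why it generates the next term. *)
Lemma TK_ITp_Kk i x : TK i x -> ITp i x -> hdeg i.+1 x -> Kk i.+1 x.
Proof.
move=> Tx Zx hx; apply: Kk_intro => [|j ij].
  have := sprod_comp (h := 1) (@graded_full k Q) (@Kk_hdeg i) Tx hx.
  by apply: sprodS => // y [].
rewrite ij in Zx hx.
exact: (sprod_comp (h := 2) (gid_graded (g := I)) (fun y hy => hy) Zx hx).
Qed.

Local Notation e v := (pbase (ptriv v) : T).

(** Cutting a linear projection by the idempotents on both sides and adding up makes it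
    a morphism of T_0-bimodules. *)
Lemma K_projection i : exists p : {linear T -> T},
  [/\ forall x, Kk i (p x), forall x, Kk i x -> p x = x,
      forall v x, p (e v * x) = e v * p x & forall v x, p (x * e v) = p x * e v].
Proof.
have [p0 [pK pid]] := projection_exists (KS i).
pose f x : T := \sum_v \sum_w e v * p0 (e v * x * e w) * e w.
have [|p pE] := @linear_of k T T f.
  move=> c x y; rewrite scaler_sumr -big_split; apply: eq_bigr => v _ /=.
  rewrite scaler_sumr -big_split; apply: eq_bigr => w _ /=.
  rewrite mulrDr -scaleT_mulr mulrDl -scaleT_mull linearP mulrDr mulrDl.
  by rewrite -scaleT_mulr -scaleT_mull.
have Ke x v w : Kk i x -> Kk i (e v * x * e w).
  by move=> Kx; apply: Kk_T0r; [apply: hdeg_idem|apply: Kk_T0l; first exact: hdeg_idem].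
exists p; split=> [x|x Kx|v x|v x]; rewrite !pE /f.
- apply: (smem_sum (U := KS i)) => v _; apply: (smem_sum (U := KS i)) => w _.
  exact/Ke/pK.
- rewrite -[RHS]mul1r -[RHS]mulr1 -pbase_one mulr_suml mulr_suml.
  apply: eq_bigr => v _; rewrite mulr_sumr; apply: eq_bigr => w _.
  rewrite pid; last exact: Ke.
  by rewrite !mulrA idem_idem -!mulrA idem_idem.
- rewrite (bigD1 v) //= [X in _ + X]big1 ?addr0 => [|u ne]; last first.
    rewrite big1 // => w _.
    by rewrite !mulrA idem_mul (negbTE ne) !mul0r linear0 mulr0 mul0r.
  rewrite [in RHS]mulr_sumr [RHS](bigD1 v) //= [X in _ + X]big1 ?addr0 => [|u ne]; last first.
    rewrite mulr_sumr big1 // => w _.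
    by rewrite !mulrA idem_mul eq_sym (negbTE ne) !mul0r.
  by rewrite mulr_sumr; apply: eq_bigr => w _; rewrite !mulrA idem_idem.
rewrite mulr_suml; apply: eq_bigr => u _.
rewrite (bigD1 v) //= [X in _ + X]big1 ?addr0 => [|w ne]; last first.
  by rewrite -!mulrA idem_mul eq_sym (negbTE ne) !mulr0 linear0 mul0r mulr0.
rewrite [in RHS]mulr_suml [RHS](bigD1 v) //= [X in _ + X]big1 ?addr0 => [|w ne]; last first.
  by rewrite -!mulrA idem_mul (negbTE ne) !mulr0.
by rewrite -!mulrA idem_idem.
Qed.

End KoszulSpaces.

(** * Graded modules *)

(** T/I, known through its projection only. *)
Record presentation (k : fieldType) (Q : quiver) (I : gideal k Q) (A : kalgType k) :=
  Presentation {
  pr :> {rmorphism palg k Q -> A};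
  pr_surj : forall a, exists x, pr x = a;
  pr_ker : forall x, pr x = 0 <-> I x;
  pr_scale : forall c x, pr (c *: x) = kscal c * pr x
}.

Section GradedModules.
Variables (k : fieldType) (Q : quiver) (I : gideal k Q) (A : kalgType k).
Variable (pi : presentation I A).
Local Notation T := (palg k Q).

Definition graded_module (M : lmodType A) (g : int -> M -> Prop) : Prop :=
  [/\ forall j, g j 0 /\ (forall x y, g j x -> g j y -> g j (x - y)),
      forall i j a x, hdeg i a -> g j x -> g (i%:Z + j) (pi a *: x),
      forall x, exists (s : seq int) (f : int -> M),
        (forall j, g j (f j)) /\ x = \sum_(j <- s) f j
    & forall (s : seq int) (f : int -> M), uniq s -> (forall j, g j (f j)) ->
        \sum_(j <- s) f j = 0 -> forall j, j \in s -> f j = 0].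

Section Components.
Variables (M : lmodType A) (g : int -> M -> Prop) (gM : graded_module g).

Lemma gr0 j : g j 0. Proof. by have [/(_ j)[]] := gM. Qed.
Lemma grB j x y : g j x -> g j y -> g j (x - y).
Proof. by have [/(_ j)[_]] := gM => + _ _ _; apply. Qed.
Lemma grN j x : g j x -> g j (- x).
Proof. by move=> gx; rewrite -[- x]add0r; apply: grB => //; apply: gr0. Qed.
Lemma grD j x y : g j x -> g j y -> g j (x + y).
Proof. by move=> gx gy; rewrite -[y]opprK; apply: grB => //; apply: grN. Qed.
Lemma grM h j a x : hdeg h a -> g j x -> g (h%:Z + j) (pi a *: x).
Proof. by have [_ + _ _] := gM; apply. Qed.

Let decomp x (f : int -> M) := (forall j, g j (f j)) /\
  exists s : seq int, [/\ uniq s, forall j, j \notin s -> f j = 0 & x = \sum_(j <- s) f j].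

Let decomp_exists x : exists f, decomp x f.
Proof.
have [_ _ /(_ x)[s [f [gf ->]]] _] := gM.
exists (fun j => \sum_(i <- s | i == j) f i); split.
  move=> j; elim/big_ind: _ => //; [exact: gr0|exact: grD|].
  by move=> i /eqP <-.
exists (undup s); split; first exact: undup_uniq.
  move=> j; rewrite mem_undup => js; rewrite big1_seq // => i /andP[/eqP -> js'].
  by rewrite js' in js.
rewrite (exchange_big_dep xpredT) //= big_seq [RHS]big_seq; apply: eq_bigr => i si.
rewrite big_mkcond (bigD1_seq i) ?mem_undup ?undup_uniq //= eqxx.
by rewrite big1 ?addr0 // => j; rewrite eq_sym => /negbTE ->.
Qed.

Let decompB x y f f' : decomp x f -> decomp y f' -> decomp (x - y) (fun j => f j - f' j).
Proof.
move=> [gf [s [us zs ->]]] [gf' [s' [us' zs' ->]]]; split.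
  by move=> j; apply: grB.
have ext (t t' : seq int) (h : int -> M) : uniq t -> uniq t' -> {subset t <= t'} ->
    (forall j, j \notin t -> h j = 0) -> \sum_(j <- t) h j = \sum_(j <- t') h j.
  move=> ut ut' tt' zt; rewrite [RHS](bigID (mem t)) /= [X in _ + X]big1 ?addr0 //.
  rewrite -[RHS]big_filter; apply: perm_big; apply: uniq_perm => //; first exact: filter_uniq.
  by move=> j; rewrite mem_filter; apply/idP/andP => [jt|[]//]; split => //; apply: tt'.
exists (undup (s ++ s')); split; first exact: undup_uniq.
  by move=> j; rewrite mem_undup mem_cat negb_or => /andP[/zs -> /zs' ->]; rewrite subr0.
rewrite (ext s (undup (s ++ s'))) ?(ext s' (undup (s ++ s'))) ?undup_uniq // -?sumrB //.
  by move=> j js; rewrite mem_undup mem_cat js orbT.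
by move=> j js; rewrite mem_undup mem_cat js.
Qed.

Let decomp0 f j : decomp 0 f -> f j = 0.
Proof.
move=> [gf [s [us zs s0]]]; have [js|/zs //] := boolP (j \in s).
by have [_ _ _ /(_ s f us gf (esym s0) j js)] := gM.
Qed.

Let decomp_uniq x f f' j : decomp x f -> decomp x f' -> f j = f' j.
Proof.
move=> df df'; apply/eqP; rewrite -subr_eq0; apply/eqP.
by apply: (@decomp0 (fun j => f j - f' j)); rewrite -(subrr x); apply: decompB.
Qed.

(** Homogeneous decompositions are unique, hence compatible with differences, once
    they are all indexed by functions of finite support. *)
Lemma component_exists : exists C : int -> M -> M,
  [/\ forall j x y, C j (x - y) = C j x - C j y,
      forall j x, g j (C j x),
      forall i j x, g j x -> C i x = if i == j then x else 0
    & forall x, exists s : seq int, uniq s /\ x = \sum_(j <- s) C j x].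
Proof.
have [f df] := choice decomp_exists; exists (fun j x => f x j); split.
- by move=> j x y; exact: (decomp_uniq j (df (x - y)) (decompB (df x) (df y))).
- by move=> j x; apply: (df x).1.
- move=> i j x gx; apply: (@decomp_uniq x (f x) (fun i => if i == j then x else 0) i (df x)).
  split; first by move=> l; case: eqP => [->|_] //; apply: gr0.
  exists [:: j]; split=> //; first by move=> l; rewrite inE => /negbTE ->.
  by rewrite big_seq1 eqxx.
- by move=> x; have [_ [s [us _ xE]]] := df x; exists s.
Qed.

Definition gcomp (j : int) (x : M) : M := sval (cid component_exists) j x.

Lemma gcompB j : {morph gcomp j : x y / x - y}.
Proof. by move=> x y; rewrite /gcomp; case: cid => C [/= H _ _ _]; apply: H. Qed.
Lemma gcomp_in j x : g j (gcomp j x).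
Proof. by rewrite /gcomp; case: cid => C [/= _ H _ _]; apply: H. Qed.
Lemma gcomp_gr i j x : g j x -> gcomp i x = if i == j then x else 0.
Proof. by rewrite /gcomp; case: cid => C [/= _ _ H _]; apply: H. Qed.
Lemma sum_gcomp x : exists s : seq int, uniq s /\ x = \sum_(j <- s) gcomp j x.
Proof. by rewrite /gcomp; case: cid => C [/= _ _ _ H]; apply: H. Qed.

Lemma gcomp0 j : gcomp j 0 = 0.
Proof. by have := gcompB j 0 0; rewrite !subrr. Qed.
Lemma gcompN j : {morph gcomp j : x / - x}.
Proof. by move=> x; rewrite -[- x]add0r gcompB gcomp0 add0r. Qed.
Lemma gcompD j : {morph gcomp j : x y / x + y}.
Proof. by move=> x y; rewrite -{1}[y]opprK gcompB gcompN opprK. Qed.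
Lemma gcomp_sum J (s : seq J) (R : pred J) (F : J -> M) j :
  gcomp j (\sum_(i <- s | R i) F i) = \sum_(i <- s | R i) gcomp j (F i).
Proof. exact: (big_morph (gcomp j) (gcompD j) (gcomp0 j)). Qed.

Lemma gcomp_id j x : g j x -> gcomp j x = x.
Proof. by move/(gcomp_gr j) ->; rewrite eqxx. Qed.

Lemma sum_gcomp_at j x : exists s : seq int,
  [/\ uniq s, j \in s & x = \sum_(l <- s) gcomp l x].
Proof.
have [s [us xE]] := sum_gcomp x.
have [js|js] := boolP (j \in s); first by exists s.
exists (j :: s); rewrite /= js mem_head; split=> //.
rewrite big_cons -xE [X in gcomp j X]xE gcomp_sum big1_seq ?add0r // => i /andP[_ si].
by rewrite (gcomp_gr _ (gcomp_in i x)); case: eqP => // ji; rewrite ji si in js.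
Qed.

End Components.

Lemma gcomp_morph (M N : lmodType A) (g : int -> M -> Prop) (g' : int -> N -> Prop)
    (gM : graded_module g) (gN : graded_module g') (f : M -> N) (j d : int) x :
  (forall x y, f (x + y) = f x + f y) -> (forall i x, g i x -> g' (d + i) (f x)) ->
  gcomp gN (d + j) (f x) = f (gcomp gM j x).
Proof.
move=> fD fg; have f0 : f 0 = 0 by apply: (addrI (f 0)); rewrite -fD !addr0.
have [s [us js xE]] := sum_gcomp_at gM j x.
rewrite {1}xE (big_morph f fD f0) gcomp_sum.
rewrite (bigD1_seq j) //= (gcomp_id _ (fg _ _ (gcomp_in gM j x))) big1 ?addr0 // => i ne.
rewrite (gcomp_gr _ _ (fg _ _ (gcomp_in gM i x))) (inj_eq (addrI d)).
by rewrite eq_sym (negbTE ne).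
Qed.

Lemma gcomp_mul (M : lmodType A) (g : int -> M -> Prop) (gM : graded_module g) h j a x :
  hdeg h a -> gcomp gM (h%:Z + j) (pi a *: x) = pi a *: gcomp gM j x.
Proof.
move=> ha; apply: (gcomp_morph gM) => [y z|i y]; first exact: scalerDr.
exact: grM.
Qed.

Lemma gcomp_mul_res (M : lmodType A) (g : int -> M -> Prop) (gM : graded_module g)
    (i n : nat) y v : g i%:Z v ->
  gcomp gM n%:Z (pi y *: v) = pi (res (fun h => h + i == n)%N y) *: v.
Proof.
move=> gv; elim/path_ind: y => [|y y' IH IH'|c y IH|p].
- by rewrite linear0 !rmorph0 !scale0r gcomp0.
- by rewrite linearD !rmorphD !scalerDl gcompD IH IH'.
- rewrite linearZZ !pr_scale -!scalerA -IH.
  have -> : kscal c = pi (c *: (1 : T)) :> A by rewrite pr_scale rmorph1 mulr1.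
  have h1 : hdeg 0 (c *: (1 : T)) by apply: degsZ; apply: hdeg1.
  by have := gcomp_mul gM n%:Z (pi y *: v) h1; rewrite add0r.
have hp := @hdeg_path k Q p.
rewrite (gcomp_gr gM _ (grM gM hp gv)) (res_hdeg _ hp) -PoszD eqz_nat eq_sym.
by case: eqP => // _; rewrite rmorph0 scale0r.
Qed.

End GradedModules.

(** * Exactness of the left Koszul complex *)

Section SigmaMap.
Variables (k : fieldType) (Q : quiver) (I : gideal k Q) (A : kalgType k).
Variable (pi : presentation I A).
Local Notation T := (palg k Q).
Local Notation e v := (pbase (ptriv v) : T).
Variable M : lmodType A.
Implicit Types (x y z : T).

Definition equivariant (X : T -> Prop) (s : T -> M) :=
  (forall c x y, X x -> X y -> s (c *: x + y) = (kscal c : A) *: s x + s y) /\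
  (forall v x, X x -> s (e v * x) = pi (e v) *: s x).

Lemma pr_scaleM c x (m : M) : pi (c *: x) *: m = pi x *: ((kscal c : A) *: m).
Proof. by rewrite pr_scale scalerA -kscalC. Qed.

Lemma equivariant_sum (s : T -> M) J (r : seq J) (P : pred J) (c : J -> k) (F : J -> T) :
  equivariant (fun _ => True) s ->
  s (\sum_(j <- r | P j) c j *: F j) = \sum_(j <- r | P j) (kscal (c j) : A) *: s (F j).
Proof.
move=> [sL _]; have s0 : s 0 = 0.
  have := sL 1 0 0 Logic.I Logic.I; rewrite scaler0 addr0 rmorph1 scale1r.
  by move=> /eqP; rewrite -subr_eq0 opprD addNKr oppr_eq0 => /eqP.
elim: r => [|j r IH]; first by rewrite !big_nil.
by rewrite !big_cons; case: ifP => // _; rewrite sL // IH.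
Qed.

Variables (i : nat) (s : T -> M).

(** The map T T_i -> M with y m |-> y s(m), for m in T_i; it vanishes on I T_i, so it
    is the A-linear extension of [s] to A T_i. *)
Definition Sig x : M := \sum_(m : walk Q i) pi (dR m x) *: s (pbase m).

Lemma Sig_linear c x y : Sig (c *: x + y) = (kscal c : A) *: Sig x + Sig y.
Proof.
rewrite /Sig scaler_sumr -big_split; apply: eq_bigr => m _ /=.
by rewrite linearP rmorphD pr_scale scalerDl scalerA.
Qed.

Lemma SigD x y : Sig (x + y) = Sig x + Sig y.
Proof. by rewrite -{1}[x]scale1r Sig_linear rmorph1 scale1r. Qed.

Lemma Sig0 : Sig 0 = 0.
Proof. by rewrite /Sig big1 // => m _; rewrite linear0 rmorph0 scale0r. Qed.

Lemma SigN x : Sig (- x) = - Sig x.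
Proof. by apply/eqP; rewrite -addr_eq0 -SigD addNr Sig0. Qed.

Lemma SigB x y : Sig (x - y) = Sig x - Sig y.
Proof. by rewrite SigD SigN. Qed.

Lemma Sig_mull a x : dgeq i x -> Sig (a * x) = pi a *: Sig x.
Proof.
move=> gx; rewrite /Sig scaler_sumr; apply: eq_bigr => m _.
by rewrite dR_mul ?plen_wpath // rmorphM scalerA.
Qed.

Hypothesis sE : equivariant (fun _ => True) s.

Lemma Sig_mul y z : hdeg i z -> Sig (y * z) = pi y *: s z.
Proof.
move=> hz; rewrite [X in s X](hdeg_sum hz) (equivariant_sum _ _ _ _ sE) scaler_sumr.
apply: eq_bigr => m _; rewrite dR_hdeg_mul // pr_scaleM rmorphM -scalerA.
congr (_ *: _); rewrite scalerA -kscalC -scalerA; congr (_ *: _).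
by rewrite -sE.2 // idem_start.
Qed.

Lemma Sig_hdeg z : hdeg i z -> Sig z = s z.
Proof. by move=> hz; rewrite -[z in LHS]mul1r Sig_mul // rmorph1 scale1r. Qed.

Lemma Sig_IT x : IT I i x -> Sig x = 0.
Proof.
elim=> [|y z _ IH _ IH'|y z /pr_ker py hz]; first exact: Sig0.
  by rewrite SigD IH IH' addr0.
by rewrite Sig_mul // (py _ pi) scale0r.
Qed.

End SigmaMap.

Section LinearResolution.
Variables (k : fieldType) (Q : quiver) (I : gideal k Q) (A : kalgType k).
Variable (pi : presentation I A).
Local Notation T := (palg k Q).
Local Notation K := (Kk I).
Local Notation TK := (TK I).
Local Notation IT := (IT I).
Local Notation ITp := (ITp I).
Variables (S : lmodType A) (cls : {linear A^o -> S}).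
Hypothesis cls_surj : forall y, exists a, cls a = y.
Hypothesis cls_ker : forall x, cls (pi x) = 0 <-> dgeq 1 x.
Variables (P : proj_resolution S) (g : forall i, int -> P i -> Prop).
Arguments g : clear implicits.
Hypothesis gP : forall i, graded_module pi (g i).
Hypothesis gd : forall i j x, g i.+1 j x -> g i j (pdiff P i x).
Hypothesis ga : forall j x, g 0%N j x -> j = 0 \/ paug P x = 0.
Hypothesis gen : forall i x, lspan (g i i%:Z) x.
Implicit Types (x y z : T).
Local Notation C i := (gcomp (gP i)).

Lemma lspan_ind i (F : P i -> Prop) : F 0 -> (forall u v, F u -> F v -> F (u + v)) ->
  (forall y v, g i i%:Z v -> F (pi y *: v)) -> forall u, F u.
Proof.
move=> F0 FD FM u; have [s [sg ->]] := gen u; rewrite big_seq.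
elim/big_ind: _ => // -[a v] /sg /=; have [y <-] := pr_surj pi a; exact: FM.
Qed.

(** Multiplication by elements of A does not lower degrees. *)
Lemma comp_low i j u : (j < i)%N -> C i j%:Z u = 0.
Proof.
move=> ji; elim/lspan_ind: u => [|u v IH IH'|y v gv]; first exact: gcomp0.
  by rewrite gcompD IH IH' addr0.
rewrite (gcomp_mul_res _ _ _ gv) res_none ?rmorph0 ?scale0r // => p _.
by apply/eqP => E; rewrite -E ltnNge leq_addl in ji.
Qed.

Lemma pdiff_comp i j u : pdiff P i (C i.+1 j u) = C i j (pdiff P i u).
Proof.
have := gcomp_morph (gP i.+1) (gP i) (f := pdiff P i) (d := 0) j u.
rewrite add0r => <- //; first by move=> x y; exact: linearD.
by move=> l x gx; rewrite add0r; apply: gd.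
Qed.

(** Cycles of the augmented resolution, so that index 0 is treated like the others. *)
Definition Zc i : P i -> Prop :=
  match i with 0 => fun u => paug P u = 0 | j.+1 => fun u => pdiff P j u = 0 end.

Lemma Zc_exact i u : Zc u <-> exists w, pdiff P i w = u.
Proof. by case: i u => [|i] u; [apply: paug_exact | apply: pdiff_exact]. Qed.

(** A cycle is a boundary, and boundaries come from a module generated in degree
    [i + 1]. *)
Lemma kernel_low i u : g i i%:Z u -> Zc u -> u = 0.
Proof.
move=> gu /Zc_exact[w wu]; rewrite -(gcomp_id (gP i) gu) -wu -pdiff_comp.
by rewrite comp_low ?linear0.
Qed.

(** The lift of an element of K_j to the lowest component is unique, hence linear and
    compatible with the idempotents; a projection onto K_j extends it to all of T. *)
Lemma sigma_exists j (N : lmodType A) (d : {linear P j -> N}) (F : T -> N) :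
  (forall u, g j j%:Z u -> d u = 0 -> u = 0) ->
  equivariant pi (K j) F ->
  (forall x, K j x -> exists2 u, g j j%:Z u & d u = F x) ->
  exists s : T -> P j, equivariant pi (fun _ => True) s /\
    forall x, K j x -> g j j%:Z (s x) /\ d (s x) = F x.
Proof.
move=> dinj [FL Fe] Fex; have [p [pK pid pe _]] := K_projection I j.
have /choice[s sE] : forall x, exists u, g j j%:Z u /\ d u = F (p x).
  by move=> x; have [u gu du] := Fex _ (pK x); exists u.
have uniq_s x u : g j j%:Z u -> d u = F (p x) -> s x = u.
  move=> gu du; apply/eqP; rewrite -subr_eq0; apply/eqP/dinj.
    by apply: (grB (gP j)) => //; apply: (sE x).1.
  by rewrite linearB /= (sE x).2 du subrr.
have gZ (a : T) u : hdeg 0 a -> g j j%:Z u -> g j j%:Z (pi a *: u).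
  by move=> ha gu; have := grM (gP j) ha gu; rewrite add0r.
exists s; split; first split.
- move=> c x y _ _; apply: uniq_s; last first.
    by rewrite linearP linearD linearZZ /= FL // (sE x).2 (sE y).2.
  apply: (grD (gP j)); last exact: (sE y).1.
  have -> : kscal c = pi (c *: (1 : T)) :> A by rewrite pr_scale rmorph1 mulr1.
  by apply: gZ; [apply: degsZ; apply: hdeg1 | apply: (sE x).1].
- move=> v x _; apply: uniq_s; first by apply: gZ; [apply: hdeg_idem | apply: (sE x).1].
  by rewrite linearZZ pe Fe // (sE x).2.
by move=> x Kx; have := sE x; rewrite pid.
Qed.

(** [s] identifies K_i with the component of degree [i] of P_i, in which P_i is
    generated. *)
Definition lowest i (s : T -> P i) :=
  [/\ equivariant pi (fun _ => True) s, forall x, K i x -> g i i%:Z (s x),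
      forall x, K i x -> s x = 0 -> x = 0
    & forall u, g i i%:Z u -> exists2 x, K i x & u = s x].

(** The part of exactness carried along the induction: the cycles of P_i pulled back
    to T K_i are those of the left Koszul complex. *)
Definition kernel_ok i (s : T -> P i) :=
  forall x, TK i x -> Zc (Sig pi i s x) <-> ITp i x.

Section Level.
Variables (i : nat) (s : T -> P i).
Hypothesis ls : lowest s.
Local Notation Sg := (Sig pi i s).

Lemma Sig_surj u : exists2 x, TK i x & Sg x = u.
Proof.
have [sE sg _ sK] := ls.
elim/lspan_ind: u => [|u v [x Tx <-] [y Ty <-]|y v /sK[x Kx ->]].
- by exists 0; [apply: smem0 | rewrite Sig0].
- by exists (x + y); [apply: smemD | rewrite SigD].
exists (y * x); first by apply: sprodM.
by rewrite Sig_mul //; apply: Kk_hdeg Kx.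
Qed.

Lemma Sig_gcomp n x : TK i x -> Sg (res (pred1 n) x) = C i n%:Z (Sg x).
Proof.
have [sE sg _ _] := ls.
elim=> [|y z _ IH _ IH'|y z _ Kz]; first by rewrite linear0 Sig0 gcomp0.
  by rewrite linearD /= !SigD IH IH' gcompD.
have hz := Kk_hdeg Kz.
by rewrite (res_mulr _ _ hz) !Sig_mul // (gcomp_mul_res _ _ _ (sg _ Kz)).
Qed.

(** The kernel of [Sg] on T K_i is I T_i because P_i is projective: A T_i -> P_i splits,
    and the splitting writes a homogeneous element of the kernel as a combination
    of elements of K_i killed by [s]. *)
Lemma Sig_kernel x : TK i x -> Sg x = 0 -> IT i x.
Proof.
have [sE sg sinj sK] := ls.
have [p [pK pid pe _]] := K_projection I i.
pose X := free_mod A (walk Q i).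
pose F : {linear X -> P i} := free_fun (fun m : walk Q i => s (p (pbase m))).
have Fsurj u : exists f, F f = u.
  elim/lspan_ind: u => [|u v [f <-] [f' <-]|y v /sK[z Kz ->]].
  - by exists 0; rewrite linear0.
  - by exists (f + f'); rewrite linearD.
  exists (\sum_(m : walk Q i) (pi (pcoef z m *: y) : A) *: delta A m).
  rewrite linear_sum /= -[in RHS](pid _ Kz) [in RHS](hdeg_sum (Kk_hdeg Kz)).
  rewrite linear_sum (eq_bigr _ (fun m _ => linearZZ p _ _)) (equivariant_sum _ _ _ _ sE).
  rewrite scaler_sumr; apply: eq_bigr => m _.
  by rewrite linearZZ /F /= free_fun_delta pr_scaleM.
have [r rE] : exists r : {linear P i -> X}, forall u, F (r u) = u.
  have [h hE] := pterm_projective (idfun : {linear P i -> P i}) Fsurj.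
  by exists h.
have [q qE] := choice (pr_surj pi).
pose z (f : X) : T := \sum_(m : walk Q i) q (f m) * p (pbase m).
have zT f : TK i (z f).
  by apply: smem_sum => m _; apply: sprodM.
have Sz f : Sg (z f) = F f.
  rewrite /z (big_morph Sg (SigD _ _ _) (Sig0 _ _ _)); apply: eq_bigr => m _.
  by rewrite Sig_mul ?qE //; apply: Kk_hdeg (pK _).
have zlin a f f' : IT i (a * z f + z f' - z (pi a *: f + f')).
  rewrite /z mulr_sumr -big_split -sumrB; apply: smem_sum => m _ /=.
  rewrite mulrA -mulrDl -mulrBl; apply: sprodM; last exact: Kk_hdeg (pK _).
  by apply/(pr_ker pi); rewrite rmorphB rmorphD rmorphM !qE !ffunE subrr.
have z0 : IT i (z 0).
  apply: smem_sum => m _; apply: sprodM; last exact: Kk_hdeg (pK _).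
  by apply/(pr_ker pi); rewrite qE ffunE.
pose N y := TK i y /\ Sg y = 0.
(* [z (r (Sg y))] is a lift of [y] that depends on [Sg y] only; the error it makes
   on [y] of degree [h + i] is a combination of elements of the kernel. *)
have approx h y : sprod (fun a => True /\ hdeg h a) (K i) y ->
    exists2 w, sprod (hdeg h) N w & IT i (y - z (r (Sg y)) - w).
  elim=> [|y1 y2 _ [w1 Nw1 Iw1] _ [w2 Nw2 Iw2]|a c [_ ha] Kc].
  - exists 0; first exact: sprod0.
    by rewrite Sig0 linear0 sub0r subr0; apply: smemN.
  - exists (w1 + w2); first exact: sprodD.
    rewrite SigD linearD /=; set z1 := r (Sg y1); set z2 := r (Sg y2).
    have -> : y1 + y2 - z (z1 + z2) - (w1 + w2) =
      (y1 - z z1 - w1) + (y2 - z z2 - w2) + (1 * z z1 + z z2 - z (pi 1 *: z1 + z2)).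
      have -> : (y1 - z z1 - w1) + (y2 - z z2 - w2) = y1 + y2 - (z z1 + z z2) - (w1 + w2).
        by rewrite addrACA (addrACA y1) -!opprD.
      by rewrite rmorph1 scale1r mul1r [RHS]addrAC addrA subrK.
    exact: smemD (smemD Iw1 Iw2) (zlin 1 z1 z2).
  exists (a * (c - z (r (s c)))).
    apply: sprodM => //; split.
      by apply: smemB => //; apply: Kk_TK.
    by rewrite SigB Sig_hdeg ?Sz ?rE ?subrr //; apply: Kk_hdeg Kc.
  rewrite Sig_mul ?linearZZ //; last exact: Kk_hdeg Kc.
  rewrite mulrBr opprB addrC addrA subrK.
  by have := smemB (zlin a (r (s c)) 0) z0; rewrite addr0 addrAC addrK.
have hom h y : hdeg h y -> TK i y -> Sg y = 0 -> IT i y.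
  move=> hy Ty Sy; have [hi|ih] := ltnP h i.
    suff -> : y = 0 by apply: smem0.
    apply: pcoef_inj => t; rewrite pcoef0; apply/eqP/contraT => nt.
    by have := TK_geq Ty nt; rewrite (hy _ nt) leqNgt hi.
  rewrite -(subnK ih) in hy.
  have [w Nw] := approx _ _ (sprod_comp (@graded_full k Q) (@Kk_hdeg _ _ I i) Ty hy).
  rewrite Sy linear0 => Iw.
  have {Iw} Iw : IT i (y - w) by have := smemD Iw z0; rewrite addrAC subrK.
  (* The left factors of [w] have degree [h - i], so its component of degree [h] uses
     the components in K_i of elements of the kernel, and [s] is injective on K_i. *)
  have w0 : res (pred1 (h - i + i)%N) w = 0.
    elim: Nw => [|w1 w2 _ E1 _ E2|a c ha [Tc Sc]]; first exact: linear0.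
      by rewrite linearD /= E1 E2 addr0.
    rewrite (res_mull _ _ ha).
    have -> : res (fun n => pred1 (h - i + i)%N (h - i + n)%N) c = res (pred1 i) c.
      by apply: pcoef_inj => t; rewrite !coef_res /= eqn_add2l.
    suff -> : res (pred1 i) c = 0 by rewrite mulr0.
    have Kc : K i (res (pred1 i) c).
      by apply: TK_Kk; [apply: TK_graded | apply: hdeg_res].
    by apply: sinj => //; rewrite -(Sig_hdeg sE (Kk_hdeg Kc)) Sig_gcomp // Sc gcomp0.
  have := IT_graded (pred1 (h - i + i)%N) Iw.
  by rewrite linearB /= w0 subr0 (res_hdeg _ hy) /= eqxx.
move=> Tx Sx; have [B dB] := degs_bound x.
rewrite (@sum_res _ _ x B.+1) //; apply: smem_sum => h _; apply: (hom h).
- exact: hdeg_res.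
- exact: TK_graded.
- by rewrite Sig_gcomp // Sx gcomp0.
Qed.

End Level.

(** K_(i+1) is the lowest part of the cycles of A K_i, and the lowest component of
    P_(i+1) is mapped onto the corresponding part of the cycles of P_i; no boundary
    from P_(i+2) has degree [i + 1], so that the map is also injective there. *)
Lemma lowest_step i (s : T -> P i) : lowest s -> kernel_ok s ->
  exists s' : T -> P i.+1, [/\ lowest s', kernel_ok s' &
    forall x, TK i.+1 x -> pdiff P i (Sig pi i.+1 s' x) = Sig pi i s x].
Proof.
move=> ls ks; have [sE sg sinj sK] := ls.
have [|||s' [s'E s'K]] := @sigma_exists i.+1 _ (pdiff P i) (Sig pi i s).
- by move=> u gu du; apply: (@kernel_low i.+1).
- split=> [c x y _ _|v x Kx]; first exact: Sig_linear.
  by apply: Sig_mull; apply: (TK_geq (TK_decr (Kk_TK Kx))).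
- move=> x Kx; have Tx := TK_decr (Kk_TK Kx).
  have /Zc_exact[w wE] : Zc (Sig pi i s x) by apply/(ks _ Tx); apply: TK_ITp (Kk_TK Kx).
  exists (gcomp (gP i.+1) i.+1%:Z w); first exact: gcomp_in.
  rewrite pdiff_comp wE -Sig_gcomp // (res_hdeg _ (Kk_hdeg Kx)) /= eqxx //.
have s'd x : TK i.+1 x -> pdiff P i (Sig pi i.+1 s' x) = Sig pi i s x.
  elim=> [|y z _ IH _ IH'|y z _ Kz]; first by rewrite !Sig0 linear0.
    by rewrite !SigD linearD /= IH IH'.
  rewrite Sig_mul //; last exact: Kk_hdeg Kz.
  rewrite linearZZ (s'K _ Kz).2 Sig_mull //.
  exact: (TK_geq (TK_decr (Kk_TK Kz))).
have kerE x : TK i.+1 x -> pdiff P i (Sig pi i.+1 s' x) = 0 <-> IT i x.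
  move=> Tx; rewrite s'd //; split; last exact: Sig_IT.
  by apply: Sig_kernel => //; apply: TK_decr.
exists s'; split=> //; split=> //.
- by move=> x /s'K[].
- move=> x Kx sx; have Ix : IT i x.
    by apply/kerE; rewrite ?Sig_hdeg ?sx ?linear0 //; [apply: Kk_TK | apply: Kk_hdeg Kx].
  apply: pcoef_inj => t; rewrite pcoef0; apply/eqP/contraT => nt.
  have := sprod_in_geq (@gid_geq2 _ _ I) Ix nt.
  by rewrite (Kk_hdeg Kx nt) addSn add1n ltnn.
- move=> u gu; have [x Tx Sx] := Sig_surj ls (pdiff P i u).
  pose y := res (pred1 i.+1) x.
  have Ty : TK i y by apply: TK_graded.
  have Sy : Sig pi i s y = pdiff P i u.
    by rewrite Sig_gcomp // Sx; apply: gcomp_id; apply: gd.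
  have Ky : K i.+1 y.
    apply: TK_ITp_Kk => //; last exact: hdeg_res.
    by apply/(ks _ Ty); rewrite Sy; apply/Zc_exact; exists u.
  exists y => //; apply/eqP; rewrite -subr_eq0; apply/eqP.
  apply: (@kernel_low i.+1); first by apply: (grB (gP i.+1)) => //; exact: (s'K _ Ky).1.
  by rewrite /= linearB /= (s'K _ Ky).2 Sy subrr.
Qed.

Lemma lowest_base : exists s : T -> P 0%N, lowest s /\ kernel_ok s.
Proof.
pose F x : S := cls (pi x : A^o).
have FM (a x : T) : F (a * x) = pi a *: F x.
  by rewrite /F rmorphM -linearZZ.
have FD x y : F (x + y) = F x + F y by rewrite /F rmorphD linearD.
have augB : forall x y, F x = F y -> dgeq 1 (x - y).
  move=> x y /eqP; rewrite -subr_eq0 => /eqP Fxy; apply/cls_ker.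
  by rewrite rmorphB linearB.
have [|||s [sE sK]] := @sigma_exists 0 _ (paug P) F.
- by move=> u gu du; apply: (@kernel_low 0).
- split=> [c x y _ _|v x _]; last exact: FM.
  by rewrite FD /F pr_scale -linearZZ.
- move=> x Kx; have [u uE] := paug_surj P (F x).
  exists (gcomp (gP 0%N) 0 u); first exact: gcomp_in.
  have [t [ut t0 xE]] := sum_gcomp_at (gP 0%N) 0 u.
  rewrite -uE [in RHS]xE linear_sum (bigD1_seq 0) //= big1 ?addr0 // => j nj.
  by have [j0|//] := ga (gcomp_in (gP 0%N) j u); rewrite j0 eqxx in nj.
have augE x : TK 0 x -> paug P (Sig pi 0 s x) = F x.
  elim=> [|y z _ IH _ IH'|y z _ Kz].
  - by rewrite Sig0 /F rmorph0 !linear0.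
  - by rewrite SigD linearD /= IH IH' FD.
  by rewrite Sig_mul ?linearZZ ?(sK _ Kz).2 ?FM //; apply: Kk_hdeg Kz.
exists s; split; last by move=> x Tx; rewrite /= augE //; apply: cls_ker.
split=> //.
- by move=> x /sK[].
- move=> x Kx sx; have gx : dgeq 1 x.
    by apply/cls_ker; rewrite -[LHS]/(F x) -(sK _ Kx).2 sx linear0.
  apply: pcoef_inj => t; rewrite pcoef0; apply/eqP/contraT => nt.
  by have := gx _ nt; rewrite (Kk_hdeg Kx nt).
move=> u gu; have [a ua] := cls_surj (paug P u); have [x xa] := pr_surj pi a.
pose y := res (pred1 0%N) x.
have Ky : K 0 y by apply: hdeg_Kk0; apply: hdeg_res.
have Fy : F y = F x.
  apply/eqP; rewrite eq_sym -subr_eq0 /F -linearB -rmorphB; apply/eqP/cls_ker => p.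
  rewrite -[- y]scaleN1r pcoefD pcoefZ mulN1r coef_res /=.
  by case: (plen p) => [|//]; rewrite eqxx subrr eqxx.
exists y => //; apply/eqP; rewrite -subr_eq0; apply/eqP.
apply: (@kernel_low 0); first by apply: (grB (gP 0%N)) => //; exact: (sK _ Ky).1.
by rewrite /= linearB /= (sK _ Ky).2 Fy /F xa ua subrr.
Qed.

Lemma lowest_exists i : exists s : T -> P i, lowest s /\ kernel_ok s.
Proof.
elim: i => [|i [s [ls ks]]]; first exact: lowest_base.
by have [s' [ls' ks' _]] := lowest_step ls ks; exists s'.
Qed.

(** The left Koszul complex is exact because it is isomorphic to the linear
    resolution. *)
Theorem left_exact i x : TK i x -> ITp i x -> exists2 u, TK i.+1 u & IT i (x - u).
Proof.
move=> Tx Ix; have [s [ls ks]] := lowest_exists i.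
have [s' [ls' ks' s'd]] := lowest_step ls ks.
have /Zc_exact[w wE] : Zc (Sig pi i s x) by apply/(ks _ Tx).
have [u Tu uE] := Sig_surj ls' w; exists u => //.
apply: (Sig_kernel ls); first by apply: smemB => //; apply: TK_decr.
by rewrite SigB -(s'd u) // uE wE subrr.
Qed.

(** Up to homotopy the identity of P factors through the resolution of length [n] and
    is 0 at index [n + 1]. An element v of K_(n+1), of degree [n + 1] in P_(n+1), is
    then d(hv) + h(dv) for a homotopy h. In degree [n + 1] the first term is 0 since
    P_(n+2) starts in degree [n + 2]; dv is a combination of generators u of P_n
    with coefficients of degree 1, and the part of hu of degree [n] is 0 since P_(n+1)
    starts in degree [n + 1]. *)
Lemma K_vanish n (P' : proj_resolution S) :
  (forall i, (n < i)%N -> forall x : P' i, x = 0) -> forall x, K n.+1 x -> x = 0.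
Proof.
move=> P'0 x Kx; have [s [[sE sg sinj sK] ks]] := lowest_exists n.+1.
apply: sinj => //; set v := s x; have gv : g n.+1 n.+1%:Z v by apply: sg.
have [f [fa fd]] := comparison P P'; have [f' [fa' fd']] := comparison P' P.
have [||h hE] := @homotopy_id _ _ P (fun i => f' i \o f i : {linear P i -> P i}).
- by move=> u; rewrite /= fa' fa.
- by move=> i u; rewrite /= fd' fd.
rewrite -(gcomp_id (gP n.+1) gv) (hE n v) /= [f n.+1 v]P'0 // linear0 add0r gcompD.
rewrite -pdiff_comp comp_low // linear0 add0r.
have : g n n.+1%:Z (pdiff P n v) by apply: gd.
move/(gcomp_id (gP n)) <-; move: (pdiff P n v) => w.
have h0 : h n 0 = 0 by rewrite linear0.
elim/lspan_ind: w => [|u u' IH IH'|y u gu].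
- by rewrite gcomp0 h0 gcomp0.
- by rewrite gcompD linearD gcompD IH IH' addr0.
rewrite (gcomp_mul_res (gP n) _ _ gu) linearZZ.
have hy : hdeg 1 (res (fun h => h + n == n.+1)%N y).
  by move=> p /degs_res; rewrite -add1n eqn_add2r => /eqP.
have := gcomp_mul (gP n.+1) n%:Z (h n u) hy.
by rewrite -PoszD add1n => ->; rewrite comp_low ?scaler0.
Qed.

End LinearResolution.

(** * The bimodule Koszul complex *)

(** [E] is the tensor product of [A] and its opposite: [tn a b] is the class of the pair
    and [tn_lift] the existence part of the universal property. *)
Record enveloping (k : fieldType) (A E : kalgType k) := Enveloping {
  tn :> A -> A -> E;
  tnDl : forall a a' b, tn (a + a') b = tn a b + tn a' b;
  tnDr : forall a b b', tn a (b + b') = tn a b + tn a b';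
  tnZl : forall c a b, tn (kscal c * a) b = kscal c * tn a b;
  tnZr : forall c a b, tn a (kscal c * b) = kscal c * tn a b;
  tnM : forall a b c d, tn a b * tn c d = tn (a * c) (d * b);
  tn1 : tn 1 1 = 1;
  tn_ind : forall F : E -> Prop, F 0 -> (forall u v, F u -> F v -> F (u + v)) ->
    (forall a b, F (tn a b)) -> forall u, F u;
  tn_lift : forall (V : lmodType k) (f : A -> A -> V),
    (forall a a' b, f (a + a') b = f a b + f a' b) ->
    (forall a b b', f a (b + b') = f a b + f a b') ->
    (forall c a b, f (kscal c * a) b = c *: f a b) ->
    (forall c a b, f a (kscal c * b) = c *: f a b) ->
    exists h : E -> V, (forall u v, h (u + v) = h u + h v) /\
      forall a b, h (tn a b) = f a b
}.

(** [B] is [A] as a bimodule over itself. *)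
Record regular_bimodule (k : fieldType) (A E : kalgType k) (t : enveloping A E)
    (B : lmodType E) := RegularBimodule {
  bim :> A -> B;
  bimD : forall a b, bim (a + b) = bim a + bim b;
  bim_inj : injective bim;
  bim_surj : forall y, exists a, bim a = y;
  bim_act : forall a b x, t a b *: bim x = bim (a * x * b)
}.

Section BimoduleComplex.
Variables (k : fieldType) (Q : quiver) (I : gideal k Q) (A : kalgType k).
Variable (pi : presentation I A).
Variables (E : kalgType k) (t : enveloping A E).
Local Notation T := (palg k Q).
Local Notation e v := (pbase (ptriv v) : T).
Local Notation IT := (IT I).
Implicit Types (x y z : T).

Lemma tn0l b : t 0 b = 0.
Proof. by apply: (addrI (t 0 b)); rewrite -tnDl !addr0. Qed.

Lemma tn0r a : t a 0 = 0.
Proof. by apply: (addrI (t a 0)); rewrite -tnDr !addr0. Qed.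

Lemma tn_sumr J (r : seq J) (P : pred J) (F : J -> A) a :
  t a (\sum_(j <- r | P j) F j) = \sum_(j <- r | P j) t a (F j).
Proof. exact: (big_morph (t a) (tnDr t a) (tn0r a)). Qed.

Definition tnT x y : E := t (pi x) (pi y).

Lemma tnT_Zl c x y : tnT (c *: x) y = kscal c * tnT x y.
Proof. by rewrite /tnT pr_scale tnZl. Qed.

Lemma tnT_Zr c x y : tnT x (c *: y) = kscal c * tnT x y.
Proof. by rewrite /tnT pr_scale tnZr. Qed.

Lemma tnTM x y x' y' : tnT x y * tnT x' y' = tnT (x * x') (y' * y).
Proof. by rewrite /tnT tnM !rmorphM. Qed.

Lemma tnT_Dl x x' y : tnT (x + x') y = tnT x y + tnT x' y.
Proof. by rewrite /tnT rmorphD tnDl. Qed.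

Lemma tnT_Il x y : I x -> tnT x y = 0.
Proof. by move=> /(pr_ker pi) xI; rewrite /tnT xI tn0l. Qed.

Lemma tnT_Ir x y : I y -> tnT x y = 0.
Proof. by move=> /(pr_ker pi) yI; rewrite /tnT yI tn0r. Qed.

Lemma tnT_0l y : tnT 0 y = 0.
Proof. by apply: tnT_Il; apply: smem0. Qed.

Lemma tnT_0r x : tnT x 0 = 0.
Proof. by apply: tnT_Ir; apply: smem0. Qed.

(** ** The free bimodules A T_i A *)

Local Notation Y i := (free_mod E (walk Q i)).

(** The map T T_i T_s -> A T_i A that sends a path p m q, with m of length [i] and q of
    length [s], to p tensor q times the basis vector m. Elements of A T_i A are thus
    represented by elements of T, with the right degree [s] as a label. *)
Definition vec i s x : Y i :=
  [ffun m : walk Q i => \sum_(q : walk Q s) tnT (dR m (dR q x)) (pbase q)].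

Lemma vec_linear i s c x y :
  vec i s (c *: x + y) = (kscal c : E) *: vec i s x + vec i s y.
Proof.
apply/ffunP => m; rewrite !ffunE scaler_sumr -big_split; apply: eq_bigr => q _ /=.
by rewrite !linearP tnT_Dl tnT_Zl.
Qed.

Lemma vecD i s x y : vec i s (x + y) = vec i s x + vec i s y.
Proof. by rewrite -{1}[x]scale1r vec_linear rmorph1 scale1r. Qed.

Lemma vec0 i s : vec i s 0 = 0.
Proof. by apply: (addrI (vec i s 0)); rewrite -vecD !addr0. Qed.

Lemma vecZ i s c x : vec i s (c *: x) = (kscal c : E) *: vec i s x.
Proof. by rewrite -[c *: x]addr0 vec_linear vec0 addr0. Qed.

Lemma vecN i s x : vec i s (- x) = - vec i s x.
Proof. by apply/eqP; rewrite -addr_eq0 -vecD addNr vec0. Qed.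

Lemma vecB i s x y : vec i s (x - y) = vec i s x - vec i s y.
Proof. by rewrite vecD vecN. Qed.

Lemma vec_sum i s J (r : seq J) (P : pred J) (F : J -> T) :
  vec i s (\sum_(j <- r | P j) F j) = \sum_(j <- r | P j) vec i s (F j).
Proof. exact: (big_morph (vec i s) (vecD i s) (vec0 i s)). Qed.

Lemma vec_mul i s x m0 z : hdeg i m0 -> hdeg s z ->
  vec i s (x * m0 * z) =
  [ffun m : walk Q i => kscal (pcoef m0 m) * tnT (x * e (pstart m)) (e (pend m) * z)].
Proof.
move=> hm hz; apply/ffunP => m; rewrite !ffunE.
have hme v : hdeg i (m0 * e v) by rewrite -[i]addn0; apply: hdeg_mul => //; apply: hdeg_idem.
have E1 (q : walk Q s) : tnT (dR (wpath m) (dR q (x * m0 * z))) (pbase q) =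
    kscal (pcoef m0 (wpath m)) *
      tnT (x * e (pstart (wpath m))) (pcoef z q *: (e (pend (wpath m)) * pbase q)).
  rewrite (dR_hdeg_mul _ _ hz) linearZZ -mulrA (dR_hdeg_mul _ _ (hme _)).
  rewrite pcoef_mul_idem idem_path [pend _ == _]eq_sym; case: eqP => _.
    by rewrite !tnT_Zl tnT_Zr !mulrA kscalC.
  by rewrite scale0r !(tnT_Zl, tnT_Zr) tnT_0l tnT_0r !mulr0.
rewrite (eq_bigr _ (fun q _ => E1 q)) -mulr_sumr; congr (_ * _).
rewrite [in RHS](hdeg_sum hz) mulr_sumr /tnT rmorph_sum tn_sumr.
by apply: eq_bigr => q _; rewrite scaleT_mulr.
Qed.

Lemma dgeq_sprod i s x : dgeq (i + s) x -> sprod (dgeq i) (hdeg s) x.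
Proof.
move=> gx; have gs : dgeq s x by apply: geqW gx; apply: leq_addl.
apply: (@sprod_geq _ _ (degs_sub (fun n => i <= n)%N)) => // q.
apply: degs_dR => // p /gx h; rewrite leq_subRL 1?addnC //.
exact: leq_trans (leq_addl _ _) h.
Qed.

Lemma dgeq_ind i s (F : T -> Prop) : F 0 -> (forall x y, F x -> F y -> F (x + y)) ->
  (forall x m z, hdeg i m -> hdeg s z -> F (x * m * z)) ->
  forall x, dgeq (i + s) x -> F x.
Proof.
move=> F0 FD FM x /dgeq_sprod; elim=> [//|u v _ Fu _ Fv|u z /geq_sprod Gu hz].
  exact: FD.
elim: Gu => [|y1 y2 _ IH1 _ IH2|y1 y2 _ h2]; first by rewrite mul0r.
  by rewrite mulrDl; apply: FD.
exact: FM.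
Qed.

Lemma vec_act i s h x w y : dgeq (i + s) w -> hdeg h y ->
  vec i (s + h) (x * w * y) = tnT x y *: vec i s w.
Proof.
move=> gw hy; move: w gw; apply: dgeq_ind => [|w w' IH IH'|u m z hm hz].
- by rewrite mulr0 mul0r !vec0 scaler0.
- by rewrite mulrDr mulrDl !vecD IH IH' scalerDr.
have -> : x * (u * m * z) * y = (x * u) * m * (z * y) by rewrite !mulrA.
rewrite !vec_mul //; last exact: hdeg_mul.
apply/ffunP => m'; rewrite free_scaleE !ffunE [RHS]mulrA -kscalC -[RHS]mulrA tnTM.
by rewrite !mulrA.
Qed.

(** ** The differential *)

Definition sgn i : E := (-1) ^+ i.

(** The Koszul differential: m = a m' = m'' b, with arrows a and b, goes to a m' plus or
    minus m'' b, where a and b are moved to the coefficients. *)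
Definition dif i : {linear Y i.+1 -> Y i} :=
  free_fun (fun m : walk Q i.+1 =>
    vec i 0 (pbase m) + sgn i.+1 *: vec i 1 (pbase m)).

Lemma sgnC i (u : E) : sgn i * u = u * sgn i.
Proof. by apply/commr_sym/commr_sign. Qed.

Lemma sgn_scale (M : lmodType E) i (u : E) (x : M) : u *: (sgn i *: x) = sgn i *: (u *: x).
Proof. by rewrite !scalerA sgnC. Qed.

Lemma free_fun_vec (M : lmodType E) i s (F : walk Q i -> M) x m z :
  hdeg i m -> hdeg s z -> free_fun F (vec i s (x * m * z)) =
  \sum_(p : walk Q i) (kscal (pcoef m p) : E) *:
     (tnT (x * e (pstart p)) (e (pend p) * z) *: F p).
Proof.
move=> hm hz; rewrite /free_fun (vec_mul _ hm hz).
by apply: eq_bigr => p _; rewrite ffunE scalerA.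
Qed.

(** On representatives in T the differential is the identity up to sign: only the
    place where the factor T_i is cut out changes. *)
Lemma dif_vec i s w : dgeq (i.+1 + s) w ->
  dif i (vec i.+1 s w) = vec i s w + sgn i.+1 *: vec i s.+1 w.
Proof.
move: w; apply: dgeq_ind => [|w w' IH IH'|x m z hm hz].
- by rewrite !vec0 linear0 scaler0 addr0.
- by rewrite !vecD linearD /= IH IH' scalerDr addrACA.
rewrite [LHS]free_fun_vec // [in RHS](hdeg_sum hm) mulr_sumr mulr_suml !vec_sum.
rewrite scaler_sumr -big_split; apply: eq_bigr => p _ /=.
rewrite -scaleT_mulr -scaleT_mull !vecZ.
have hp : hdeg i.+1 (pbase (wpath p) : T) := @hdeg_walk k Q i.+1 p.
have gp j : (j <= i.+1)%N -> dgeq j (pbase (wpath p) : T).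
  by move=> ji; apply: (geqW ji); apply: hdeg_geq.
have hez : hdeg s (e (pend (wpath p)) * z) by apply: (@hdeg_mul _ _ 0) => //; apply: hdeg_idem.
have xz : x * e (pstart (wpath p)) * pbase (wpath p) * (e (pend (wpath p)) * z) = x * pbase (wpath p) * z.
  by rewrite -!mulrA (mulrA (e _)) idem_start (mulrA (pbase (wpath p))) idem_end.
have act j : (j <= 1)%N -> tnT (x * e (pstart (wpath p))) (e (pend (wpath p)) * z) *: vec i j (pbase (wpath p)) =
    vec i (j + s) (x * pbase (wpath p) * z).
  by move=> j1; rewrite -xz vec_act //; apply: gp; rewrite -addn1 leq_add2l.
by rewrite !scalerDr !sgn_scale (act 0%N) // (act 1%N).
Qed.

(** ** The kernel of [vec] *)

(** The kernel of [vec i s]. *)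
Definition ker_vec i s x := exists a b,
  [/\ x = a + b, IT (i + s) a & sprod (dgeq i) (fun z => I z /\ hdeg s z) b].

Lemma ker_vecL i s c x y : ker_vec i s x -> ker_vec i s y -> ker_vec i s (c *: x + y).
Proof.
move=> [a [b [-> Ia Ib]]] [a' [b' [-> Ia' Ib']]].
exists (c *: a + a'), (c *: b + b'); split.
- by rewrite scalerDr addrACA.
- exact: smemL.
exact: (@sprodL _ _ (degs_sub (fun n => i <= n)%N)).
Qed.

Lemma ker_vec0 i s : ker_vec i s 0.
Proof. by exists 0, 0; split; [rewrite addr0 | exact: smem0 | exact: sprod0]. Qed.

Definition kerS i s : submodule T := Submodule (ker_vec0 i s) (@ker_vecL i s).

Lemma ker_vec_l i s a z : I a -> hdeg (i + s) z -> ker_vec i s (a * z).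
Proof.
move=> Ia hz; exists (a * z), 0; split; [by rewrite addr0| |exact: sprod0].
exact: sprodM.
Qed.

Lemma ker_vec_r i s a z : dgeq i a -> I z -> hdeg s z -> ker_vec i s (a * z).
Proof.
move=> ga Iz hz; exists 0, (a * z); split; [by rewrite add0r|exact: smem0|].
exact: sprodM.
Qed.

Lemma ker_vec_graded i s : graded (ker_vec i s).
Proof.
move=> P x [a [b [-> Ia Ib]]]; exists (res P a), (res P b); split.
- exact: linearD.
- exact: IT_graded.
by apply: (graded_sprod (j := s)) Ib => [|y []//]; apply: graded_geq.
Qed.

Lemma ker_vecP i s x : ker_vec i s x -> vec i s x = 0.
Proof.
move=> [a [b [-> Ia Ib]]]; rewrite vecD [vec i s a](_ : _ = 0) ?add0r.
  elim: Ib => [|y z _ IH _ IH'|y z /geq_sprod gy [Iz hz]]; first exact: vec0.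
    by rewrite vecD IH IH' addr0.
  elim: gy => [|u v _ IH _ IH'|u v _ hv]; first by rewrite mul0r vec0.
    by rewrite mulrDl vecD IH IH' addr0.
  rewrite vec_mul //; apply/ffunP => m; rewrite !ffunE tnT_Ir ?mulr0 //.
  exact: gid_l.
elim: Ia => [|y z _ IH _ IH'|y z Iy hz]; first exact: vec0.
  by rewrite vecD IH IH' addr0.
have gs : dgeq s z by apply: geqW (hdeg_geq hz); apply: leq_addl.
rewrite (sum_dR gs) mulr_sumr vec_sum big1 // => q _.
have hd : hdeg i (dR q z).
  by apply: (@degs_dR _ _ (fun n => n = i)) => // p /hz ->; rewrite addnK.
rewrite mulrA vec_mul //; last exact: hdeg_walk.
apply/ffunP => m; rewrite !ffunE tnT_Il ?mulr0 //; exact: gid_r.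
Qed.

(** The complement of a linear projection onto I descends to A. *)
Lemma section_exists : exists N : A -> T,
  [/\ forall a b, N (a + b) = N a + N b, forall c a, N (kscal c * a) = c *: N a
    & forall x, I (N (pi x) - x)].
Proof.
have [p [pI pid]] := projection_exists I.
have [r rE] := choice (pr_surj pi).
have rI x y : pi x = pi y -> x - p x = y - p y.
  move=> /eqP; rewrite -subr_eq0 -rmorphB => /eqP /(pr_ker pi) /pid.
  rewrite linearB /= => D; have {1}-> : x = p x - p y + y by rewrite D subrK.
  by rewrite addrC !addrA addNr add0r addrC.
exists (fun a => r a - p (r a)); split=> [a b|c a|x].
- rewrite (rI _ (r a + r b)); last by rewrite rmorphD !rE.
  by rewrite linearD opprD addrACA.
- rewrite (rI _ (c *: r a)); last by rewrite pr_scale !rE.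
  by rewrite linearZZ scalerBr.
by rewrite (rI _ x) ?rE // addrC addKr; apply: smemN.
Qed.

End BimoduleComplex.

(** * Exactness of the bimodule complex in each right degree *)

Section BimoduleExactness.
Variables (k : fieldType) (Q : quiver) (I : gideal k Q) (A : kalgType k).
Variable (pi : presentation I A).
Variables (E : kalgType k) (t : enveloping A E).
Local Notation T := (palg k Q).
Local Notation e v := (pbase (ptriv v) : T).
Local Notation TK := (TK I).
Local Notation IT := (IT I).
Local Notation Y i := (free_mod E (walk Q i)).
Local Notation vec := (vec pi t).
Local Notation dif := (dif pi t).
Local Notation ker_vec := (ker_vec I).
Local Notation kerS := (kerS I).
Implicit Types (x y z : T).

Definition secN : A -> T := sval (cid (section_exists pi)).

Lemma secND a b : secN (a + b) = secN a + secN b.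
Proof. by rewrite /secN; case: cid => N []. Qed.
Lemma secNZ c a : secN (kscal c * a) = c *: secN a.
Proof. by rewrite /secN; case: cid => N []. Qed.
Lemma secN_I x : I (secN (pi x) - x).
Proof. by rewrite /secN; case: cid => N []. Qed.

(** The lift to T_s of the component in A_s of the class of an element. *)
Definition secd s (a : A) : T := res (pred1 s) (secN a).

Lemma secdD s a b : secd s (a + b) = secd s a + secd s b.
Proof. by rewrite /secd secND linearD. Qed.

Lemma secdZ s c a : secd s (kscal c * a) = c *: secd s a.
Proof. by rewrite /secd secNZ linearZZ. Qed.

Lemma secd_hdeg s a : hdeg s (secd s a).
Proof. exact: hdeg_res. Qed.

Lemma secd0 s : secd s 0 = 0.
Proof. by apply: (addrI (secd s 0)); rewrite -secdD !addr0. Qed.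

Lemma secd_I s s' z : hdeg s' z -> I (secd s (pi z) - (if s' == s then z else 0)).
Proof.
move=> hz; have := gid_graded (pred1 s) (secN_I z).
by rewrite linearB /= (res_hdeg _ hz).
Qed.

(** Replacing classes by their lifts in p tensor q times m gives back p m q modulo the
    kernel of [vec i s], and taking only the component of degree [s] of the lift of q
    kills the other right degrees. *)
Lemma vec_section i s : exists h : Y i -> T, (forall u v, h (u + v) = h u + h v) /\
  forall s' w, dgeq (i + s') w -> ker_vec i s (h (vec i s' w) - (if s' == s then w else 0)).
Proof.
have hm (m : walk Q i) : exists h : E -> T, (forall u v, h (u + v) = h u + h v) /\
    forall a b, h (t a b) = secN a * pbase m * secd s b.
  apply: (tn_lift t (f := fun a b => secN a * pbase m * secd s b)).
  - by move=> a a' b; rewrite secND !mulrDl.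
  - by move=> a b b'; rewrite secdD mulrDr.
  - by move=> c a b; rewrite secNZ -!scaleT_mull.
  - by move=> c a b; rewrite secdZ -scaleT_mulr.
have {hm} /choice[h hE] := hm.
pose H (f : Y i) : T := \sum_m h m (f m).
have HD u v : H (u + v) = H u + H v.
  by rewrite /H -big_split; apply: eq_bigr => m _ /=; rewrite ffunE (hE m).1.
exists H; split=> // s' w.
have H0 : H 0 = 0 by apply: (addrI (H 0)); rewrite -HD !addr0.
move: w; apply: dgeq_ind => [|w w' IH IH'|x m0 z hm hz].
- by rewrite vec0 H0 sub0r if_same oppr0; apply: (smem0 (kerS i s)).
- rewrite vecD HD; have := smemD (U := kerS i s) IH IH'.
  by case: eqP => _; rewrite ?subr0 // addrACA -opprD.
have E1 : (if s' == s then x * m0 * z else 0) = \sum_(m : walk Q i) pcoef m0 m *: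
    (if s' == s then x * e (pstart m) * pbase m * (e (pend m) * z) else 0).
  case: eqP => _; last by rewrite big1 // => m _; rewrite scaler0.
  rewrite {1}(hdeg_sum hm) mulr_sumr mulr_suml; apply: eq_bigr => m _.
  rewrite -scaleT_mulr -scaleT_mull; congr (_ *: _).
  by rewrite -!mulrA (mulrA (e _)) idem_start (mulrA (pbase m)) idem_end.
rewrite E1 /H -sumrB; apply: (smem_sum (U := kerS i s)) => m _.
rewrite (vec_mul _ _ _ hm hz) ffunE -tnT_Zl /tnT (hE m).2 pr_scale secNZ.
rewrite -!scaleT_mull -scalerBr; apply: (smemZ (U := kerS i s)).
set a := x * _; set b := _ * z.
have hb : hdeg s' b by apply: (@hdeg_mul _ _ 0) => //; apply: hdeg_idem.
have -> : secN (pi a) * pbase m * secd s (pi b) - (if s' == s then a * pbase m * b else 0) =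
    (secN (pi a) - a) * (pbase m * secd s (pi b)) +
    a * pbase m * (secd s (pi b) - (if s' == s then b else 0)).
  rewrite mulrBl !mulrBr !mulrA addrA subrK.
  by case: eqP => _; rewrite ?mulr0 // /b !mulrA.
apply: (smemD (U := kerS i s)).
  apply: ker_vec_l; first exact: secN_I.
  by apply: hdeg_mul; [apply: hdeg_walk | apply: secd_hdeg].
apply: ker_vec_r; last 2 first.
- exact: secd_I.
- apply: (smemB (U := homS s)); first exact: secd_hdeg.
  by case: eqP => [<-//|_]; apply: degs0.
by apply: (@geq_mul _ _ 0 i) => //; apply: hdeg_geq; apply: hdeg_walk.
Qed.

Lemma vec_sum_ker i M (w : nat -> T) : (forall s, dgeq (i + s) (w s)) ->
  \sum_(s < M) vec i s (w s) = 0 -> forall s, (s < M)%N -> ker_vec i s (w s).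
Proof.
move=> gw w0 s sM; have [h [hD hk]] := vec_section i s.
have h0 : h 0 = 0 by apply: (addrI (h 0)); rewrite -hD !addr0.
have E1 : \sum_(s' < M) (if (s' : nat) == s then w s' else 0) = w s.
  rewrite (bigD1 (Ordinal sM)) //= eqxx big1 ?addr0 // => s' ne.
  by rewrite -val_eqE /= in ne; rewrite (negbTE ne).
have := congr1 h w0; rewrite h0 (big_morph h hD h0) => hw.
rewrite -[w s]opprK -[- w s]add0r -{1}hw -E1 -sumrB.
apply: (smemN (U := kerS i s)); apply: (smem_sum (U := kerS i s)) => s' _.
exact: hk.
Qed.

(** ** The bimodules A K_i A *)

Definition TKT i s : submodule T := prodS (TK i) (hdeg s).

Lemma TKT_geq i s x : TKT i s x -> dgeq (i + s) x.
Proof. by apply: sprod_in_geq => y; apply: TK_geq. Qed.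

Lemma TKT_decr i s x : TKT i.+1 s x -> TKT i s x.
Proof. by apply: sprodS => // y; apply: TK_decr. Qed.

Lemma TKT_shift i s x : TKT i.+1 s x -> TKT i s.+1 x.
Proof.
apply: sprod_sub => y z Ty hz; elim: Ty => [|u v _ IH _ IH'|u v _ Kv].
- by rewrite mul0r; apply: smem0.
- by rewrite mulrDl; apply: smemD.
elim: (Kk_subr Kv) => [|a b _ IH _ IH'|a b Ka hb].
- by rewrite mulr0 mul0r; apply: smem0.
- by rewrite mulrDr mulrDl; apply: smemD.
rewrite mulrA -mulrA; apply: sprodM; last exact: (hdeg_mul hb hz).
by apply: sprodM.
Qed.

Lemma TKT_graded i s : graded (TKT i s).
Proof. by apply: (@graded_sprod _ _ _ _ s) => //; apply: TK_graded. Qed.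

(** The first two arrows of an element of K_(i+2) form a relation. *)
Lemma TKT_kerl i s x : TKT i.+2 s x -> ker_vec i s x.
Proof.
apply: (@sprod_sub _ _ _ _ (kerS i s)) => y z Ty hz.
elim: Ty => [|u v _ IH _ IH'|u v _ Kv].
- by rewrite mul0r; apply: (smem0 (kerS i s)).
- by rewrite mulrDl; apply: (smemD (U := kerS i s)).
elim: (Kk_quadl Kv) => [|a b _ IH _ IH'|a b [Ia _] hb].
- by rewrite mulr0 mul0r; apply: (smem0 (kerS i s)).
- by rewrite mulrDr mulrDl; apply: (smemD (U := kerS i s)).
rewrite mulrA -mulrA; apply: ker_vec_l; first exact: gid_l.
exact: hdeg_mul.
Qed.

Lemma TKT_kerr i s x : TKT i.+2 s x -> ker_vec i s.+2 x.
Proof.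
apply: (@sprod_sub _ _ _ _ (kerS i s.+2)) => y z Ty hz.
elim: Ty => [|u v _ IH _ IH'|u v _ Kv].
- by rewrite mul0r; apply: (smem0 (kerS i s.+2)).
- by rewrite mulrDl; apply: (smemD (U := kerS i s.+2)).
elim: (Kk_quadr Kv) => [|a b _ IH _ IH'|a b ha [Ib hb]].
- by rewrite mulr0 mul0r; apply: (smem0 (kerS i s.+2)).
- by rewrite mulrDr mulrDl; apply: (smemD (U := kerS i s.+2)).
rewrite mulrA -mulrA; apply: ker_vec_r; last exact: (hdeg_mul hb hz).
  by apply: (@geq_mul _ _ 0 i) => //; apply: hdeg_geq.
exact: gid_r.
Qed.

Lemma ker_vec_decr i s x : ker_vec i.+1 s x -> ker_vec i s.+1 x.
Proof.
move=> [a [b [-> Ia Ib]]]; apply: (smemD (U := kerS i s.+1)).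
  elim: Ia => [|y z _ IH _ IH'|y z Iy hz].
  - exact: (smem0 (kerS i s.+1)).
  - exact: (smemD (U := kerS i s.+1)).
  by apply: ker_vec_l => //; rewrite addnS.
elim: Ib => [|y z _ IH _ IH'|y z gy [Iz hz]].
- exact: (smem0 (kerS i s.+1)).
- exact: (smemD (U := kerS i s.+1)).
rewrite -addn1 in gy.
elim: (dgeq_sprod gy) => [|u v _ IH _ IH'|u v gu hv].
- by rewrite mul0r; apply: (smem0 (kerS i s.+1)).
- by rewrite mulrDl; apply: (smemD (U := kerS i s.+1)).
rewrite -mulrA; apply: ker_vec_r => //; first exact: gid_l.
exact: (hdeg_mul hv hz).
Qed.

(** ** Exactness *)

Section Star.
Variable s : nat.

(** The lift to T_s of the class of [z] in A_s, made compatible with the idempotents at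
    the start of paths. *)
Definition nuf z : T := \sum_v e v * secd s (pi (e v * z)).

Lemma nuf_linear c z z' : nuf (c *: z + z') = c *: nuf z + nuf z'.
Proof.
rewrite /nuf scaler_sumr -big_split; apply: eq_bigr => v _ /=.
by rewrite mulrDr -scaleT_mulr rmorphD pr_scale secdD secdZ mulrDr scaleT_mulr.
Qed.

Lemma nuf_hdeg z : hdeg s (nuf z).
Proof.
apply: (smem_sum (U := homS s)) => v _.
by apply: (@hdeg_mul _ _ 0 s); [apply: hdeg_idem | apply: secd_hdeg].
Qed.

Lemma nuf_I z : I z -> nuf z = 0.
Proof.
move=> Iz; rewrite /nuf big1 // => v _.
have /(pr_ker pi) -> : I (e v * z) by apply: gid_l.
by rewrite secd0 mulr0.
Qed.

Lemma nuf_eq z : hdeg s z -> I (nuf z - z).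
Proof.
move=> hz; have {2}-> : z = \sum_v e v * (e v * z).
  rewrite -[LHS]mul1r -pbase_one mulr_suml; apply: eq_bigr => v _.
  by rewrite mulrA idem_idem.
rewrite /nuf -sumrB; apply: smem_sum => v _; rewrite -mulrBr; apply: gid_l.
have hv : hdeg s (e v * z) by apply: (@hdeg_mul _ _ 0 s) => //; apply: hdeg_idem.
by have := secd_I s hv; rewrite eqxx.
Qed.

(** The map y q |-> y nuf(q), for q in T_s. *)
Definition psi x : T := \sum_(q : walk Q s) dR q x * nuf (pbase q).

Lemma psiD x y : psi (x + y) = psi x + psi y.
Proof.
by rewrite /psi -big_split; apply: eq_bigr => q _ /=; rewrite linearD mulrDl.
Qed.

Lemma psi0 : psi 0 = 0.
Proof. by rewrite /psi big1 // => q _; rewrite linear0 mul0r. Qed.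

Lemma nuf_idem v z : e v * nuf z = nuf (e v * z).
Proof.
rewrite /nuf (bigD1 v) //= mulrDr mulr_sumr big1 ?addr0 => [|w ne]; last first.
  by rewrite mulrA idem_mul eq_sym (negbTE ne) mul0r.
rewrite [RHS](bigD1 v) //= [X in _ = _ + X]big1 ?addr0 => [|w ne]; last first.
  by rewrite mulrA idem_mul (negbTE ne) mul0r rmorph0 secd0 mulr0.
by rewrite !mulrA !idem_idem.
Qed.

Lemma psi_mul y z : hdeg s z -> psi (y * z) = y * nuf z.
Proof.
move=> hz; have nu0 : nuf 0 = 0 by apply: nuf_I; apply: smem0.
have nuD : {morph nuf : a b / a + b}.
  by move=> a b; rewrite -{1}[a]scale1r nuf_linear scale1r.
rewrite [in RHS](hdeg_sum hz) (big_morph nuf nuD nu0) mulr_sumr.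
apply: eq_bigr => q _; rewrite dR_hdeg_mul // -scaleT_mull -mulrA nuf_idem idem_start.
by rewrite -[pcoef z q *: pbase q]addr0 nuf_linear nu0 addr0 -scaleT_mulr.
Qed.

Hypothesis LE : forall i x, TK i.+1 x -> IT i x ->
  exists2 u, TK i.+2 u & IT i.+1 (x - u).

(** The left complex stays exact after tensoring with A_s: modulo the products with last
    factor in [I], one may split off the last [s] arrows and work with each
    coefficient separately. *)
Lemma exact_tensor i w : TKT i.+1 s w -> ker_vec i s w ->
  exists2 u, TKT i.+2 s u & ker_vec i.+1 s (w - u).
Proof.
move=> Tw [a [b [wE Ia Ib]]].
have psiT : TKT i.+1 s (psi w).
  elim: Tw => [|y z _ IH _ IH'|y z Ty hz].
  - by rewrite psi0; apply: smem0.
  - by rewrite psiD; apply: smemD.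
  by rewrite psi_mul //; apply: sprodM => //; apply: nuf_hdeg.
have wpsi : ker_vec i.+1 s (w - psi w).
  elim: Tw => [|y z _ IH _ IH'|y z /TK_geq gy hz].
  - by rewrite psi0 subr0; apply: (smem0 (kerS _ _)).
  - by rewrite psiD opprD addrACA; apply: (smemD (U := kerS _ _)).
  rewrite psi_mul // -mulrBr; apply: ker_vec_r => //.
    by rewrite -opprB; apply: smemN; apply: nuf_eq.
  by apply: (smemB (U := homS s)) => //; apply: nuf_hdeg.
have psib : psi b = 0.
  elim: Ib => [|y z _ IH _ IH'|y z _ [Iz hz]]; first exact: psi0.
    by rewrite psiD IH IH' addr0.
  by rewrite psi_mul // nuf_I // mulr0.
have psia : IT (i + s) (psi w).
  rewrite wE psiD psib addr0; elim: Ia => [|y z _ IH _ IH'|y z Iy hz].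
  - by rewrite psi0; apply: smem0.
  - by rewrite psiD; apply: smemD.
  have gz : dgeq (i + s) z by apply: hdeg_geq.
  rewrite {1}(sum_dR (geqW (leq_addl _ _) gz)) mulr_sumr.
  rewrite (big_morph psi psiD psi0); apply: smem_sum => q _.
  have hd : hdeg i (dR q z).
    apply: (@degs_dR _ _ (fun n => n = i)); first exact: geqW (leq_addl _ _) gz.
    by move=> p /hz ->; rewrite addnK.
  rewrite mulrA psi_mul; last exact: hdeg_walk.
  by rewrite -mulrA; apply: sprodM => //; apply: hdeg_mul => //; apply: nuf_hdeg.
have coefP (q : walk Q s) : exists u, TK i.+2 u /\ IT i.+1 (dR q (psi w) - u).
  suff [u Tu Iu] : exists2 u, TK i.+2 u & IT i.+1 (dR q (psi w) - u) by exists u.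
  apply: LE.
    elim: psiT => [|y z _ IH _ IH'|y z Ty hz].
    - by rewrite linear0; apply: smem0.
    - by rewrite linearD; apply: smemD.
    rewrite dR_hdeg_mul //; apply: smemZ; apply: TK_mulr0 => //; exact: hdeg_idem.
  elim: psia => [|y z _ IH _ IH'|y z Iy hz].
  - by rewrite linear0; apply: smem0.
  - by rewrite linearD; apply: smemD.
  have gz : dgeq s z by apply: geqW (hdeg_geq hz); apply: leq_addl.
  rewrite dR_mul ?plen_wpath //; apply: sprodM => //.
  by apply: (@degs_dR _ _ (fun n => n = i)) => // p /hz ->; rewrite addnK.
have [u uE] := choice coefP; exists (\sum_(q : walk Q s) u q * pbase q).
  apply: smem_sum => q _; apply: sprodM; [exact: (uE q).1 | exact: hdeg_walk].
have -> : w - \sum_(q : walk Q s) u q * pbase q =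
    (w - psi w) + (psi w - \sum_(q : walk Q s) u q * pbase q) by rewrite addrA subrK.
apply: (smemD (U := kerS _ _)) => //.
have gs : dgeq s (psi w) by apply: geqW (IT_geq psia); apply: leq_addl.
rewrite (sum_dR gs) -sumrB; apply: (smem_sum (U := kerS _ _)) => q _.
rewrite -mulrBl; elim: (uE q).2 => [|y z _ IH _ IH'|y z Iy hz].
- by rewrite mul0r; apply: (smem0 (kerS _ _)).
- by rewrite mulrDl; apply: (smemD (U := kerS _ _)).
rewrite -mulrA; apply: ker_vec_l => //; apply: hdeg_mul => //; exact: hdeg_walk.
Qed.

End Star.

(** The submodule A K_i A of A T_i A. *)
Inductive Cmem i : Y i -> Prop :=
| Cmem0 : Cmem 0
| CmemD u v : Cmem u -> Cmem v -> Cmem (u + v)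
| Cmem_vec s w : TKT i s w -> Cmem (vec i s w).

Lemma CmemZ i a (u : Y i) : Cmem u -> Cmem (a *: u).
Proof.
move=> Cu; elim/(@tn_ind _ _ _ t): a => [|a b Ca Cb|a b].
- by rewrite scale0r; apply: Cmem0.
- by rewrite scalerDl; apply: CmemD.
elim: Cu => [|v v' _ IH _ IH'|s w Tw]; first by rewrite scaler0; apply: Cmem0.
  by rewrite scalerDr; apply: CmemD.
have [x <-] := pr_surj pi a; have [y <-] := pr_surj pi b.
have [B dB] := degs_bound y; rewrite (@sum_res _ _ y B.+1) // rmorph_sum tn_sumr scaler_suml.
elim/big_ind: _ => // [|v v'|h _]; [exact: Cmem0 | exact: CmemD|].
rewrite -[t _ _]/(tnT pi t x (res (pred1 (h : nat)) y)) -(vec_act pi t x (TKT_geq Tw) (@hdeg_res _ _ h y)).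
apply: Cmem_vec; rewrite -mulrA; elim: Tw => [|u1 u2 _ IH _ IH'|u1 u2 Tu hu].
- by rewrite mul0r mulr0; apply: smem0.
- by rewrite mulrDl mulrDr; apply: smemD.
rewrite -mulrA mulrA; apply: sprodM; first exact: TK_mull.
by apply: hdeg_mul => //; apply: hdeg_res.
Qed.

Lemma CmemL i a (u v : Y i) : Cmem u -> Cmem v -> Cmem (a *: u + v).
Proof. by move=> Cu; apply: CmemD; apply: CmemZ. Qed.

Definition CS i : submodule (Y i) := Submodule (smem := @Cmem i) (Cmem0 i) (@CmemL i).

(** A projection onto K_i that respects the idempotents on both sides induces a
    bimodule retraction of A T_i A onto A K_i A. *)
Lemma CS_projective i : projective (subm (CS i)).
Proof.
have [p [pK pid pe pe']] := K_projection I i.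
pose F (m : walk Q i) := vec i 0 (p (pbase m)).
have Cp (m : walk Q i) : CS i (F m).
  apply: Cmem_vec; rewrite -[p _]mulr1; apply: sprodM; last exact: hdeg1.
  by apply: Kk_TK; apply: pK.
apply: (retract_projective (p := free_fun F)) => [f|f Cf].
  by apply: smem_sum => m _; apply: smemZ; apply: Cp.
elim: Cf => [|u v _ IH _ IH'|s w Tw]; first exact: linear0.
  by rewrite linearD IH IH'.
elim: Tw => [|y z _ IH _ IH'|y z Ty hz]; first by rewrite vec0 linear0.
  by rewrite vecD linearD IH IH'.
elim: Ty => [|u v _ IH _ IH'|u v _ Kv]; first by rewrite mul0r vec0 linear0.
  by rewrite mulrDl vecD linearD IH IH'.
have hv := Kk_hdeg Kv.
rewrite [LHS](free_fun_vec pi t F u hv hz) -[in RHS](pid _ Kv) [in RHS](hdeg_sum hv).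
rewrite linear_sum mulr_sumr mulr_suml vec_sum; apply: eq_bigr => m _.
rewrite linearZZ -scaleT_mulr -scaleT_mull vecZ; congr (_ *: _).
have gp : dgeq (i + 0) (p (pbase m)) by rewrite addn0; apply: hdeg_geq; apply: Kk_hdeg (pK _).
have hez : hdeg s (e (pend m) * z) by apply: (@hdeg_mul _ _ 0 s) => //; apply: hdeg_idem.
rewrite -(vec_act pi t _ gp hez); congr (vec i s _).
by rewrite -!mulrA (mulrA (e _) (p _)) -pe idem_start (mulrA (p _)) -pe' idem_end.
Qed.

End BimoduleExactness.

(** * The bimodule Koszul resolution and its cohomology *)

Section Resolution.
Variables (k : fieldType) (Q : quiver) (I : gideal k Q) (A : kalgType k).
Variable (pi : presentation I A).
Variables (E : kalgType k) (t : enveloping A E).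
Variables (B : lmodType E) (bim : regular_bimodule t B).
Local Notation T := (palg k Q).
Local Notation e v := (pbase (ptriv v) : T).
Local Notation K := (Kk I).
Local Notation TK := (TK I).
Local Notation IT := (IT I).
Local Notation Y i := (free_mod E (walk Q i)).
Local Notation vec := (vec pi t).
Local Notation dif := (dif pi t).
Local Notation ker_vec := (ker_vec I).
Local Notation kerS := (kerS I).
Local Notation TKT := (TKT I).
Local Notation CS := (CS pi t).
Local Notation sgn := (sgn E).
Implicit Types (x y z : T).

Hypothesis LE : forall i x, TK i.+1 x -> IT i x ->
  exists2 u, TK i.+2 u & IT i.+1 (x - u).

Lemma vec_sign i s n x : vec i s ((-1) ^+ n *: x) = sgn n *: vec i s x.
Proof. by rewrite vecZ rmorphXn rmorphN1. Qed.

Lemma dif_vecT i s w : TKT i.+1 s w -> dif i (vec i.+1 s w) =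
  vec i s w + sgn i.+1 *: vec i s.+1 w.
Proof. by move=> Tw; apply: dif_vec; apply: (TKT_geq Tw). Qed.

Lemma dif_mem i u : CS i.+1 u -> CS i (dif i u).
Proof.
elim=> [|v v' _ IH _ IH'|s w Tw]; first by rewrite linear0; apply: Cmem0.
  by rewrite linearD; apply: CmemD.
rewrite dif_vecT //; apply: CmemD; first by apply: Cmem_vec; apply: TKT_decr.
by apply: CmemZ; apply: Cmem_vec; apply: TKT_shift.
Qed.

(** In [dif (vec i.+2 s w)] the relations at the left and at the right end of K_(i+2)
    kill the two outer terms, and the two middle ones cancel because of the signs. *)
Lemma dif_dif i u : CS i.+2 u -> dif i (dif i.+1 u) = 0.
Proof.
elim=> [|v v' _ IH _ IH'|s w Tw]; first by rewrite !linear0.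
  by rewrite !linearD /= IH IH' addr0.
rewrite dif_vecT // linearD linearZZ dif_vecT; last exact: TKT_decr.
rewrite dif_vecT; last exact: TKT_shift.
rewrite [vec i s w]ker_vecP ?[vec i s.+2 w]ker_vecP ?scaler0 ?addr0 ?add0r.
- by rewrite /sgn [(-1) ^+ i.+2]exprS mulN1r scaleNr subrr.
- exact: TKT_kerr.
exact: TKT_kerl.
Qed.

Definition prev (w : nat -> T) s : T := if s is s'.+1 then w s' else 0.

(** An element of A K_i A is the sum of the [vec i s (w s)] for some family [w]; the
    component of right degree [s] of its differential is [w s] plus or minus
    [prev w s], see [dif_fsum]. *)
Definition family i M (w : nat -> T) :=
  (forall s, TKT i s (w s)) /\ (forall s, (M <= s)%N -> w s = 0).

Definition fsum i M (w : nat -> T) : Y i := \sum_(s < M) vec i s (w s).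

Lemma fsum_widen i M M' w : (M <= M')%N -> family i M w -> fsum i M' w = fsum i M w.
Proof.
move=> MM' [_ w0]; rewrite /fsum [RHS](big_ord_widen M' (fun s => vec i s (w s))) //.
rewrite [RHS]big_mkcond; apply: eq_bigr => s _.
by case: ltnP => // /w0 ->; rewrite vec0.
Qed.

Lemma CS_family i u : CS i u -> exists M w, family i M w /\ u = fsum i M w.
Proof.
elim=> [|u1 u2 _ [M1 [w1 [f1 ->]]] _ [M2 [w2 [f2 ->]]]|s w Tw].
- exists 0%N, (fun _ => 0); split; last by rewrite /fsum big_ord0.
  by split=> // s; apply: smem0.
- exists (maxn M1 M2), (fun s => w1 s + w2 s); split.
    split=> s; first by apply: smemD; [apply: f1.1 | apply: f2.1].
    by rewrite geq_max => /andP[? ?]; rewrite f1.2 // f2.2 // addr0.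
  rewrite -(fsum_widen (leq_maxl M1 M2) f1) -(fsum_widen (leq_maxr M1 M2) f2).
  by rewrite /fsum -big_split; apply: eq_bigr => s _; rewrite vecD.
exists s.+1, (fun s' => if s' == s then w else 0); split.
  split=> s'; first by case: eqP => [->//|_]; apply: smem0.
  by move=> ss'; rewrite gtn_eqF.
rewrite /fsum big_ord_recr /= eqxx big1 ?add0r // => s' _.
by rewrite ltn_eqF ?vec0.
Qed.

Lemma fsum_mem i M w : family i M w -> CS i (fsum i M w).
Proof. by move=> [Tw _]; apply: smem_sum => s _; apply: Cmem_vec. Qed.

Lemma dif_fsum i M w : family i.+1 M w ->
  dif i (fsum i.+1 M w) = fsum i M.+1 (fun s => w s + (-1) ^+ i.+1 *: prev w s).
Proof.
move=> [Tw w0]; rewrite /fsum linear_sum.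
under eq_bigr do rewrite dif_vecT //.
under [in RHS]eq_bigr do rewrite vecD vec_sign.
rewrite !big_split /=; congr (_ + _).
  by rewrite big_ord_recr /= w0 // vec0 addr0.
by rewrite big_ord_recl /= vec0 scaler0 add0r.
Qed.

Lemma family_bound i M w : family i M w ->
  exists D, forall s, degs (fun n => n <= D)%N (w s).
Proof.
move=> [_ w0]; have [b bP] := choice (fun s => degs_bound (w s)).
exists (\max_(s < M) b s) => s; have [sM|/w0 ->] := ltnP s M; last exact: degs0.
by apply: degsW (bP s) => n /leq_trans; apply; apply: (leq_bigmax (Ordinal sM)).
Qed.

Lemma prev_mem i s w : (forall s, TKT i.+1 s (w s)) -> TKT i s (prev w s).
Proof. by case: s => [|s] Tw; [exact: smem0 | exact: TKT_shift]. Qed.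

(** The components of a primitive are found one after the other from right degree 0 on,
    each by exactness of the left complex; a bound [D] on the degrees makes the process
    stop, as the component of right degree [s] has degree at least [s]. *)
Lemma primitive i D (w : nat -> T) : (forall s, TKT i.+1 s (w s)) ->
  (forall s, degs (fun n => n <= D)%N (w s)) ->
  (forall s, ker_vec i s (w s + (-1) ^+ i.+1 *: prev w s)) ->
  forall N, exists u : nat -> T, [/\ forall s, TKT i.+2 s (u s),
    forall s, degs (fun n => n <= D)%N (u s)
    & forall s, (s < N)%N -> ker_vec i.+1 s (w s - (u s + (-1) ^+ i.+2 *: prev u s))].
Proof.
move=> Tw dw cw; set ep : k := (-1) ^+ i.+1.
have epE : (-1) ^+ i.+2 = - ep by rewrite exprS mulN1r.
have ep2 : ep * ep = 1 by rewrite -expr2 sqrr_sign.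
rewrite epE; elim=> [|N [u [Tu du cu]]].
  by exists (fun _ => 0); split=> // s; [apply: smem0 | apply: degs0].
pose w' := w N + ep *: prev u N.
have Tw' : TKT i.+1 N w'.
  by apply: smemD => //; apply: smemZ; apply: prev_mem => s.
have kw' : ker_vec i N w'.
  rewrite /w'; case: N cu {w' Tw'} => [|N] cu /=.
    by have := cw 0%N; rewrite /= scaler0.
  have -> : w N.+1 + ep *: u N = (w N.+1 + ep *: w N) -
      ep *: (w N - (u N - ep *: prev u N)) + prev u N.
    rewrite !scalerBr scalerA ep2 scale1r opprB [_ - ep *: w N]addrC.
    by rewrite !addrA addrK subrK.
  apply: (smemD (U := kerS i N.+1)).
    apply: (smemB (U := kerS i N.+1)); first exact: (cw N.+1).
    apply: (smemZ (U := kerS i N.+1)); apply: ker_vec_decr.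
    by rewrite -scaleNr; apply: cu.
  case: N {cu} => [|N] /=; first exact: (smem0 (kerS _ _)).
  exact: TKT_kerr.
have [x Tx kx] := exact_tensor pi LE Tw' kw'.
pose y := res (fun n => n <= D)%N x.
have Ty : TKT i.+2 N y by apply: TKT_graded.
have dw' : degs (fun n => n <= D)%N w'.
  apply: degsD => //; apply: degsZ.
  by case: (N) => [|N']; [apply: degs0 | apply: du].
have ky : ker_vec i.+1 N (w' - y).
  by rewrite -[w'](@res_id _ _ (fun n => n <= D)%N) // -linearB; apply: ker_vec_graded.
exists (fun s => if s == N then y else u s); split=> s.
- by case: eqP => [->|].
- by case: eqP => _ //; apply: (@degs_res _ _ (fun n => n <= D)%N).
rewrite ltnS leq_eqVlt => /orP[/eqP ->|sN].
  have -> : prev (fun s => if s == N then y else u s) N = prev u N.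
    by case: (N) => //= N'; rewrite ltn_eqF.
  by rewrite eqxx scaleNr opprB addrA [w N + _]addrC -addrA addrC addrAC.
have -> : prev (fun s => if s == N then y else u s) s = prev u s.
  by case: s sN => //= s' /ltnW sN; rewrite ltn_eqF.
by rewrite ltn_eqF //; apply: cu.
Qed.

Lemma dif_exact i u : CS i.+1 u -> dif i u = 0 -> exists2 v, CS i.+2 v & dif i.+1 v = u.
Proof.
move=> /CS_family[M [w [fw {u}->]]]; rewrite (dif_fsum fw) => d0.
have [D dD] := family_bound fw.
have gw s : dgeq (i + s) (w s + (-1) ^+ i.+1 *: prev w s).
  apply: degsD; first exact/TKT_geq/TKT_decr/fw.1.
  by apply: degsZ; apply/TKT_geq/prev_mem; apply: fw.1.
have cw s : ker_vec i s (w s + (-1) ^+ i.+1 *: prev w s).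
  have [sM|Ms] := ltnP s M.+1; first exact: (vec_sum_ker gw d0 sM).
  rewrite fw.2 ?(ltnW Ms) // add0r; apply: (smemZ (U := kerS i s)).
  by case: s Ms => [|s] //= Ms; rewrite fw.2 //; apply: (smem0 (kerS _ _)).
pose N := (maxn M D).+1.
have [u [Tu du cu]] := primitive fw.1 dD cw N.+1.
have u0 s : (D < s)%N -> u s = 0.
  move=> Ds; apply: pcoef_inj => p; rewrite pcoef0; apply/eqP/contraT => np.
  have := leq_trans (TKT_geq (Tu s) np) (du s p np).
  by rewrite leqNgt (leq_trans Ds) // leq_addl.
have fu : family i.+2 N u.
  split=> // s Ns; apply: u0; apply: leq_trans Ns; rewrite ltnS; exact: leq_maxr.
exists (fsum i.+2 N u); first exact: fsum_mem.
rewrite (dif_fsum fu); have MN : (M <= N.+1)%N.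
  by apply: leq_trans (leq_maxl M D) _; rewrite /N -addn2 leq_addr.
rewrite -(fsum_widen MN fw); apply/eqP; rewrite eq_sym -subr_eq0; apply/eqP.
rewrite /fsum -sumrB big1 // => s _; rewrite -vecB; apply: ker_vecP; apply: cu.
exact: ltn_ord.
Qed.

Lemma bimZ c a : (kscal c : E) *: bim a = bim (kscal c * a).
Proof. by rewrite -[kscal c in LHS]mulr1 -(tn1 t) -tnZl mulr1 bim_act mulr1. Qed.

Lemma bim0 : bim 0 = 0.
Proof. by apply: (addrI (bim 0)); rewrite -bimD !addr0. Qed.

Lemma bim_sum J (r : seq J) (P : pred J) (F : J -> A) :
  bim (\sum_(j <- r | P j) F j) = \sum_(j <- r | P j) bim (F j).
Proof. exact: (big_morph bim (bimD bim) bim0). Qed.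

Definition augm : {linear Y 0 -> B} := free_fun (fun m : walk Q 0 => bim (pi (pbase m))).

Lemma augm_vec s w : dgeq s w -> augm (vec 0 s w) = bim (pi w).
Proof.
move: w; apply: (@dgeq_ind _ _ 0 s) => [|w w' IH IH'|x m z hm hz].
- by rewrite vec0 linear0 rmorph0 bim0.
- by rewrite vecD linearD /= IH IH' rmorphD bimD.
rewrite [LHS](free_fun_vec pi t _ x hm hz) [in RHS](hdeg_sum hm) mulr_sumr mulr_suml.
rewrite rmorph_sum bim_sum; apply: eq_bigr => p _.
rewrite -scaleT_mulr -scaleT_mull pr_scale -bimZ /tnT bim_act -!rmorphM.
by rewrite -!mulrA (mulrA (e _)) idem_start (mulrA (pbase p)) idem_end.
Qed.

Lemma augm_surj b : exists2 u, CS 0 u & augm u = b.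
Proof.
have [a <-] := bim_surj bim b; have [x <-] := pr_surj pi a.
exists (vec 0 0 x); last by rewrite augm_vec.
apply: Cmem_vec; rewrite -[x]mulr1; apply: sprodM; last exact: hdeg1.
rewrite -[x]mulr1; apply: sprodM => //; apply: hdeg_Kk0; exact: hdeg1.
Qed.

Lemma augm_dif u : CS 1 u -> augm (dif 0 u) = 0.
Proof.
elim=> [|v v' _ IH _ IH'|s w Tw]; first by rewrite !linear0.
  by rewrite !linearD /= IH IH' addr0.
have gw := TKT_geq Tw; rewrite dif_vecT // linearD linearZZ.
rewrite !augm_vec //; last exact: geqW gw.
by rewrite /sgn expr1 scaleN1r subrr.
Qed.

(** The differential of [vec 1 s w] is the difference of the two ways to cut [w] after
    all but [s + 1] or all but [s] arrows. *)
Lemma vec_cut s w : dgeq s w ->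
  exists2 v, CS 1 v & vec 0 s w = vec 0 0 w + dif 0 v.
Proof.
elim: s => [|s IH] gw.
  by exists 0; [apply: Cmem0 | rewrite linear0 addr0].
have Tw : TKT 1 s w.
  apply: sprodS (dgeq_sprod (i := 1) gw) => // y /geq_sprod.
  by apply: sprodS => // z; apply: hdeg_Kk1.
have [v Cv vE] := IH (geqW (leqnSn s) gw).
exists (v - vec 1 s w); first by apply: (smemB (U := CS 1)) => //; apply: Cmem_vec.
rewrite linearB /= dif_vecT // /sgn expr1 scaleN1r opprB addrA -vE.
by rewrite addrC subrK.
Qed.

Lemma augm_exact u : CS 0 u -> augm u = 0 -> exists2 v, CS 1 v & dif 0 v = u.
Proof.
move=> Cu u0.
have [w [v [Cv uE aE]]] : exists w v, [/\ CS 1 v, u = vec 0 0 w + dif 0 v & augm u = bim (pi w)].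
  elim: Cu {u0} => [|u1 u2 _ [w1 [v1 [C1 E1 A1]]] _ [w2 [v2 [C2 E2 A2]]]|s w Tw].
  - by exists 0, 0; rewrite vec0 !linear0 rmorph0 bim0 addr0; split=> //; apply: Cmem0.
  - exists (w1 + w2), (v1 + v2); split; first exact: CmemD.
      by rewrite vecD linearD addrACA -E1 -E2.
    by rewrite linearD /= A1 A2 rmorphD bimD.
  have gw := TKT_geq Tw; have [v Cv vE] := vec_cut gw.
  by exists w, v; split=> //; apply: augm_vec.
have Iw : I w.
  by apply/(pr_ker pi)/(bim_inj (r := bim)); rewrite -aE u0 bim0.
exists v => //; rewrite uE ker_vecP ?add0r // -[w]mulr1.
by apply: ker_vec_l => //; apply: hdeg1.
Qed.

(** ** The resolution and its cohomology *)

Lemma kdiff_exists i : exists g : {linear subm (CS i.+1) -> subm (CS i)},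
  forall u, incl _ (g u) = dif i (incl _ u).
Proof.
apply: (corestrict (f := dif i \o incl (CS i.+1) : {linear subm (CS i.+1) -> Y i})).
by move=> x; apply: dif_mem; apply: inclP.
Qed.

Definition kdiff i : {linear subm (CS i.+1) -> subm (CS i)} := sval (cid (kdiff_exists i)).

Lemma kdiffE i u : incl _ (kdiff i u) = dif i (incl _ u).
Proof. exact: (svalP (cid (kdiff_exists i))). Qed.

Definition koszul_resolution : proj_resolution B.
Proof.
apply: (@ProjResolution E B (fun i => subm (CS i)) kdiff (augm \o incl (CS 0))).
- exact: CS_projective.
- move=> y; have [u /subm_of[x xu] uy] := augm_surj y.
  by exists x; rewrite -[LHS]/(augm (incl (CS 0) x)) xu.
- move=> x; change (augm (incl (CS 0) x) = 0 <-> exists u, kdiff 0 u = x).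
  split=> [x0|[y <-]].
    have [v /subm_of[y yv] vE] := augm_exact (inclP x) x0.
    by exists y; apply: incl_inj; rewrite kdiffE yv.
  by rewrite kdiffE augm_dif //; apply: inclP.
move=> i x; split=> [x0|[y <-]].
  have [||v /subm_of[y yv] vE] := @dif_exact i (incl _ x); first exact: inclP.
    by rewrite -kdiffE x0 linear0.
  by exists y; apply: incl_inj; rewrite kdiffE yv.
by apply: incl_inj; rewrite !kdiffE linear0; apply: dif_dif; apply: inclP.
Defined.

Lemma CS_trivial i : (forall x, K i x -> x = 0) -> forall u, CS i u -> u = 0.
Proof.
move=> K0 u; elim=> [//|v v' _ -> _ ->|s w Tw]; first by rewrite addr0.
suff -> : w = 0 by rewrite vec0.
elim: Tw => [//|y z _ -> _ ->|y z Ty _]; first by rewrite addr0.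
suff -> : y = 0 by rewrite mul0r.
elim: Ty => [//|y1 y2 _ -> _ ->|y1 y2 _ /K0 ->]; first by rewrite addr0.
by rewrite mulr0.
Qed.

(** The differential takes an arrow out of a generator, on the left or on the right, and
    [g] is linear on both sides. The radical consists of the classes of elements of positive
    degree. *)
Lemma boundary_radical n (g : {linear subm (CS n) -> B}) x (u : subm (CS n.+1)) :
  K n.+1 x -> incl _ u = vec n.+1 0 x -> exists2 y, dgeq 1 y & g (kdiff n u) = bim (pi y).
Proof.
move=> Kx uE.
pose rad (b : B) := exists2 y, dgeq 1 y & b = bim (pi y).
have rad0 : rad 0 by exists 0; [exact: degs0 | rewrite rmorph0 bim0].
have radD b b' : rad b -> rad b' -> rad (b + b').
  by move=> [y gy ->] [y' gy' ->]; exists (y + y'); [exact: degsD | rewrite rmorphD bimD].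
have genK y : K n y -> exists w : subm (CS n), incl _ w = vec n 0 y.
  move=> Ky; apply: subm_of; apply: Cmem_vec; rewrite -[y]mulr1.
  by apply: sprodM; [exact: Kk_TK | exact: hdeg1].
have gpi w : exists y, g w = bim (pi y).
  by have [b <-] := bim_surj bim (g w); have [y <-] := pr_surj pi b; exists y.
have actK a y c s : hdeg s c -> dgeq 1 a \/ dgeq 1 c -> K n y ->
    exists w : subm (CS n), incl _ w = vec n s (a * y * c) /\ rad (g w).
  move=> hc ac Ky; have [w wE] := genK y Ky; have [y' yE] := gpi w.
  exists (tnT pi t a c *: w); split.
    rewrite inclZ wE -(vec_act pi t a _ hc) // addn0.
    by apply: hdeg_geq; apply: Kk_hdeg Ky.
  exists (a * y' * c); last by rewrite linearZZ yE /tnT bim_act !rmorphM.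
  case: ac => [ga|gc]; last by apply: (@geq_mul _ _ 0 1).
  by rewrite -mulrA; apply: (@geq_mul _ _ 1 0).
have radL y : sprod (hdeg 1) (K n) y ->
    exists w : subm (CS n), incl _ w = vec n 0 y /\ rad (g w).
  elim=> [|y1 y2 _ [w1 [E1 R1]] _ [w2 [E2 R2]]|a y' ha Ky'].
  - by exists 0; rewrite !linear0 vec0.
  - by exists (w1 + w2); rewrite inclD linearD E1 E2 vecD; split=> //; apply: radD.
  rewrite -[a * y']mulr1; apply: actK => //; first exact: hdeg1.
  by left; apply: hdeg_geq.
have radR y : sprod (K n) (hdeg 1) y ->
    exists w : subm (CS n), incl _ w = vec n 1 y /\ rad (g w).
  elim=> [|y1 y2 _ [w1 [E1 R1]] _ [w2 [E2 R2]]|y' c Ky' hc].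
  - by exists 0; rewrite !linear0 vec0.
  - by exists (w1 + w2); rewrite inclD linearD E1 E2 vecD; split=> //; apply: radD.
  rewrite -[y']mul1r; apply: actK => //.
  by right; apply: hdeg_geq.
have [w1 [E1 R1]] := radL _ (Kk_subl Kx).
have [w2 [E2 [y2 gy2 R2]]] := radR _ (Kk_subr Kx).
have -> : kdiff n u = w1 + sgn n.+1 *: w2.
  apply: incl_inj; rewrite kdiffE uE inclD inclZ E1 E2 dif_vec //.
  by rewrite addn0; apply: hdeg_geq; apply: Kk_hdeg Kx.
rewrite linearD linearZZ R2; apply: radD => //.
exists ((-1) ^+ n.+1 *: y2); first exact: degsZ.
by rewrite pr_scale -bimZ rmorphXn rmorphN1.
Qed.

(** As K_(n+2) = 0, all linear maps on A K_(n+1) A are cocycles. A linear functional on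
    the sum of the e_v K_(n+1) e_v, with its value on the summand of v multiplied by e_v,
    extends to such a map, while a coboundary takes the generators into the radical of
    A, which does not contain a nonzero multiple of e_v. Functionals dual to [b] hence give
    independent classes. *)
Theorem Ext_lower_bound n d (b : 'I_d -> qvert Q -> T) :
  (forall j v, K n.+1 (b j v)) -> (forall j v, e v * b j v * e v = b j v) ->
  (forall c : 'I_d -> k, (forall v, \sum_j c j *: b j v = 0) -> forall j, c j = 0) ->
  (forall x, K n.+2 x -> x = 0) ->
  Ext_dim_ge B B n.+1 d.
Proof.
move=> Kb eb bfree K0.
pose N := #|{: walk Q n.+1}|; pose m (l : 'I_N) : walk Q n.+1 := enum_val l.
pose L : 'M[k]_(d, N) := \matrix_(j, l) pcoef (b j (pstart (m l))) (m l).
have bcoef j v p : pcoef (b j v) p != 0 -> [/\ pstart p = v, pend p = v & plen p = n.+1].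
  move=> nz; have := nz; rewrite -eb pcoef_mul_idem pcoef_idem_mul.
  case: (v =P pend p) => [<-|_]; last by rewrite eqxx.
  case: (v =P pstart p) => [<-|_]; last by rewrite eqxx.
  by split=> //; apply: (Kk_hdeg (Kb j v)).
(* The rows of [L] are the coordinates of the families [b j]; a right inverse [R]
   consists of coordinate vectors of functionals dual to them. *)
have /row_freeP[R LR] : row_free L.
  apply: inj_row_free => c cL; apply/rowP => j; rewrite mxE; move: j.
  apply: bfree => v; apply: pcoef_inj => p; rewrite pcoef0 pcoef_sum.
  have [/andP[/eqP pv /eqP pn]|np] := boolP ((pstart p == v) && (plen p == n.+1)).
    have [q qp] := walk_of p; move: q qp; rewrite pn => q qp.
    have := congr1 (fun M : 'rV_N => M 0 (enum_rank q)) cL; rewrite !mxE => {2}<-.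
    by apply: eq_bigr => j _; rewrite pcoefZ mxE /m enum_rankK qp pv.
  rewrite big1 // => j _; rewrite pcoefZ.
  have [->|/bcoef[pv _ pn]] := eqVneq (pcoef (b j v) p) 0; first by rewrite mulr0.
  by rewrite pv pn !eqxx in np.
pose F j : {linear Y n.+1 -> B} := free_fun (fun q : walk Q n.+1 =>
  bim (kscal (R (enum_rank q) j) * pi (e (pstart q)))).
pose f j : {linear subm (CS n.+1) -> B} := F j \o incl (CS n.+1).
have fE j u : f j u = F j (incl _ u) by [].
apply: (@Ext_dim_ge_transfer _ _ _ _ koszul_resolution n d f).
  move=> j u; rewrite fE kdiffE.
  have -> : incl _ u = 0 by apply: (CS_trivial K0); apply: inclP.
  by rewrite !linear0.
move=> c [g gE].
pose a i j v := \sum_(q : walk Q n.+1) pcoef (b j v) q * R (enum_rank q) i.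
have FE i j v : F i (vec n.+1 0 (b j v)) = bim (pi (a i j v *: e v)).
  rewrite -[b j v]mulr1 -[b j v]mul1r [LHS](free_fun_vec pi t _ _ (Kk_hdeg (Kb j v))); last exact: hdeg1.
  rewrite scaler_suml rmorph_sum bim_sum; apply: eq_bigr => q _.
  have [b0|/bcoef[qs qe _]] := eqVneq (pcoef (b j v) q) 0.
    by rewrite b0 rmorph0 scale0r mul0r scale0r rmorph0 bim0.
  rewrite qs qe mul1r mulr1 /tnT bim_act bimZ -pr_scale -!rmorphM -pr_scale.
  by rewrite -scaleT_mulr -scaleT_mull !idem_idem scalerA.
(* [a i j v] is the [v]-part of the value of the [i]-th functional on [b j]. *)
have main j v : \sum_i c i * a i j v = 0.
  have [u uE] : exists u : subm (CS n.+1), incl _ u = vec n.+1 0 (b j v).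
    apply: subm_of; apply: Cmem_vec; rewrite -[b j v]mulr1.
    by apply: sprodM; [exact: Kk_TK | exact: hdeg1].
  have [y gy yE] := boundary_radical g (Kb j v) uE.
  have := gE u; rewrite -[pdiff _ _ _]/(kdiff n u) yE.
  under eq_bigr do rewrite fE uE FE bimZ -pr_scale scalerA.
  rewrite -bim_sum -rmorph_sum -scaler_suml => /bim_inj /eqP.
  rewrite -subr_eq0 -rmorphB => /eqP /(pr_ker pi) /gid_geq2 g2.
  have : dgeq 1 ((\sum_i c i * a i j v) *: e v).
    by rewrite -[_ *: _](subrK y); apply: degsD => //; apply: geqW g2.
  move=> /(_ (ptriv v)); rewrite pcoefZ pcoef_base eqxx mulr1 => ge1.
  by apply/eqP/contraT => /ge1.
move=> j; have -> : c j = \sum_i c i * (L *m R) j i.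
  rewrite LR (bigD1 j) //= mxE eqxx mulr1 big1 ?addr0 // => i ne.
  by rewrite mxE eq_sym (negbTE ne) mulr0.
transitivity (\sum_v \sum_i c i * a i j v); last by rewrite big1.
rewrite [RHS]exchange_big; apply: eq_bigr => i _; rewrite -mulr_sumr; congr (_ * _).
rewrite mxE exchange_big (reindex (enum_val : 'I_N -> walk Q n.+1)) /=; last first.
  by exists enum_rank => q _; [exact: enum_valK | exact: enum_rankK].
apply: eq_bigr => l _; rewrite mxE -mulr_suml enum_valK; congr (_ * _).
rewrite (bigD1 (pstart (m l))) //= big1 ?addr0 // => v ne.
by apply/eqP/contraT => /bcoef[vs _ _]; rewrite -vs eqxx in ne.
Qed.

End Resolution.

(** * The enveloping algebra as a tensor product *)

Section QuotientAlgebra.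
Variables (k : fieldType) (B : kalgType k) (G : B -> Prop).

Lemma quotpi0 : quotpi G 0 = 0.
Proof. by have := quotpiB G 0 0; rewrite !subrr. Qed.

Lemma quotpi_eq0 x : quotpi G x = 0 <-> ideal G x.
Proof. by rewrite -quotpi0; split=> [/quotpiP|Gx]; [|apply/quotpiP]; rewrite subr0. Qed.

Lemma quotpi_rel x : G x -> quotpi G x = 0.
Proof.
move=> Gx; apply/quotpi_eq0; exists [:: (1, x, 1)]; split=> [u|].
  by rewrite inE => /eqP ->.
by rewrite big_seq1 mul1r mulr1.
Qed.

Variable S : B -> Prop.
Hypothesis S_span : forall F : B -> Prop, F 0 -> (forall x y, F x -> F y -> F (x + y)) ->
  (forall c x, F x -> F (kscal c * x)) -> (forall x, S x -> F x) -> forall x, F x.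

(** If [S] spans [B], multipliers in [S] suffice to describe the elements of the ideal. *)
Lemma ideal_ind (F : B -> Prop) : F 0 -> (forall x y, F x -> F y -> F (x + y)) ->
  (forall c x, F x -> F (kscal c * x)) ->
  (forall a r b, S a -> G r -> S b -> F (a * r * b)) ->
  forall x, ideal G x -> F x.
Proof.
move=> F0 FD FZ FG _ [s [sG ->]]; rewrite big_seq.
elim/big_ind: _ => // -[[a r] b] /sG /= Gr.
elim/S_span: a => [|a a' Ha Ha'|c a Ha|a Sa].
- by rewrite !mul0r.
- by rewrite !mulrDl; apply: FD.
- by rewrite -!mulrA; apply: FZ; rewrite mulrA.
elim/S_span: b => [|b b' Hb Hb'|c b Hb|b Sb].
- by rewrite mulr0.
- by rewrite mulrDr; apply: FD.
- by rewrite mulrA -kscalC -mulrA; apply: FZ.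
exact: FG.
Qed.

End QuotientAlgebra.

Lemma pmalg_span (k : fieldType) (X : pmonType) (F : pmalg k X -> Prop) :
  F 0 -> (forall x y, F x -> F y -> F (x + y)) ->
  (forall c x, F x -> F (kscal c * x)) ->
  (forall x, (exists p : X, x = << p >>) -> F x) -> forall x, F x.
Proof.
move=> F0 FD FZ FS; apply: pmalg_ind => //.
  by move=> c f Ff; rewrite -[c *: f]pm_scalE; apply: FZ.
by move=> p; apply: FS; exists p.
Qed.

Section EnvelopingAlgebra.
Variables (k : fieldType) (A : kalgType k).
Local Notation X := (envmon A).
Local Notation PT := (@pre_tensor k A).

Lemma tensor_rel (r : pmalg k X) : env_rel r -> quotpi (@env_rel k A) r = 0.
Proof. exact: quotpi_rel. Qed.

Lemma tensorDl (a a' b : A) : tensor (a + a') b = tensor a b + tensor a' b.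
Proof.
have := tensor_rel (EnvAddl a a' b); rewrite !quotpiB => /eqP.
by rewrite -addrA -opprD subr_eq0 => /eqP.
Qed.

Lemma tensorDr (a b b' : A) : tensor a (b + b') = tensor a b + tensor a b'.
Proof.
have := tensor_rel (EnvAddr a b b'); rewrite !quotpiB => /eqP.
by rewrite -addrA -opprD subr_eq0 => /eqP.
Qed.

Lemma quotpi_scale c (f : pmalg k X) :
  quotpi (@env_rel k A) (c *: f) = kscal c * quotpi (@env_rel k A) f.
Proof. by rewrite -[c *: f]pm_scalE quotpiM. Qed.

Lemma tensorZl c (a b : A) : tensor (kscal c * a) b = kscal c * tensor a b.
Proof.
have := tensor_rel (EnvScall c a b); rewrite quotpiB quotpi_scale => /eqP.
by rewrite subr_eq0 => /eqP.
Qed.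

Lemma tensorZr c (a b : A) : tensor a (kscal c * b) = kscal c * tensor a b.
Proof.
have := tensor_rel (EnvScalr c a b); rewrite quotpiB quotpi_scale => /eqP.
by rewrite subr_eq0 => /eqP.
Qed.

Lemma pre_tensorM (a b c d : A) : PT a b * PT c d = PT (a * c) (d * b).
Proof. exact: pm_mulUU. Qed.

Lemma tensorM (a b c d : A) : tensor a b * tensor c d = tensor (a * c) (d * b).
Proof. by rewrite /tensor -quotpiM pre_tensorM. Qed.

Lemma pre_tensor1 : PT 1 1 = 1.
Proof. by symmetry; apply: big_seq1. Qed.

Lemma tensor1 : tensor (1 : A) 1 = 1.
Proof. by rewrite /tensor pre_tensor1. Qed.

Lemma tensor_ind (F : envalg A -> Prop) : F 0 -> (forall u v, F u -> F v -> F (u + v)) ->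
  (forall a b, F (tensor a b)) -> forall u, F u.
Proof.
move=> F0 FD FT; apply: quot_elim => f; rewrite (pmalgE f).
elim/big_ind: _ => [|u v Fu Fv|[a b] _].
- by rewrite quotpi0.
- by rewrite quotpiD; apply: FD.
by rewrite quotpi_scale -tensorZl; apply: FT.
Qed.

Lemma scale_in (c : k) (f g h : pmalg k X) : f * (c *: g) * h = c *: (f * g * h).
Proof.
rewrite -[c *: g]pm_scalE -[RHS]pm_scalE mulrA.
by rewrite -(pm_scalC c f) -!mulrA.
Qed.

Section Lift.
Variables (V : lmodType k) (f : A -> A -> V).
Hypothesis fDl : forall a a' b, f (a + a') b = f a b + f a' b.
Hypothesis fDr : forall a b b', f a (b + b') = f a b + f a b'.
Hypothesis fZl : forall c a b, f (kscal c * a) b = c *: f a b.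
Hypothesis fZr : forall c a b, f a (kscal c * b) = c *: f a b.

Let lift0_exists : exists h : pmalg k X -> V,
  [/\ forall x y, h (x + y) = h x + h y, forall c x, h (c *: x) = c *: h x
    & forall a b, h (PT a b) = f a b].
Proof.
pose h (x : pmalg k X) := \sum_(p <- msupp x) x@_p *: f p.1 p.2.
have hE (d : {fset X}) x : (msupp x `<=` d)%fset -> h x = \sum_(p <- d) x@_p *: f p.1 p.2.
  by move=> le; apply: big_fset_incl => // p _ /mcoeff_outdom ->; rewrite scale0r.
exists h; split=> [x y|c x|a b].
- pose d := (msupp (x + y) `|` (msupp x `|` msupp y))%fset.
  have [d1 d2 d3] : [/\ msupp (x + y) `<=` d, msupp x `<=` d & msupp y `<=` d]%fset.
    by split; apply/fsubsetP => p pd; rewrite !inE pd ?orbT.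
  rewrite (hE d _ d1) (hE d _ d2) (hE d _ d3) -big_split.
  by apply: eq_bigr => p _ /=; rewrite mcoeffD scalerDl.
- rewrite (hE (msupp x)) ?msuppZ_le // scaler_sumr.
  by apply: eq_bigr => p _; rewrite mcoeffZ scalerA.
rewrite (hE [fset ((a, b) : X)]%fset) ?msuppU_le //.
by rewrite big_seq_fset1 mcoeffUU scale1r.
Qed.

(** The linear extension of [f] to the algebra on pairs kills the bilinearity relations
    multiplied by pairs on both sides, as these are bilinearity relations again. *)
Lemma tensor_lift : exists h : envalg A -> V, (forall u v, h (u + v) = h u + h v) /\
  forall a b, h (tensor a b) = f a b.
Proof.
have [h [hD hZ hE]] := lift0_exists.
have h0 : h 0 = 0 by apply: (addrI (h 0)); rewrite -hD !addr0.
have hB x y : h (x - y) = h x - h y by rewrite hD -[- y]scaleN1r hZ scaleN1r.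
have hrel r a b c d : env_rel r -> h (PT a b * r * PT c d) = 0.
  case=> [x x' y|x y y'|e x y|e x y].
  - rewrite !mulrBr !mulrBl !hB !pre_tensorM !hE mulrDr mulrDl fDl.
    by rewrite addrAC addrK subrr.
  - rewrite !mulrBr !mulrBl !hB !pre_tensorM !hE mulrDl mulrDr fDr.
    by rewrite addrAC addrK subrr.
  - rewrite !mulrBr !mulrBl !hB scale_in hZ !pre_tensorM !hE.
    by rewrite (mulrA a) -(kscalC e a) -!mulrA fZl subrr.
  rewrite !mulrBr !mulrBl !hB scale_in hZ !pre_tensorM !hE.
  by rewrite -!mulrA (mulrA d) -(kscalC e d) -!mulrA fZr subrr.
have hideal x : ideal (@env_rel k A) x -> h x = 0.
  apply: (ideal_ind (@pmalg_span k X) (F := fun x => h x = 0)) => [|y z hy hz|c y hy|a r b [[a1 a2] ->] rr [[b1 b2] ->]].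
  - exact: h0.
  - by rewrite hD hy hz addr0.
  - by rewrite [kscal c * y]pm_scalE hZ hy scaler0.
  exact: hrel.
exists (fun u => h (quotrepr u)); split=> [u v|a b].
  apply/eqP; rewrite -subr_eq0 -hD -hB; apply/eqP/hideal.
  by apply/quotpiP; rewrite quotpiD !quotreprK.
apply/eqP; rewrite -hE -subr_eq0 -hB; apply/eqP/hideal; exact: reprpi.
Qed.

End Lift.

Definition envalg_enveloping : enveloping A (envalg A) :=
  Enveloping tensorDl tensorDr tensorZl tensorZr tensorM tensor1 tensor_ind tensor_lift.

Definition bimod_regular : regular_bimodule envalg_enveloping (bimod A).
Proof.
by exists (fun a : A => (a : bimod A)) => //; [move=> y; exists y | exact: tensor_bimod].
Defined.

End EnvelopingAlgebra.

(** * Algebras given by quadratic relations *)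

Section QuotientModule.
Variables (R : pzRingType) (V : lmodType R) (G : V -> Prop).

Lemma modproj_exists : exists f : {linear V -> quotmod G}, forall x, f x = modpi G x.
Proof.
apply: linear_of => a x y; rewrite modpiD; congr (_ + _).
by rewrite -mod_scaleE.
Qed.

Definition modproj : {linear V -> quotmod G} := sval (cid modproj_exists).

Lemma modprojE x : modproj x = modpi G x.
Proof. by rewrite /modproj; case: cid. Qed.

Lemma modproj_surj y : exists x, modproj x = y.
Proof. by exists (modrepr y); rewrite modprojE; apply: modreprK. Qed.

Lemma modproj_eq0 x : modproj x = 0 <-> lspan G x.
Proof.
rewrite -(linear0 modproj) !modprojE.
by split=> [/modpiP|Gx]; [|apply/modpiP]; rewrite subr0.
Qed.

End QuotientModule.

Section QuadraticAlgebra.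
Variables (k : fieldType) (Q : quiver) (rho : path_algebra k Q -> Prop).
Hypothesis rho2 : forall x, rho x -> homog 2 x.
Local Notation T := (palg k Q).
Local Notation PA := (path_algebra k Q).
Implicit Types (x y z : T).

Lemma homog_hdeg i (x : PA) : homog i x -> hdeg i (x : T).
Proof. by move=> hx p; rewrite pcoefE; apply: hx. Qed.

Lemma hdeg_homog i x : hdeg i x -> homog i (of_palg x).
Proof. by move=> hx p; have := hx p; rewrite pcoefE. Qed.

Definition rel_ideal x : Prop := ideal rho (of_palg x).

Lemma rel_ideal_ind (U : submodule T) :
  (forall p r q, rho (of_palg r) -> U (pbase p * r * pbase q)) ->
  forall x, rel_ideal x -> U x.
Proof.
move=> Ur; apply: (ideal_ind (@pmalg_span k (qpath Q)) (F := fun x : PA => U (x : T))).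
- exact: smem0.
- by move=> x y Ux Uy; apply: (smemD (U := U) Ux Uy).
- by move=> c x Ux; have := smemZ c Ux; rewrite scaleE -pm_scalE.
move=> a r b [p ->] Gr [q ->].
by have := Ur p r q Gr; rewrite !mulE !pbaseE.
Qed.

Lemma rel_ideal0 : rel_ideal 0.
Proof. by exists [::]; rewrite big_nil. Qed.

Lemma rel_ideal_l a x : rel_ideal x -> rel_ideal (a * x).
Proof. by rewrite mulE; apply: idealMl. Qed.

Lemma rel_ideal_r a x : rel_ideal x -> rel_ideal (x * a).
Proof. by move=> Ix; rewrite /rel_ideal mulE; exact: (Defs.idealMr (of_palg a) Ix). Qed.

Lemma rel_idealL c x y : rel_ideal x -> rel_ideal y -> rel_ideal (c *: x + y).
Proof.
move=> Ix Iy; apply: idealD => //.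
by rewrite scaleE -pm_scalE; apply: idealMl.
Qed.

Definition rel_sub : submodule T := Submodule rel_ideal0 rel_idealL.

Lemma rel_ideal_gen x : rho (of_palg x) -> rel_ideal x.
Proof. by move=> rx; apply/quotpi_eq0; apply: quotpi_rel. Qed.

Lemma rel_degree p x q : rho (of_palg x) ->
  hdeg (plen p + 2 + plen q) (pbase p * x * pbase q).
Proof.
move=> /rho2/homog_hdeg rx.
apply: hdeg_mul (@hdeg_path k Q q); apply: hdeg_mul rx; exact: hdeg_path.
Qed.

Lemma rel_graded : graded rel_ideal.
Proof.
move=> P; have W0 : rel_ideal (res P 0) by rewrite linear0; apply: rel_ideal0.
have WL c x y : rel_ideal (res P x) -> rel_ideal (res P y) -> rel_ideal (res P (c *: x + y)).
  by move=> Wx Wy; rewrite linearD linearZZ; apply: rel_idealL.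
apply: (rel_ideal_ind (U := Submodule W0 WL)) => p r q /[dup] rr /rel_degree hr /=.
rewrite (res_hdeg _ (hr p q)); case: (P _); last exact: rel_ideal0.
exact/rel_ideal_r/rel_ideal_l/rel_ideal_gen.
Qed.

Lemma rel_geq2 x : rel_ideal x -> dgeq 2 x.
Proof.
apply: (rel_ideal_ind (U := degs_sub (fun n => 2 <= n)%N)) => p r q rr.
have le2 : (2 <= plen p + 2 + plen q)%N by rewrite addnAC leq_addl.
exact: (geqW le2 (hdeg_geq (rel_degree rr))).
Qed.

Definition rel_gideal : gideal k Q :=
  GIdeal (gid := rel_sub) rel_ideal_l rel_ideal_r rel_graded rel_geq2.

Definition rel_pr (x : T) : qalgebra rho := quotpi rho (of_palg x).

Fact rel_pr_zmod : zmod_morphism rel_pr.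
Proof. by move=> x y; apply: (quotpiB rho (of_palg x) (of_palg y)). Qed.

Fact rel_pr_monoid : monoid_morphism rel_pr.
Proof.
split; first by rewrite /rel_pr oneE.
by move=> x y; rewrite /rel_pr mulE; apply: (quotpiM rho (of_palg x) (of_palg y)).
Qed.

HB.instance Definition _ := GRing.isZmodMorphism.Build T (qalgebra rho) rel_pr rel_pr_zmod.
HB.instance Definition _ := GRing.isMonoidMorphism.Build T (qalgebra rho) rel_pr rel_pr_monoid.

Lemma rel_pr_surj (a : qalgebra rho) : exists x, rel_pr x = a.
Proof. by exists (quotrepr a : T); apply: quotreprK. Qed.

Lemma rel_pr_ker x : rel_pr x = 0 <-> rel_gideal x.
Proof. exact: quotpi_eq0. Qed.

Lemma rel_pr_scale c x : rel_pr (c *: x) = kscal c * rel_pr x.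
Proof.
by rewrite /rel_pr scaleE -pm_scalE; apply: (quotpiM rho (kscal c) (of_palg x)).
Qed.

Definition rel_presentation : presentation rel_gideal (qalgebra rho) :=
  Presentation (pr := rel_pr) rel_pr_surj rel_pr_ker rel_pr_scale.

Local Notation pi := rel_presentation.

(** ** The module A_0 *)

Definition posd (a : (qalgebra rho)^o) := exists2 i, (0 < i)%N & grade (rho := rho) i a.

Definition cls : {linear (qalgebra rho)^o -> A0mod rho} := modproj posd.

Lemma cls_surj (y : A0mod rho) : exists a, cls a = y.
Proof. exact: modproj_surj. Qed.

Lemma grade_pr i a : grade (rho := rho) i a -> exists2 x, hdeg i x & a = pi x.
Proof. by case=> x /homog_hdeg hx ->; exists (x : T). Qed.

Lemma grade_hdeg i x : hdeg i x -> grade (rho := rho) i (pi x).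
Proof. by move=> hx; exists (of_palg x) => //; apply: hdeg_homog. Qed.

Lemma cls_ker x : cls (pi x) = 0 <-> dgeq 1 x.
Proof.
split.
  move=> /modproj_eq0 [s [sG sE]].
  have {sG sE} [z gz zE] : exists2 z, dgeq 1 z & pi x = pi z.
    rewrite sE big_seq; elim/big_ind: _ => [|a b [y gy ->] [z gz ->]|[a b] /sG /= [i i0 /grade_pr[y hy ->]]].
    - by exists 0; rewrite ?rmorph0 //; apply: degs0.
    - by exists (y + z); rewrite ?rmorphD //; apply: degsD.
    have [u <-] := pr_surj pi a; exists (u * y); last by rewrite rmorphM.
    by apply: (@geq_mul _ _ 0 1) => //; apply: (geqW _ (hdeg_geq hy)).
  have Ixz : rel_gideal (x - z) by apply/(pr_ker pi); rewrite rmorphB zE subrr.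
  rewrite -[x](subrK z); apply: degsD => //.
  exact: (geqW _ (gid_geq2 Ixz)).
move=> /geq_sprod; elim=> [|y z _ hy _ hz|a y _ hy].
- by rewrite rmorph0 linear0.
- by rewrite rmorphD linearD hy hz addr0.
rewrite rmorphM -[_ * _]/(pi a *: (pi y : (qalgebra rho)^o)) linearZZ.
suff -> : cls (pi y) = 0 by rewrite scaler0.
apply/modproj_eq0; exists [:: (1, pi y : (qalgebra rho)^o)]; split=> [t|]; last by rewrite big_seq1 scale1r.
by rewrite inE => /eqP -> /=; exists 1%N => //; apply: grade_hdeg.
Qed.

End QuadraticAlgebra.

(** * The Hochschild cohomology of a Koszul algebra *)

Section KoszulAlgebra.
Variables (k : fieldType) (Q : quiver) (rho : path_algebra k Q -> Prop).
Hypothesis rho2 : forall x, rho x -> homog 2 x.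
Local Notation T := (palg k Q).
Local Notation I := (rel_gideal rho2).
Implicit Types (x y z : T).

Lemma quadR_quad x : quadR rho (of_palg x) -> quad I x.
Proof. by case=> Ix /homog_hdeg hx; split. Qed.

Lemma Kspace_sprod n x r s : Kspace rho n (of_palg x) -> (r + s + 2)%N = n ->
  sprod (sprod (hdeg r) (quad I)) (hdeg s) x.
Proof.
move=> Kx /Kx [l [lG xE]]; rewrite -[x]/(of_palg x) xE big_seq.
elim/big_ind: _ => [|y z Sy Sz|[c _] /lG /= [a [b [d [ha Rb hd ->]]]]].
- exact: sprod0.
- exact: (sprodD Sy Sz).
have -> : c *: (a * b * d) = (c *: (a : T)) * (b : T) * (d : T).
  by rewrite -!scaleT_mull scaleE !mulE.
apply: sprodM; last exact: homog_hdeg.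
apply: sprodM; last exact: quadR_quad.
by apply: degsZ; apply: homog_hdeg.
Qed.

Lemma Kspace_hdeg n x : Kspace rho n.+2 (of_palg x) -> hdeg n.+2 x.
Proof.
move=> /Kspace_sprod-/(_ 0%N n); rewrite add0n addn2 => /(_ erefl).
apply: (@sprod_sub _ _ _ _ (homS n.+2)) => y z Sy hz.
apply: (@hdeg_mul _ _ 2 n) => //.
move: Sy; apply: (@sprod_sub _ _ _ _ (homS 2)) => a b ha [_ hb].
exact: (hdeg_mul ha hb).
Qed.

Lemma Kspace_Kk n x : Kspace rho n.+2 (of_palg x) -> Kk I n.+2 x.
Proof.
by move=> Kx; split; [move=> r s; apply: Kspace_sprod | apply: Kspace_hdeg].
Qed.

Lemma is_grading_graded (M : lmodType (qalgebra rho)) g :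
  is_grading (M := M) g -> graded_module (rel_presentation rho2) g.
Proof.
case=> gB gM gS gU; split=> // i j a x ha; apply: gM; exact: grade_hdeg.
Qed.

End KoszulAlgebra.

Theorem corollary4p3 (k : fieldType) (Q : quiver)
    (rho : path_algebra k Q -> Prop) (n : nat) :
  (forall x, rho x -> homog 2 x) ->
  (2 <= n)%N ->
  Koszul rho ->
  gl_dim (qalgebra rho) n ->
  forall d : nat,
    dim_ge (coprod_eKe rho n) d -> HH_dim_ge (qalgebra rho) n d.
Proof.
move=> rho2; case: n => [|[|n]] // _ [P [g [gP gd ga gen]]] [gldim _] d [b [bK b_indep]].
pose pi := rel_presentation rho2.
have gP' i : graded_module pi (g i) := is_grading_graded rho2 (gP i).
have ga' j x : g 0%N j x -> j = 0 \/ paug P x = 0 by apply: ga.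
pose c j v : palg k Q := b j v.
have [P' P'0] := gldim (A0mod rho).
apply: (@Ext_lower_bound _ _ _ _ pi _ (envalg_enveloping (qalgebra rho)) _
  (bimod_regular (qalgebra rho)) _ n.+1 d c).
- move=> i x; exact: (left_exact (pi := pi) (@cls_surj _ _ rho) (cls_ker rho2) gP' gd ga' gen).
- move=> j v; have [x Kx bE] := bK j v.
  have Kc : Kk (rel_gideal rho2) n.+2 (pbase (ptriv v) * (x : palg k Q) * pbase (ptriv v)).
    apply: Kk_T0r; first exact: hdeg_idem.
    by apply: Kk_T0l; [apply: hdeg_idem | apply: (Kspace_Kk rho2 (x := x))].
  by move: Kc; rewrite !mulE pbaseE /c bE.
- move=> j v; have [x Kx bE] := bK j v.
  have -> : c j v = pbase (ptriv v) * (x : palg k Q) * pbase (ptriv v).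
    by rewrite !mulE pbaseE /c bE.
  by rewrite !mulrA idem_idem -!mulrA idem_idem.
- move=> a a0; apply: b_indep; apply/ffunP => v; rewrite sum_ffunE ffunE.
  rewrite -[RHS](a0 v); apply: eq_bigr => j _.
  by rewrite ffunE scaleE.
move=> x; exact: (K_vanish (pi := pi) (@cls_surj _ _ rho) (cls_ker rho2) gP' gd ga' gen P'0).
Qed.
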